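(* Let $Q\subset\mathbb{R}^d$ be a (measurable) set of finite measure, $h\in L^2(\mathbb{R}^d)$, and $\{A_j\in GL_d(\mathbb{R}) : j\in J\}$ a family of invertible matrices. For each $j\in J$ set $B_j=(A_j^T)^{-1}$, $S_j=B_j^{-1}Q=A_j^TQ$, and $h_j=h(B_j\,\cdot)$. Assume that $\{S_j : j\in J\}$ is a covering of $\mathbb{R}^d$, that $\{h_j\}_{j\in J}$ is a Riesz partition of unity with bounds $p$ and $P$, and that $\operatorname{supp}(h)\subset Q$. Let $X=\{x_{j,k}\in\mathbb{R}^d : j\in J,\ k\in K\}$ be such that for each $j\in J$ the set $\{e_{x_{j,k}}\chi_Q : k\in K\}$ is a frame for $\mathcal{K}_Q$ with lower and upper frame bounds $m_j$ and $M_j$ respectively. If $m:=\inf_j m_j>0$ and $M:=\sup_j M_j<+\infty$, then the collection $$\{|\det A_j|^{1/2}\psi(A_jx-x_{j,k}) : j\in J,\ k\in K\}$$ is a frame of $L^2(\mathbb{R}^d)$ with frame bounds $mp$ and $MP$, where $\psi$ is the inverse Fourier transform of $h$.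
   Context: $J$ and $K$ are countable index sets. $e_x(\xi)=e^{-i2\pi x\cdot\xi}$, and $\chi_Q$ is the characteristic function of $Q$. The Fourier transform is $\hat f(\xi)=\int f(x)e^{-i2\pi x\cdot \xi}\,dx$. For measurable $Q\subset\mathbb{R}^d$, $\mathcal{K}_Q=\{f\in L^2(\mathbb{R}^d) : \operatorname{supp}(f)\subset\overline{Q}\}$. A set of functions $\{g_j\}$ is a frame for a closed subspace $F$ of $L^2(\mathbb{R}^d)$ with lower and upper bounds $m,M$ ($0<m,M<+\infty$) if $g_j\in F$ for all $j$ and $m\|f\|^2\le\sum_j|\langle f,g_j\rangle|^2\le M\|f\|^2$ for all $f\in F$. A set $\{h_j\}_{j\in J}$ of measurable functions on $\mathbb{R}^d$ is a Riesz partition of unity with bounds $0<p\le P<+\infty$ if $p\le\sum_{j\in J}|h_j(x)|^2\le P$ for a.e. $x\in\mathbb{R}^d$. *)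

(* Defs.v *)
From HB Require Import structures.
From mathcomp Require Import all_boot all_order all_algebra.
From mathcomp Require Import all_classical all_reals all_analysis.
From mathcomp Require Import complex.

Set Implicit Arguments.
Unset Strict Implicit.
Unset Printing Implicit Defensive.
Import Order.TTheory GRing.Theory Num.Theory.
Import numFieldNormedType.Exports.
Local Open Scope classical_set_scope.
Local Open Scope ring_scope.
Local Open Scope complex_scope.

Section lebesgue_measure_Rd.
Context (R : realType) (d : nat).
Implicit Types (a b : 'cV[R]_d) (A : set 'cV[R]_d).

Definition box a b : set 'cV[R]_d :=
  [set x | forall i, a i 0 < x i 0 <= b i 0].

(* The maximum makes the volume of an empty box 0. *)
Definition box_vol a b : R := \prod_(i < d) Num.max 0 (b i 0 - a i 0).

Lemma box_vol_ge0 a b : 0 <= box_vol a b.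
Proof. by apply: prodr_ge0 => i _; rewrite le_max lexx. Qed.

Definition box_cover A (D : set ('cV[R]_d * 'cV[R]_d)) : Prop :=
  countable D /\ A `<=` \bigcup_(ab in D) box ab.1 ab.2.

Definition leb_outer A : \bar R :=
  ereal_inf [set (\esum_(ab in D) (box_vol ab.1 ab.2)%:E)%E
            | D in [set D | box_cover A D]].

Let leb_outer_ge0 A : (0 <= leb_outer A)%E.
Proof.
apply: le_ereal_inf_tmp => _ [D _ <-]; apply: esum_ge0 => ab _.
by rewrite lee_fin box_vol_ge0.
Qed.

Let leb_outer0 : (leb_outer set0 = 0)%E.
Proof.
apply/eqP; rewrite eq_le leb_outer_ge0 andbT.
apply: ereal_inf_lbound; exists set0; last by rewrite esum_set0.
by split; [exact: countable0|exact: sub0set].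
Qed.

Let le_leb_outer : {homo leb_outer : A B / A `<=` B >-> (A <= B)%E}.
Proof.
move=> A B AB; apply: ereal_inf_le_tmp => _ [D [cD BD] <-].
by exists D => //; split => //; exact: subset_trans BD.
Qed.

Let leb_outer_sigma_subadditive : sigma_subadditive leb_outer.
Proof.
move=> A; have [[i ioo]|] := pselect (exists i, leb_outer (A i) = +oo%E).
  rewrite (eseries_pinfty _ _ ioo) ?leey// => n _.
  by rewrite -ltNye (lt_le_trans _ (leb_outer_ge0 _)).
rewrite -forallNE => Aoo.
suff add2e (e : {posnum R}) :
    (leb_outer (\bigcup_n A n) <=
     \sum_(i <oo) leb_outer (A i) + e%:num%:E)%E.
  by apply/lee_addgt0Pr => _/posnumP[].
rewrite (le_trans _ (epsilon_trick _ _ _))//.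
pose vol ab := (box_vol ab.1 ab.2)%:E.
have vol0 ab : (0 <= vol ab)%E by rewrite lee_fin box_vol_ge0.
have [D PD] : {D : (set ('cV[R]_d * 'cV[R]_d))^nat & forall n,
    box_cover (A n) (D n) /\ (\esum_(ab in D n) vol ab <=
      leb_outer (A n) + (e%:num / (2 ^ n.+1)%:R)%:E)%E}.
  apply: (@choice _ _ (fun n D => box_cover (A n) D /\
    (\esum_(ab in D) vol ab <= leb_outer (A n) +
      (e%:num / (2 ^ n.+1)%:R)%:E)%E)) => n.
  have fin : leb_outer (A n) \is a fin_num.
    by rewrite ge0_fin_numE// ltey; apply/eqP; exact: Aoo.
  have en : (0 < e%:num / (2 ^ n.+1)%:R)%R by [].
  have [_ [D cD <-] Dlt] := lb_ereal_inf_adherent en fin.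
  by exists D; split => //; exact: ltW.
apply: (@le_trans _ _ (\esum_(ab in \bigcup_n D n) vol ab)).
  apply: ereal_inf_lbound; exists (\bigcup_n D n) => //; split.
    by apply: bigcup_countable => // n _; exact: (PD n).1.1.
  move=> x [n _ /((PD n).1.2)] [ab Dab xab].
  by exists ab => //; exists n.
rewrite seqDU_bigcup_eq nneseries_sum_bigcup//.
apply: lee_nneseries => [n _ _|n _]; first exact: esum_ge0.
apply: le_trans (PD n).2; apply: ge_ereal_sup => _ [X [finX XI] <-].
by apply: esum_ge; exists X => //; split => //;
  exact: subset_trans (@subset_seqDU _ _ _).
Qed.

HB.instance Definition _ := isOuterMeasure.Build R 'cV[R]_d leb_outer
  leb_outer0 leb_outer_ge0 le_leb_outer leb_outer_sigma_subadditive.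

End lebesgue_measure_Rd.

(* R^d as column vectors, with the sigma-algebra of Lebesgue-measurable (and
   not only Borel) sets; the topology used below is that of 'cV[R]_d. *)
Notation leb_space R d := (caratheodory_type (@leb_outer R d)).

Section lebesgue_measure_Rd_measure.
Context (R : realType) (d : nat).

Definition leb : set (leb_space R d) -> \bar R := @leb_outer R d.

Let leb_semi_sigma_additive : semi_sigma_additive leb.
Proof. exact: caratheodory_measure_sigma_additive. Qed.

HB.instance Definition _ := isMeasure.Build _ _ _ leb
  (outer_measure0 (@leb_outer R d)) (outer_measure_ge0 (@leb_outer R d))
  leb_semi_sigma_additive.

End lebesgue_measure_Rd_measure.
Arguments leb : clear implicits.

Section square_integrable.
Context (R : realType) (d : nat).
Local Notation mu := (leb R d).
Implicit Types (f g : 'cV[R]_d -> R[i]) (Q : set 'cV[R]_d).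

Definition cmeasurable f : Prop :=
  measurable_fun [set: leb_space R d] (fun x => complex.Re (f x)) /\
  measurable_fun [set: leb_space R d] (fun x => complex.Im (f x)).

(* Junk (componentwise) value if f is not integrable. *)
Definition cintegral f : R[i] :=
  (\int[mu]_x complex.Re (f x)) +i* (\int[mu]_x complex.Im (f x)).

Definition sqnorm2 f : \bar R := (\int[mu]_x (Normc.normc (f x) ^+ 2)%:E)%E.

(* Elements of L^2 are represented by everywhere defined functions; all the
   notions below are invariant under equality almost everywhere. *)
Definition L2 : set ('cV[R]_d -> R[i]) :=
  [set f | cmeasurable f /\ (sqnorm2 f < +oo)%E].

Definition inner2 f g : R[i] := cintegral (fun x => f x * (g x)^*).

(* Support of a class of functions modulo equality a.e.: the complement of the
   largest open set on which f vanishes a.e. *)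
Definition supp f : set 'cV[R]_d :=
  ~` \bigcup_(U in [set U : set 'cV[R]_d |
       open U /\ {ae mu, forall x, U x -> f x = 0}]) U.

Definition K_ Q : set ('cV[R]_d -> R[i]) :=
  [set f | L2 f /\ supp f `<=` closure Q].

Definition is_frame (I : choiceType) (F : set ('cV[R]_d -> R[i]))
    (g : I -> 'cV[R]_d -> R[i]) (m M : R) : Prop :=
  [/\ 0 < m, 0 < M, forall i, F (g i) & forall f, F f ->
    (m%:E * sqnorm2 f <= \esum_(i in [set: I]) (Normc.normc (inner2 f (g i)) ^+ 2)%:E
       <= M%:E * sqnorm2 f)%E].

Definition Riesz_partition_of_unity (J : choiceType)
    (h : J -> 'cV[R]_d -> R[i]) (p P : R) : Prop :=
  [/\ 0 < p, p <= P, forall j, cmeasurable (h j) &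
    {ae mu, forall x,
      (p%:E <= \esum_(j in [set: J]) (Normc.normc (h j x) ^+ 2)%:E <= P%:E)%E}].

Definition dotp (x y : 'cV[R]_d) : R := \sum_(i < d) x i 0 * y i 0.

Definition expi (t : R) : R[i] := cos t +i* sin t.

Definition e_ (x : 'cV[R]_d) : 'cV[R]_d -> R[i] :=
  fun xi => expi (- (2 * pi * dotp x xi)).

Definition charf Q : 'cV[R]_d -> R[i] := fun x => (\1_Q x)%:C.

(* Meaningful for integrable h; an h in L^2 whose support is contained in a
   set of finite measure is integrable. *)
Definition inv_fourier (h : 'cV[R]_d -> R[i]) : 'cV[R]_d -> R[i] :=
  fun x => cintegral (fun xi => h xi * expi (2 * pi * dotp x xi)).

End square_integrable.

(* Main.v *)
(* The transform of s is paired with the frame of K_Q block by block: by Fubini,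
   the inner product of s with |det A_j|^(1/2) psi(A_j y - x) equals that of
   F_j(xi) = |det A_j|^(1/2) s^(A_j^T xi) conj(h(xi)), an element of K_Q, with
   e_x chi_Q.  The frame inequality in K_Q thus bounds the sum over k by
   multiples of ||F_j||^2, which is the integral of |s^|^2 |h_j|^2 after the
   substitution xi = B_j eta; summing over j brings in the Riesz partition of
   unity, and Plancherel's theorem turns ||s^|| into ||s||.

   It suffices to do this for step functions s (finite combinations of
   indicators of boxes): they are dense, and both sides of each inequality are
   quadratic forms continuous at 0, the upper bound being needed for the
   continuity used in the lower one.  For step functions Plancherel's theorem
   reduces, by tensorization, to the one-dimensional integral of
   (1 - cos(t xi)) / xi^2.  That the frame elements are in L^2 follows from
   Fatou's lemma along step functions converging to h in L^1 and in L^2. *)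

Require Import Defs.
From HB Require Import structures.
From mathcomp Require Import all_boot all_order all_algebra.
From mathcomp Require Import all_classical all_reals all_analysis.
From mathcomp Require Import measurable_realfun measurable_fun_approximation.
From mathcomp Require Import simple_functions complex.
From mathcomp Require Import ring lra.

Set Implicit Arguments.
Unset Strict Implicit.
Unset Printing Implicit Defensive.
Import Order.TTheory GRing.Theory Num.Theory.
Import numFieldNormedType.Exports.
Local Open Scope classical_set_scope.
Local Open Scope complex_scope.
Local Open Scope ring_scope.
Import Normc.

(** * Enumeration of countable sets *)

Section countable_enumeration.

(** The transform is only meaningful on integrable functions, so the transform of a general element
    of L^2 is never formed. On step functions Plancherel's theorem is an equality of Gram matrices:
    the inner product of two boxes, like that of their transforms, is the volume of their
    intersection. In dimension one, the length of an overlap is a combination of absolute values of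
    differences of endpoints, and [|t| / 2] is the integral of a Fejer kernel.

    Two sigma-algebras are needed. Caratheodory sets are stable under preimages by invertible linear
    maps, which the substitution uses; sets generated by boxes split as products, which
    tensorization uses. Integrals move between them along the identity map. The effect of a linear
    map is computed on outer measures of arbitrary sets, so that it yields measurability of
    preimages as well.

    The passage to the limit avoids square roots and tolerates infinite values: Minkowski's
    inequality is replaced by one with a free parameter [eta], whose main factor [1 + eta] tends to
    1, so that the constants [m * p] and [M * P] survive exactly. *)

Lemma countable_set_image (T : choiceType) (D : set T) : countable D ->
  D = set0 \/ exists (P : set nat) (e : nat -> T), set_inj P e /\ D = e @` P.
Proof.
have [->|/set0P[x0 Dx0]] := eqVneq D set0; first by left.
move=> /countable_injP[f]; right.
exists (f @` D), ('pinv_(fun=> x0) D f); split.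
  move=> _ _ /set_mem[x Dx <-] /set_mem[y Dy <-].
  by rewrite !pinvKV ?inE// => ->.
apply/seteqP; split=> [x Dx|_ [_ [x Dx <-] <-]]; last by rewrite pinvKV ?inE.
by exists (f x); [exists x|rewrite pinvKV ?inE].
Qed.

End countable_enumeration.

Lemma ge0_esumZl (R : realType) (T : choiceType) (D : set T) (c : R)
    (f : T -> \bar R) : 0 < c -> (forall i, 0 <= f i)%E ->
  (\esum_(i in D) (c%:E * f i) = c%:E * \esum_(i in D) f i)%E.
Proof.
move=> c0 f0; rewrite /esum -ereal_sup_pZl// image_comp/=.
congr ereal_sup; apply: eq_imagel => A [finA _] /=.
by rewrite ge0_mule_fsumr.
Qed.

(** * Lebesgue measure on R^d *)

Section box_measure.
Context (R : realType).

Definition tailcv d (x : 'cV[R]_d.+1) : 'cV[R]_d := \col_j x (lift ord0 j) 0.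

Definition conscv d (t : R) (v : 'cV[R]_d) : 'cV[R]_d.+1 :=
  \col_i (if unlift ord0 i is Some j then v j 0 else t).

Lemma conscv0 d t (v : 'cV[R]_d) : conscv t v ord0 0 = t.
Proof. by rewrite mxE unlift_none. Qed.

Lemma tailcvK d t (v : 'cV[R]_d) : tailcv (conscv t v) = v.
Proof. by apply/colP => i; rewrite !mxE liftK. Qed.

Lemma box_consE d (a b x : 'cV[R]_d.+1) :
  box a b x <-> a ord0 0 < x ord0 0 <= b ord0 0 /\
                box (tailcv a) (tailcv b) (tailcv x).
Proof.
split=> [abx|[abx0 abx] i]; first by split=> [|i]; rewrite ?mxE; exact: abx.
have [j ->|-> //] := unliftP ord0 i.
by have := abx j; rewrite !mxE.
Qed.

Lemma box_vol_consE d (a b : 'cV[R]_d.+1) :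
  box_vol a b = Num.max 0 (b ord0 0 - a ord0 0) *
                box_vol (tailcv a) (tailcv b).
Proof.
rewrite /box_vol big_ord_recl; congr (_ * _).
by apply: eq_bigr => i _; rewrite !mxE.
Qed.

Lemma lebesgue_measure_oc (a b : R) :
  lebesgue_measure `]a, b] = (Num.max 0 (b - a))%:E.
Proof.
rewrite lebesgue_measure_itv/= lte_fin; case: ltP => ab.
  by rewrite max_r ?subr_ge0 ?ltW// EFinB.
by rewrite max_l ?subr_le0.
Qed.

(** Slicing replaces the usual compactness argument. For t in the first side of the covered box, the
    tails of the boxes whose first side contains t cover its tail, so the induction hypothesis
    bounds the volume of the tail; integrating in t against the one-dimensional measure concludes.
    The predicate [P] lets the induction hypothesis be used on just the boxes that a slice meets. *)
Lemma box_vol_le_nneseries d (a0 b0 : 'cV[R]_d) (P : pred nat)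
    (a b : nat -> 'cV[R]_d) :
  box a0 b0 `<=` \bigcup_(n in [set n | P n]) box (a n) (b n) ->
  ((box_vol a0 b0)%:E <= \sum_(n <oo | P n) (box_vol (a n) (b n))%:E)%E.
Proof.
elim: d a0 b0 P a b => [|d IHd] a0 b0 P a b cov.
  (* In dimension 0 every box is the whole point, of volume 1, so one covering box suffices. *)
  have vol1 (u v : 'cV[R]_0) : box_vol u v = 1 by rewrite /box_vol big_ord0.
  have [|n /= Pn _] := cov 0; first by move=> [].
  rewrite vol1 nneseries_esum; last by move=> m _; rewrite vol1 lee_fin.
  apply: esum_ge; exists [set n]; first by split => // m ->.
  by rewrite fsbig_set1 !vol1.
pose I := `]a0 ord0 0, b0 ord0 0]%classic : set R.
pose In n := `]a n ord0 0, b n ord0 0]%classic : set R.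
pose l n := box_vol (tailcv (a n)) (tailcv (b n)).
have slice t : I t -> ((box_vol (tailcv a0) (tailcv b0))%:E <=
    \sum_(n <oo | P n) (l n)%:E * (\1_(In n) t)%:E)%E.
  move=> It.
  apply: (le_trans (IHd (tailcv a0) (tailcv b0) (fun n => P n && (t \in In n))
    (fun n => tailcv (a n)) (fun n => tailcv (b n)) _)).
    move=> v abv.
    have [|n /= Pn /box_consE[]] := cov (conscv t v).
      apply/box_consE; rewrite conscv0 tailcvK; split => //.
    rewrite conscv0 tailcvK => tn abnv; exists n => //=; rewrite Pn inE/=.
    by rewrite /In/= in_itv.
  rewrite eseries_mkcond [leRHS]eseries_mkcond.
  apply: lee_nneseries => n _.
    by move=> _; case: ifP => // _; rewrite lee_fin box_vol_ge0.
  rewrite indicE; case: (P n) => //=; case: (t \in In n) => /=.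
    by rewrite mule1.
  by rewrite mule0.
have mI : measurable I by exact: measurable_itv.
have mf n : measurable_fun I (fun t : R => (l n)%:E * (\1_(In n) t)%:E : \bar R)%E.
  apply: measurable_funeM; apply/measurable_EFinP.
  by apply: measurable_indic; exact: measurable_itv.
have f0 n t : (0 <= (l n)%:E * (\1_(In n) t)%:E)%E.
  by rewrite mule_ge0// lee_fin// box_vol_ge0.
have msum : measurable_fun I
    (fun t : R => \sum_(n <oo | P n) (l n)%:E * (\1_(In n) t)%:E : \bar R)%E.
  by apply: ge0_emeasurable_sum.
have lI (u v : 'cV[R]_d.+1) :
    (lebesgue_measure (`](u ord0 0)%R, (v ord0 0)%R]%classic : set R) *
      (box_vol (tailcv u) (tailcv v))%:E = (box_vol u v)%:E)%E.
  by rewrite lebesgue_measure_oc -EFinM -box_vol_consE.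
have := integral_cst lebesgue_measure mI (box_vol (tailcv a0) (tailcv b0))%:E.
rewrite muleC lI => <-.
apply: (@le_trans _ _ (\int[lebesgue_measure]_(t in I)
    \sum_(n <oo | P n) (l n)%:E * (\1_(In n) t)%:E)%E).
  by apply: ge0_le_integral => // t _; rewrite lee_fin box_vol_ge0.
under eq_integral do rewrite eseries_mkcond.
rewrite integral_nneseries//; last first.
- by move=> n t _; case: ifP.
- by move=> n; case: (P n); [exact: mf|exact: measurable_cst].
rewrite [leRHS]eseries_mkcond; apply: lee_nneseries => n _.
  by move=> _; apply: integral_ge0 => t _; case: ifP.
case: (P n); last by rewrite integral0.
rewrite ge0_integralZl//=; last 2 first.
- by apply/measurable_EFinP; apply: measurable_indic; exact: measurable_itv.
- by rewrite lee_fin box_vol_ge0.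
rewrite integral_indic//; last exact: measurable_itv.
rewrite -(lI (a n)) muleC lee_wpmul2r ?lee_fin ?box_vol_ge0//.
have mIn : measurable (In n) by exact: measurable_itv.
by apply: le_measure; rewrite ?inE//; exact: measurableI.
Qed.

Lemma leb_outer_esum d (T : choiceType) (D : set T) (F : T -> set 'cV[R]_d) E :
  countable D -> E `<=` \bigcup_(i in D) F i ->
  (leb_outer E <= \esum_(i in D) leb_outer (F i))%E.
Proof.
move=> /countable_set_image[->|[P [e [einj ->]]]].
  rewrite bigcup_set0 subset0 => ->.
  by rewrite outer_measure0 esum_set0.
rewrite bigcup_image => EF; rewrite esum_set_image//; last first.
  by move=> n _; exact: outer_measure_ge0.
rewrite eseries_mkcond.
apply: le_trans (@le_outer_measure R _ (@leb_outer R d) _ _ _)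
  (le_trans (@outer_measure_sigma_subadditive R _ (@leb_outer R d)
    (fun n => if n \in P then F (e n) else set0)) _).
  by move=> x /EF[n Pn xn]; exists n => //; rewrite mem_set.
apply: lee_nneseries => n _; first by rewrite outer_measure_ge0.
by case: ifP => // _; rewrite outer_measure0.
Qed.

Lemma leb_outer_box d (a b : 'cV[R]_d) :
  leb_outer (box a b) = (box_vol a b)%:E.
Proof.
apply/eqP; rewrite eq_le; apply/andP; split.
  apply: ereal_inf_lbound; exists [set (a, b)].
    by split; [exact: countable1|move=> x abx; exists (a, b)].
  by rewrite esum_set1// lee_fin box_vol_ge0.
apply: le_ereal_inf_tmp => _ [D [cD covD] <-].
have [D0|[P [e [einj De]]]] := countable_set_image cD.
  rewrite D0 esum_set0.
  have := @box_vol_le_nneseries d a b pred0 (fun=> 0) (fun=> 0).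
  rewrite eseries_pred0//; apply.
  by move=> x /covD[ab]; rewrite D0.
rewrite De esum_set_image//; last first.
  by move=> n _; rewrite lee_fin box_vol_ge0.
apply: (box_vol_le_nneseries (a := fun n => (e n).1) (b := fun n => (e n).2)).
move=> x /covD[ab]; rewrite De => -[n Pn <-] xab.
by exists n => //=; rewrite mem_set.
Qed.

(** The outer measure is an infimum over covers by boxes, and f maps a cover of E to a cover of its
    image; hence a bound on boxes is enough. *)
Lemma leb_outer_image_le d (C : R) (f : 'cV[R]_d -> 'cV[R]_d)
    (E : set 'cV[R]_d) : 0 < C ->
  (forall a b, leb_outer (f @` box a b) <= (C * box_vol a b)%:E)%E ->
  (leb_outer (f @` E) <= C%:E * leb_outer E)%E.
Proof.
move=> C0 fC; rewrite -lee_pdivrMl//.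
apply: le_ereal_inf_tmp => _ [D [cD covD] <-].
rewrite lee_pdivrMl// -ge0_esumZl//; last first.
  by move=> ab; rewrite lee_fin box_vol_ge0.
apply: le_trans (leb_outer_esum cD (F := fun ab => f @` box ab.1 ab.2) _) _.
  by rewrite -image_bigcup; exact: image_subset.
by apply: le_esum => ab _; rewrite -EFinM.
Qed.

(** Covering a test set by boxes and cutting each of them by A reduces Caratheodory's criterion to
    boxes. *)
Lemma caratheodory_box d (A : set 'cV[R]_d) :
  (forall a b, leb_outer (box a b `&` A) + leb_outer (box a b `&` ~` A) <=
    (box_vol a b)%:E)%E ->
  measurable (A : set (leb_space R d)).
Proof.
move=> Abox; apply: le_caratheodory_measurable => X.
apply: le_ereal_inf_tmp => _ [D [cD covD] <-].
apply: (@le_trans _ _ (\esum_(ab in D)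
    (leb_outer (box ab.1 ab.2 `&` A) + leb_outer (box ab.1 ab.2 `&` ~` A))))%E.
  rewrite esumD; try by move=> *; exact: outer_measure_ge0.
  by apply: leeD; apply: leb_outer_esum => // x [/covD[ab Dab xab] Ax];
    exists ab.
by apply: le_esum.
Qed.

Definition updcv d (x : 'cV[R]_d) i t : 'cV[R]_d :=
  \col_k (if k == i then t else x k 0).

Lemma box_volD1 d (a b : 'cV[R]_d) i :
  box_vol a b = Num.max 0 (b i 0 - a i 0) *
    \prod_(k < d | k != i) Num.max 0 (b k 0 - a k 0).
Proof. by rewrite /box_vol (bigD1 i). Qed.

(** The half-space and its complement cut a box into two boxes whose i-th sides add up to the
    original one; the maximum and minimum also cover the case where c lies outside that side. *)
Lemma measurable_halfspace d (i : 'I_d) c :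
  measurable ([set x : 'cV[R]_d | x i 0 <= c] : set (leb_space R d)).
Proof.
apply: caratheodory_box => a b.
set A := [set x | _].
pose b' := updcv b i (Num.min (b i 0) c).
pose a' := updcv a i (Num.max (a i 0) c).
apply: (@le_trans _ _ (leb_outer (box a b') + leb_outer (box a' b))%E).
  apply: leeD; apply: le_outer_measure => x [abx Ax] k.
    rewrite mxE; case: eqVneq => [->|_]; last exact: abx.
    by have /andP[-> xb] := abx i; rewrite le_min xb.
  rewrite mxE; case: eqVneq => [->|_]; last exact: abx.
  have /andP[xa xb] := abx i; rewrite gt_max xa xb andbT /=.
  by rewrite ltNge; exact/negP.
rewrite !leb_outer_box -EFinD lee_fin !(box_volD1 _ _ i) !mxE eqxx.
set p := \prod_(k < d | k != i) _.
set p1 := \prod_(k < d | k != i) _.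
set p2 := \prod_(k < d | k != i) _.
have -> : p = p2.
  by apply: eq_bigr => k /negbTE ki; rewrite mxE ki.
have -> : p1 = p2.
  by apply: eq_bigr => k /negbTE ki; rewrite mxE ki.
rewrite -mulrDl ler_wpM2r//.
  by apply: prodr_ge0 => k _; rewrite le_max lexx.
by rewrite /Num.max /Num.min; repeat case: ifPn; lra.
Qed.

End box_measure.

(** * Generation of the linear group by elementary matrices *)

Section elementary_matrices.
Context (F : fieldType).

(** A transvection when i and j differ, the dilation of one coordinate by [1 + a] when they agree; a
    single family covers both kinds of generators. *)
Definition elem_mx n (i j : 'I_n) (a : F) : 'M[F]_n := 1%:M + a *: delta_mx i j.

Lemma elem_mxE n (i j : 'I_n) a k l :
  elem_mx i j a k l = (k == l)%:R + a * ((k == i) && (l == j))%:R.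
Proof. by rewrite !mxE. Qed.

Lemma elem_block_lift n (i j : 'I_n) a :
  elem_mx (rshift 1 i) (rshift 1 j) a = block_mx 1%:M 0 0 (elem_mx i j a).
Proof.
rewrite /elem_mx (scalar_mx_block 1 n 1).
rewrite -[delta_mx _ _ in LHS]submxK scale_block_mx add_block_mx.
congr block_mx; apply/matrixP => k l; rewrite !mxE ?eq_rshift ?eq_lrshift//.
all: by rewrite ?(andbF, andFb, mulr0, addr0).
Qed.

Lemma elem_block_corner n a :
  elem_mx (lshift n (0 : 'I_1)) (lshift n 0) (a - 1) = block_mx a%:M 0 0 1%:M.
Proof.
rewrite /elem_mx (scalar_mx_block 1 n 1).
rewrite -[delta_mx _ _ in LHS]submxK scale_block_mx add_block_mx.
congr block_mx; apply/matrixP => k l; rewrite !mxE ?eq_lshift ?eq_rlshift//.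
- by rewrite !ord1 eqxx/= mulr1 mulr1n addrC subrK.
all: by rewrite ?(andbF, andFb, mulr0, addr0).
Qed.

Lemma elem_block_col n (i : 'I_n) a :
  elem_mx (rshift 1 i) (lshift n 0) a =
  block_mx 1%:M 0 (a *: delta_mx i 0) 1%:M.
Proof.
rewrite /elem_mx (scalar_mx_block 1 n 1).
rewrite -[delta_mx _ _ in LHS]submxK scale_block_mx add_block_mx.
congr block_mx; apply/matrixP => k l;
  rewrite !mxE ?eq_rshift ?eq_lshift ?eq_lrshift ?eq_rlshift//.
all: by rewrite ?(andbF, andFb, mulr0, addr0, add0r).
Qed.

Lemma elem_block_row n (i : 'I_n) a :
  elem_mx (lshift n 0) (rshift 1 i) a =
  block_mx 1%:M (a *: delta_mx 0 i) 0 1%:M.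
Proof.
rewrite /elem_mx (scalar_mx_block 1 n 1).
rewrite -[delta_mx _ _ in LHS]submxK scale_block_mx add_block_mx.
congr block_mx; apply/matrixP => k l;
  rewrite !mxE ?eq_rshift ?eq_lshift ?eq_lrshift ?eq_rlshift//.
all: by rewrite ?(andbF, andFb, mulr0, addr0, add0r).
Qed.

(** Gaussian elimination as an induction principle: a property that is stable under products and
    holds for elementary matrices holds on the whole linear group. *)
Lemma unitmx_elem_ind n (P : 'M[F]_n -> Prop) :
  P 1%:M -> (forall A B, P A -> P B -> P (A *m B)) ->
  (forall i j a, (i != j) || (1 + a != 0) -> P (elem_mx i j a)) ->
  forall A, A \in unitmx -> P A.
Proof.
elim: n P => [|n IHn]; last rewrite -[n.+1]/(1 + n)%N; move=> P P1 PM Pe A uA.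
  by rewrite [A]flatmx0 -[0](flatmx0 1%:M).
have {}IHn C : C \in unitmx ->
    P (block_mx 1%:M 0 0 C : 'M[F]_(1 + n)).
  apply: (IHn (fun C => P (block_mx 1%:M 0 0 C : 'M[F]_(1 + n)))).
  - by rewrite -scalar_mx_block.
  - move=> B D PB PD; have := PM _ _ PB PD.
    by rewrite mulmx_block !mulmx0 !mul0mx !addr0 !add0r mul1mx.
  - move=> i j a ija; rewrite -elem_block_lift; apply: Pe.
    by rewrite eq_rshift.
have Pcol (v : 'cV_n) : P (block_mx 1%:M 0 v 1%:M : 'M[F]_(1 + n)).
  rewrite [v]matrix_sum_delta.
  under eq_bigr do rewrite big_ord1.
  apply: (big_ind (fun v => P (block_mx 1%:M 0 v 1%:M : 'M[F]_(1 + n)))).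
  - by rewrite -scalar_mx_block.
  - move=> u w Pu Pw; have := PM _ _ Pu Pw.
    by rewrite mulmx_block !mulmx0 !mul0mx !addr0 !add0r !mul1mx !mulmx1.
  - move=> i _; rewrite -elem_block_col; apply: Pe.
    by rewrite eq_rlshift.
have Prow (v : 'rV_n) : P (block_mx 1%:M v 0 1%:M : 'M[F]_(1 + n)).
  rewrite [v]matrix_sum_delta big_ord1.
  apply: (big_ind (fun v => P (block_mx 1%:M v 0 1%:M : 'M[F]_(1 + n)))).
  - by rewrite -scalar_mx_block.
  - move=> u w Pu Pw; have := PM _ _ Pu Pw.
    by rewrite mulmx_block !mulmx0 !mul0mx !addr0 !add0r !mul1mx !mulmx1 addrC.
  - move=> i _; rewrite -elem_block_row; apply: Pe.
    by rewrite eq_lrshift.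
(* A zero corner is repaired by adding to row 0 a row k with a nonzero entry in column 0; it exists
   because the determinant expands along that column. *)
wlog A00 : A uA / A 0 0 != 0 => [PA|].
  have [A00|] := eqVneq (A 0 0) 0; last exact: PA.
  have [k Ak0] : exists k, A k 0 != 0.
    apply/existsP; rewrite -negb_forall; apply/negP => /forallP A0.
    move: uA; rewrite unitmxE (expand_det_col _ 0) big1 ?unitr0//.
    by move=> i _; rewrite (eqP (A0 i)) mul0r.
  have k0 : 0 != k by apply: contraNneq Ak0 => <-; rewrite A00.
  have elemM (t u : F) : elem_mx 0 k t *m elem_mx 0 k u = elem_mx 0 k (t + u).
    rewrite /elem_mx mulmxDl !mulmxDr !mul1mx !mulmx1 -scalemxAl -scalemxAr.
    by rewrite mul_delta_mx_0 1?eq_sym// !scaler0 addr0 -addrA [_ + t *: _]addrC -scalerDl.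
  have -> : A = elem_mx 0 k (-1) *m (elem_mx 0 k 1 *m A).
    by rewrite mulmxA elemM addNr /elem_mx scale0r addr0 mul1mx.
  apply: PM; first by apply: Pe; rewrite k0.
  apply: PA.
    rewrite unitmx_mul uA andbT.
    suff : elem_mx 0 k (-1) *m elem_mx 0 k 1 \in unitmx.
      by rewrite unitmx_mul => /andP[].
    by rewrite elemM addNr /elem_mx scale0r addr0 unitmx1.
  rewrite /elem_mx mulmxDl mul1mx scale1r mxE A00 add0r mxE (bigD1 k)//=.
  rewrite big1 ?addr0; first by rewrite mxE !eqxx/= mul1r.
  by move=> i ik; rewrite mxE (negbTE ik) andbF mul0r.
move: uA; rewrite -[A](@submxK _ 1 n 1 n).
set w := ursubmx _; set v := dlsubmx _; set C := drsubmx _.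
have -> : ulsubmx (A : 'M[F]_(1 + n)) = (A 0 0)%:M.
  apply/matrixP => i j; rewrite !ord1 !mxE eqxx mulr1n.
  by congr (A _ _); apply/val_inj.
move: (A 0 0) A00 => a a0.
(* Block LU factorization with pivot a; the remaining block is the Schur complement, which is
   invertible because the whole product is. *)
have -> : block_mx a%:M w v C = block_mx 1%:M 0 (a^-1 *: v) 1%:M *m
    (elem_mx (lshift n 0) (lshift n 0) (a - 1) *m
     block_mx 1%:M 0 0 (C - a^-1 *: (v *m w))) *m
    block_mx 1%:M (a^-1 *: w) 0 1%:M :> 'M[F]_(1 + n).
  rewrite elem_block_corner !mulmx_block !(mulmx0, mul0mx, addr0, add0r).
  rewrite !(mulmx1, mul1mx) mul_scalar_mx mul_mx_scalar !scalerA divff//.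
  by rewrite !scale1r -scalemxAr addrC subrK.
rewrite !unitmx_mul => /andP[/andP[_ /andP[_ uM]] _].
apply: (PM _ _ (PM _ _ (Pcol _) (PM _ _ _ (IHn _ _))) (Prow _)).
  by apply: Pe; rewrite addrC subrK a0 orbT.
by move: uM; rewrite !unitmxE det_ublock det1 mul1r.
Qed.

Lemma det_elem_mx n (i j : 'I_n) a : \det (elem_mx i j a) = 1 + a * (i == j)%:R.
Proof.
wlog ji : i j / (j <= i)%N => [detE|].
  have [/detE//|/ltnW/detE] := leqP j i.
  by rewrite -det_tr /elem_mx linearD linearZ/= trmx1 trmx_delta [i == j]eq_sym.
rewrite det_trig; last first.
  apply/is_trig_mxP => k l kl; rewrite elem_mxE -val_eqE/= ltn_eqF// add0r.
  case: eqP => [ki|]; rewrite ?mulr0//=; case: eqP => [lj|]; rewrite ?mulr0//.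
  by move: kl; rewrite ki lj ltnNge ji.
rewrite (bigD1 i)//= big1 ?mulr1; first by rewrite elem_mxE !eqxx.
by move=> k ki; rewrite elem_mxE eqxx (negbTE ki) mulr0 addr0.
Qed.

End elementary_matrices.

(** * Lebesgue outer measure under linear maps *)

Section linear_image.
Context (R : realType).

Lemma box_set0 d (a b : 'cV[R]_d) i : b i 0 <= a i 0 -> box a b = set0.
Proof.
move=> ba; apply/seteqP; split => // x /(_ i)/andP[ax xb].
by have := lt_le_trans ax (le_trans xb ba); rewrite ltxx.
Qed.

Lemma elem_mx_mulE d (i j : 'I_d) (c : R) (x : 'cV[R]_d) k :
  (elem_mx i j c *m x) k 0 = x k 0 + c * x j 0 * (k == i)%:R.
Proof.
rewrite mulmxDl mul1mx mxE; congr (_ + _); rewrite mxE (bigD1 j)//= big1.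
  by rewrite !mxE eqxx andbT addr0 mulrAC.
by move=> l lj; rewrite !mxE (negbTE lj) andbF mulr0 mul0r.
Qed.

(** A negative factor reverses the half-open side and a zero factor collapses it, so the image need
    not be a box. It is enclosed in a box lowered by a margin [e'], which is then sent to 0. *)
Lemma leb_outer_scale_box d (i : 'I_d) (c : R) (a b : 'cV[R]_d) :
  (leb_outer (mulmx (elem_mx i i (c - 1)) @` box a b) <=
   (`|c| * box_vol a b)%:E)%E.
Proof.
have [ba|ab] := leP (b i 0) (a i 0).
  by rewrite (box_set0 ba) image_set0 outer_measure0 lee_fin
    mulr_ge0// box_vol_ge0.
set p := \prod_(k < d | k != i) Num.max 0 (b k 0 - a k 0).
have p0 : 0 <= p by apply: prodr_ge0 => k _; rewrite le_max lexx.
apply/lee_addgt0Pr => e e0.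
(* The margin adds [e' * p <= e] to the volume; [p + 1] avoids dividing by 0 when another side is
   empty. *)
pose e' := e / (p + 1).
have e'0 : 0 < e' by rewrite divr_gt0// ltr_wpDl.
pose a' := updcv a i (Num.min (c * a i 0) (c * b i 0) - e').
pose b' := updcv b i (Num.max (c * a i 0) (c * b i 0)).
apply: (@le_trans _ _ (leb_outer (box a' b'))).
  apply: le_outer_measure => _ [x abx <-] k.
  rewrite elem_mx_mulE !mxE; case: eqVneq => [->|_]; last first.
    by rewrite mulr0 addr0; exact: abx.
  have -> : x i 0 + (c - 1) * x i 0 * true%:R = c * x i 0 by rewrite mulr1; ring.
  have /andP[ax xb] := abx i.
  have minlt y : Num.min (c * a i 0) (c * b i 0) <= y ->
      Num.min (c * a i 0) (c * b i 0) - e' < y.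
    by move=> ?; rewrite ltrBlDr (le_lt_trans (y := y)) ?ltrDl.
  apply/andP; split.
    apply: minlt; rewrite ge_min; have [c0|c0] := leP 0 c.
      by rewrite ler_wpM2l// ltW.
    by rewrite orbC ler_nM2l// xb.
  rewrite le_max; have [c0|c0] := leP 0 c; first by rewrite orbC ler_wpM2l.
  by rewrite ler_nM2l// ltW.
rewrite leb_outer_box -EFinD lee_fin !(box_volD1 _ _ i) !mxE eqxx.
have -> : \prod_(k < d | k != i) Num.max 0 (b' k 0 - a' k 0) = p.
  by apply: eq_bigr => k /negbTE ki; rewrite !mxE ki.
rewrite -/p.
have -> : Num.max 0 (Num.max (c * a i 0) (c * b i 0) -
    (Num.min (c * a i 0) (c * b i 0) - e')) = `|c| * (b i 0 - a i 0) + e'.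
  have [c0|c0] := leP 0 c.
    have h : c * a i 0 <= c * b i 0 by rewrite ler_wpM2l// ltW.
    by rewrite (max_r h) (min_l h) max_r ?ger0_norm//; [ring|lra].
  have h : c * b i 0 <= c * a i 0 by rewrite ler_nM2l// ltW.
  by rewrite (max_l h) (min_r h) max_r ?ltr0_norm//; [ring|lra].
rewrite (max_r (x := 0) (y := b i 0 - a i 0)) ?subr_ge0 ?(ltW ab)//.
rewrite mulrDl mulrA lerD2l /e' mulrAC ler_pdivrMr ?ltr_wpDl//.
by rewrite ler_wpM2l ?lerDl// ltW.
Qed.

Lemma in_slice (u : nat -> R) n x : u 0%N < x <= u n ->
  exists2 m, (m < n)%N & u m < x <= u m.+1.
Proof.
elim: n => [|n IHn] /andP[u0x xun].
  by have := lt_le_trans u0x xun; rewrite ltxx.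
have [xn|nx] := leP x (u n); last by exists n => //; rewrite nx.
have [|m mn ux] := IHn; first by rewrite u0x.
by exists m => //; exact: ltnW.
Qed.

Lemma box_volD2 d (a b : 'cV[R]_d) i j : i != j ->
  box_vol a b = Num.max 0 (b i 0 - a i 0) * (Num.max 0 (b j 0 - a j 0) *
    \prod_(k < d | (k != i) && (k != j)) Num.max 0 (b k 0 - a k 0)).
Proof. by move=> ij; rewrite (box_volD1 _ _ i) (bigD1 j) 1?eq_sym. Qed.

(* The box is cut into n + 1 slices along the coordinate j; the shear moves each
   of them into a box whose i-th side has grown by |c| s / (n + 1). *)
Lemma leb_outer_shear_box d (i j : 'I_d) (c : R) (a b : 'cV[R]_d) : i != j ->
  (leb_outer (mulmx (elem_mx i j c) @` box a b) <= (box_vol a b)%:E)%E.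
Proof.
move=> ij; have [ba|ab] := leP (b j 0) (a j 0).
  by rewrite (box_set0 ba) image_set0 outer_measure0 lee_fin box_vol_ge0.
set p := \prod_(k < d | (k != i) && (k != j)) Num.max 0 (b k 0 - a k 0).
have p0 : 0 <= p by apply: prodr_ge0 => k _; rewrite le_max lexx.
set s := b j 0 - a j 0.
have s0 : 0 < s by rewrite subr_gt0.
set t := Num.max 0 (b i 0 - a i 0).
suff slices n : (leb_outer (mulmx (elem_mx i j c) @` box a b) <=
    (box_vol a b + `|c| * s ^+ 2 * p / n.+1%:R)%:E)%E.
  apply/lee_addgt0Pr => e e0.
  set q := `|c| * s ^+ 2 * p.
  have q0 : 0 <= q by rewrite !mulr_ge0// ltW.
  apply: le_trans (slices (Num.truncn (q / e))) _.
  rewrite -EFinD lee_fin lerD2l -/q ler_pdivrMr// mulrC -ler_pdivrMr//.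
  exact/ltW/truncnS_gt.
pose N : R := n.+1%:R.
have N0 : 0 < N by rewrite ltr0n.
pose u m := a j 0 + m%:R * (s / N).
have uS m : u m.+1 = u m + s / N.
  by rewrite /u -natr1; ring.
have sN0 : 0 < s / N by rewrite divr_gt0.
pose am m := updcv (updcv a j (u m)) i
  (a i 0 + Num.min (c * u m) (c * u m.+1)).
pose bm m := updcv (updcv b j (u m.+1)) i
  (b i 0 + Num.max (c * u m) (c * u m.+1)).
have volm m : box_vol (am m) (bm m) <= (t + `|c| * (s / N)) * ((s / N) * p).
  rewrite (box_volD2 _ _ ij) !mxE !eqxx [j == i]eq_sym (negbTE ij) uS.
  have -> : \prod_(k < d | (k != i) && (k != j))
      Num.max 0 (bm m k 0 - am m k 0) = p.
    apply: eq_bigr => k /andP[/negbTE ki /negbTE kj].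
    by rewrite !mxE ki kj.
  have -> : u m + s / N - u m = s / N by rewrite addrC addKr.
  rewrite (max_r (ltW sN0)) ler_wpM2r ?(mulr_ge0 (ltW sN0))//.
  have -> : b i 0 + Num.max (c * u m) (c * (u m + s / N)) -
      (a i 0 + Num.min (c * u m) (c * (u m + s / N))) =
      (b i 0 - a i 0) + `|c| * (s / N).
    have [c0|c0] := leP 0 c.
      have h : c * u m <= c * (u m + s / N).
        by rewrite ler_wpM2l// lerDl ltW.
      by rewrite (max_r h) (min_l h) ger0_norm//; ring.
    have h : c * (u m + s / N) <= c * u m by rewrite ler_nM2l// lerDl ltW.
    by rewrite (max_l h) (min_r h) ltr0_norm//; ring.
  rewrite ge_max addr_ge0 ?lerD2r ?le_max ?lexx ?orbT//.
  by rewrite mulr_ge0// ltW.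
apply: (@le_trans _ _
    (leb_outer (\big[setU/set0]_(m < n.+1) box (am m) (bm m)))).
  apply: le_outer_measure => _ [x abx <-].
  have [|m mn umx] := @in_slice u n.+1 (x j 0).
    have /andP[ax xb] := abx j.
    by rewrite /u mul0r addr0 ax mulrC divfK ?gt_eqF// addrC subrK.
  rewrite -(bigcup_mkord n.+1 (fun m => box (am m) (bm m))); exists m => //= k.
  rewrite elem_mx_mulE !mxE; case: eqVneq => [->|ki].
    rewrite mulr1; have /andP[ax xb] := abx i.
    have /andP[ux xu] := umx.
    apply/andP; split.
      apply: ltr_leD => //; rewrite ge_min.
      have [c0|c0] := leP 0 c; first by rewrite ler_wpM2l// ltW.
      by rewrite orbC ler_nM2l// xu.
    apply: lerD => //; rewrite le_max.
    have [c0|c0] := leP 0 c; first by rewrite orbC ler_wpM2l.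
    by rewrite ler_nM2l// ltW.
  rewrite mulr0 addr0; case: eqVneq => [->//|_]; exact: abx.
apply: le_trans (@outer_measure_subadditive _ _ (@leb_outer R d)
  (fun m => box (am m) (bm m)) n.+1) _.
apply: (@le_trans _ _
    (\sum_(m < n.+1) ((t + `|c| * (s / N)) * ((s / N) * p))%:E)%E).
  by apply: lee_sum => m _; rewrite [leLHS]leb_outer_box lee_fin.
rewrite sumEFin lee_fin sumr_const card_ord -[_ *+ _]mulr_natr -/N.
rewrite (box_volD2 _ _ ij) -/p -/t -/s (max_r (ltW s0)).
by rewrite le_eqVlt; apply/orP; left; apply/eqP; field; rewrite gt_eqF.
Qed.

Lemma leb_outer_linear_le d (A : 'M[R]_d) (E : set 'cV[R]_d) :
  A \in unitmx -> (leb_outer (mulmx A @` E) <= `|\det A|%:E * leb_outer E)%E.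
Proof.
move=> uA; move: A uA E; apply: unitmx_elem_ind => [E|A B PA PB E|i j c ijc E].
- rewrite det1 normr1 mul1e.
  by apply: le_outer_measure => _ [x Ex <-]; rewrite mul1mx.
- rewrite det_mulmx normrM EFinM -muleA.
  apply: le_trans (lee_wpmul2l _ (PB E)); last by rewrite lee_fin.
  apply: le_trans (PA _); apply: le_outer_measure => _ [x Ex <-].
  by exists (B *m x); [exists x|rewrite mulmxA].
move: ijc; rewrite det_elem_mx; have [->|ij] /= := eqVneq i j.
  move=> c0; apply: leb_outer_image_le; rewrite ?mulr1 ?normr_gt0// => a b.
  by rewrite -[c in elem_mx _ _ c](addKr 1) addrC leb_outer_scale_box.
move=> _; rewrite mulr0 addr0 normr1; apply: leb_outer_image_le => // a b.
by rewrite mul1r leb_outer_shear_box.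
Qed.

(** The reverse inequality is the previous one for the inverse matrix, applied to the image of E. *)
Lemma leb_outer_linear d (A : 'M[R]_d) (E : set 'cV[R]_d) :
  A \in unitmx -> leb_outer (mulmx A @` E) = (`|\det A|%:E * leb_outer E)%E.
Proof.
move=> uA; apply/eqP; rewrite eq_le leb_outer_linear_le//=.
have dA : 0 < `|\det A| by rewrite normr_gt0 -unitfE -unitmxE.
have uA' : invmx A \in unitmx by rewrite unitmx_inv.
have := leb_outer_linear_le (mulmx A @` E) uA'.
rewrite det_inv normfV lee_pdivlMl//; congr (_ * leb_outer _ <= _)%E.
rewrite image_comp; apply/seteqP; split => [_ [x Ex <-]|x Ex] /=.
  by rewrite mulKmx.
by exists x => //=; rewrite mulKmx.
Qed.

Lemma leb_measurableE d (A : set 'cV[R]_d) :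
  measurable (A : set (leb_space R d)) = caratheodory_measurable (@leb_outer R d) A.
Proof. by []. Qed.

(** Continuity would not suffice, as Lebesgue measurable sets may have nonmeasurable preimages under
    homeomorphisms. An invertible linear map multiplies the outer measure of every set by the same
    constant, which transports Caratheodory's criterion. *)
Lemma measurable_linear_preimage d (A : 'M[R]_d) (E : set (leb_space R d)) :
  A \in unitmx -> measurable E ->
  measurable ((mulmx A : leb_space R d -> leb_space R d) @^-1` E).
Proof.
rewrite !leb_measurableE => uA mE X.
have uA' : invmx A \in unitmx by rewrite unitmx_inv.
have dA : (0 < `|\det A|) by rewrite normr_gt0 -unitfE -unitmxE.
have imE Y : leb_outer Y = (`|\det A|^-1%:E * leb_outer (mulmx A @` Y))%E.
  by rewrite leb_outer_linear// muleA -EFinM mulVf ?gt_eqF// mul1e.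
rewrite !(imE (X `&` _)) (imE X) -ge0_muleDr ?outer_measure_ge0//.
congr (_ * _)%E; rewrite (mE (mulmx A @` X)).
have imI (Z : set 'cV[R]_d) :
    mulmx A @` (X `&` mulmx A @^-1` Z) = (mulmx A @` X) `&` Z.
  apply/seteqP; split => [_ [x [Xx Zx] <-]|_ [[x Xx <-] Zx]].
    by split => //; exists x.
  by exists x.
by rewrite -!imI.
Qed.

End linear_image.

(** * Complex-valued integrals *)

Section complex_modulus.
Context (R : realType).
Implicit Types z w : R[i].

Lemma normc_ge0 z : 0 <= normc z.
Proof. by case: z => a b; exact: sqrtr_ge0. Qed.

Lemma sqr_normcE z : normc z ^+ 2 = complex.Re z ^+ 2 + complex.Im z ^+ 2.
Proof. by case: z => a b; rewrite sqr_sqrtr// addr_ge0 ?sqr_ge0. Qed.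

Lemma Re_le_normc z : `|complex.Re z| <= normc z.
Proof.
rewrite -(ler_pXn2r (n := 2)) ?nnegrE ?normc_ge0// sqr_normcE.
by rewrite real_normK ?num_real// lerDl sqr_ge0.
Qed.

Lemma Im_le_normc z : `|complex.Im z| <= normc z.
Proof.
rewrite -(ler_pXn2r (n := 2)) ?nnegrE ?normc_ge0// sqr_normcE.
by rewrite real_normK ?num_real// lerDr sqr_ge0.
Qed.

Lemma normc_conj z : normc z^* = normc z.
Proof. by case: z => a b /=; rewrite sqrrN. Qed.

Lemma normc_real (a : R) : normc a%:C = `|a|.
Proof. by rewrite /= expr0n addr0 sqrtr_sqr. Qed.

Lemma normc_expi (t : R) : normc (expi t) = 1.
Proof. by rewrite /= cos2Dsin2 sqrtr1. Qed.

Lemma expiD (s t : R) : expi (s + t) = expi s * expi t.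
Proof. by rewrite /expi cosD sinD [sin s * _ + _]addrC. Qed.

Lemma expi0 : expi 0 = 1 :> R[i].
Proof. by rewrite /expi cos0 sin0. Qed.

Lemma expiN (t : R) : expi (- t) = (expi t)^*.
Proof. by rewrite /expi cosN sinN. Qed.

End complex_modulus.

Section complex_integral.
Context d (T : measurableType d) (R : realType) (mu : {measure set T -> \bar R}).
Implicit Types f g : T -> R[i].

(** [cmeas] and [cint] are [cmeasurable] and [cintegral] over an arbitrary measure, as needed for
    intervals and products; on [leb_space R d] they unfold to the same terms, and later proofs pass
    from one to the other by conversion. *)
Definition cmeas f : Prop :=
  measurable_fun [set: T] (fun x => complex.Re (f x)) /\
  measurable_fun [set: T] (fun x => complex.Im (f x)).

Definition cint f : R[i] :=
  (\int[mu]_x complex.Re (f x)) +i* (\int[mu]_x complex.Im (f x)).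

Definition cintegrable f : Prop :=
  cmeas f /\ (\int[mu]_x (normc (f x))%:E < +oo)%E.

Lemma cmeas_normc f : cmeas f -> measurable_fun [set: T] (fun x => normc (f x)).
Proof.
move=> [mRe mIm]; have -> : (fun x => normc (f x)) =
    (fun x => Num.sqrt (complex.Re (f x) ^+ 2 + complex.Im (f x) ^+ 2)).
  by apply/funext => x; case: (f x).
apply: (@measurableT_comp _ _ _ _ _ _ (@Num.sqrt R)).
  by apply: continuous_measurable_fun; exact: sqrt_continuous.
by apply: measurable_funD; exact: measurable_funX.
Qed.

Lemma cmeas_cst (c : R[i]) : cmeas (fun=> c).
Proof. by split; exact: measurable_cst. Qed.

Lemma cmeasD f g : cmeas f -> cmeas g -> cmeas (fun x => f x + g x).
Proof.
move=> [mf1 mf2] [mg1 mg2]; split.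
- rewrite (_ : (fun x => _) =
    (fun x => complex.Re (f x) + complex.Re (g x))); first exact: measurable_funD.
  by apply/funext => x; case: (f x) (g x) => [? ?] [].
- rewrite (_ : (fun x => _) =
    (fun x => complex.Im (f x) + complex.Im (g x))); first exact: measurable_funD.
  by apply/funext => x; case: (f x) (g x) => [? ?] [].
Qed.

Lemma cmeasM f g : cmeas f -> cmeas g -> cmeas (fun x => f x * g x).
Proof.
move=> [mf1 mf2] [mg1 mg2]; split.
- rewrite (_ : (fun x => _) =
    (fun x => complex.Re (f x) * complex.Re (g x) -
              complex.Im (f x) * complex.Im (g x))).
    by apply: measurable_funB; exact: measurable_funM.
  by apply/funext => x; case: (f x) (g x) => [? ?] [].
- rewrite (_ : (fun x => _) =
    (fun x => complex.Re (f x) * complex.Im (g x) +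
              complex.Im (f x) * complex.Re (g x))).
    by apply: measurable_funD; exact: measurable_funM.
  by apply/funext => x; case: (f x) (g x) => [? ?] [? ?] /=.
Qed.

Lemma cmeas_conj f : cmeas f -> cmeas (fun x => (f x)^*).
Proof.
move=> [mf1 mf2]; split.
- by rewrite (_ : (fun x => _) = (fun x => complex.Re (f x)))//;
    apply/funext => x; case: (f x).
- rewrite (_ : (fun x => _) = (fun x => - complex.Im (f x)));
    first exact: measurable_funN.
  by apply/funext => x; case: (f x).
Qed.

Lemma cmeas_expi (t : T -> R) : measurable_fun [set: T] t ->
  cmeas (fun x => expi (t x)).
Proof.
move=> mt; split; apply: measurableT_comp => //.
  by apply: continuous_measurable_fun => x; exact: continuous_cos.
by apply: continuous_measurable_fun => x; exact: continuous_sin.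
Qed.

Lemma cmeas_real (t : T -> R) : measurable_fun [set: T] t ->
  cmeas (fun x => (t x)%:C).
Proof. by move=> mt; split => //; exact: measurable_cst. Qed.

Lemma cmeas_sum (I : Type) (r : seq I) (F : I -> T -> R[i]) :
  (forall i, cmeas (F i)) -> cmeas (fun x => \sum_(i <- r) F i x).
Proof.
move=> mF; elim: r => [|i r IHr].
  rewrite (_ : (fun x => _) = fun=> 0); first exact: cmeas_cst.
  by apply/funext => x; rewrite big_nil.
rewrite (_ : (fun x => _) = fun x => F i x + \sum_(i <- r) F i x).
  exact: cmeasD.
by apply/funext => x; rewrite big_cons.
Qed.

Lemma cintegrable_ReIm f : cintegrable f ->
  mu.-integrable [set: T] (EFin \o (fun x => complex.Re (f x))) /\
  mu.-integrable [set: T] (EFin \o (fun x => complex.Im (f x))).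
Proof.
move=> [mf foo]; have mn := cmeas_normc mf; case: mf => mf1 mf2.
split; apply/integrableP; (split; first exact/measurable_EFinP).
- apply: le_lt_trans foo; apply: ge0_le_integral => //.
  + by apply/measurableT_comp => //; exact/measurable_EFinP.
  + exact/measurable_EFinP.
  + by move=> x _; rewrite lee_fin Re_le_normc.
- apply: le_lt_trans foo; apply: ge0_le_integral => //.
  + by apply/measurableT_comp => //; exact/measurable_EFinP.
  + exact/measurable_EFinP.
  + by move=> x _; rewrite lee_fin Im_le_normc.
Qed.

Lemma cintegrable_le f (g : T -> R) : cmeas f ->
  measurable_fun [set: T] g ->
  (forall x, normc (f x) <= g x) -> (\int[mu]_x (g x)%:E < +oo)%E ->
  cintegrable f.
Proof.
move=> mf mg fg goo; split => //; apply: le_lt_trans goo.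
apply: ge0_le_integral => //.
- by move=> x _; rewrite lee_fin normc_ge0.
- by apply/measurable_EFinP; exact: cmeas_normc.
- exact/measurable_EFinP.
- by move=> x _; rewrite lee_fin.
Qed.

Lemma cintegrableD f g : cintegrable f -> cintegrable g ->
  cintegrable (fun x => f x + g x).
Proof.
move=> [mf foo] [mg goo].
apply: (@cintegrable_le _ (fun x => normc (f x) + normc (g x))).
- exact: cmeasD.
- by apply: measurable_funD; exact: cmeas_normc.
- by move=> x; exact: le_normcD.
under eq_integral do rewrite EFinD.
rewrite ge0_integralD//; first exact: lte_add_pinfty.
- by move=> x _; rewrite lee_fin normc_ge0.
- by apply/measurable_EFinP; exact: cmeas_normc.
- by move=> x _; rewrite lee_fin normc_ge0.
- by apply/measurable_EFinP; exact: cmeas_normc.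
Qed.

Lemma cintegrableMl (c : T -> R[i]) (C : R) f : cmeas c ->
  (forall x, normc (c x) <= C) -> cintegrable f ->
  cintegrable (fun x => c x * f x).
Proof.
move=> mc cC [mf foo].
apply: (@cintegrable_le _ (fun x => C * normc (f x))).
- exact: cmeasM.
- by apply: measurable_funM => //; exact: cmeas_normc.
- by move=> x; rewrite normcM ler_wpM2r// normc_ge0.
(* On an empty space nothing forces [0 <= C]; otherwise any point does. *)
have [[x0 _]|T0] := pselect (exists x : T, True); last first.
  by rewrite (_ : [set: T] = set0) ?integral_set0//;
    apply/seteqP; split => // x _; apply: T0; exists x.
under eq_integral do rewrite EFinM.
rewrite ge0_integralZl//.
- by rewrite lte_mul_pinfty// lee_fin (le_trans (normc_ge0 (c x0))).
- by apply/measurable_EFinP; exact: cmeas_normc.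
- by move=> x _; rewrite lee_fin normc_ge0.
- by rewrite lee_fin (le_trans (normc_ge0 (c x0))).
Qed.

Lemma cintegrableZ (c : R[i]) f : cintegrable f ->
  cintegrable (fun x => c * f x).
Proof.
by apply: (@cintegrableMl _ (normc c)) => //; exact: cmeas_cst.
Qed.

Lemma cintegrable_conj f : cintegrable f -> cintegrable (fun x => (f x)^*).
Proof.
move=> [mf foo]; split; first exact: cmeas_conj.
by under eq_integral do rewrite normc_conj.
Qed.

Lemma cintegrable_sum (I : Type) (r : seq I) (F : I -> T -> R[i]) :
  (forall i, cintegrable (F i)) -> cintegrable (fun x => \sum_(i <- r) F i x).
Proof.
move=> iF; elim: r => [|i r IHr].
  rewrite (_ : (fun x => _) = fun=> 0).
    split; first exact: cmeas_cst.
    by under eq_integral do rewrite normc0; rewrite integral0.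
  by apply/funext => x; rewrite big_nil.
rewrite (_ : (fun x => _) = fun x => F i x + \sum_(i <- r) F i x).
  exact: cintegrableD.
by apply/funext => x; rewrite big_cons.
Qed.

Lemma cintD f g : cintegrable f -> cintegrable g ->
  cint (fun x => f x + g x) = cint f + cint g.
Proof.
move=> /cintegrable_ReIm[f1 f2] /cintegrable_ReIm[g1 g2].
apply/eqP; rewrite eq_complex /cint/=; apply/andP; split; apply/eqP.
- rewrite -RintegralD//; apply: eq_Rintegral => x _.
  by case: (f x) (g x) => [? ?] [].
- rewrite -RintegralD//; apply: eq_Rintegral => x _.
  by case: (f x) (g x) => [? ?] [].
Qed.

Lemma cintZ (c : R[i]) f : cintegrable f -> cint (fun x => c * f x) = c * cint f.
Proof.
move=> /cintegrable_ReIm[f1 f2].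
have fZ (r : R) (u : T -> R) : mu.-integrable [set: T] (EFin \o u) ->
    mu.-integrable [set: T] (EFin \o (fun x => r * u x)).
  by move=> iu; have := integrableZl measurableT r iu.
case: c => a b; apply/eqP; rewrite eq_complex /cint/=; apply/andP; split; apply/eqP.
- rewrite -!RintegralZl// -RintegralB//; try exact: fZ.
  by apply: eq_Rintegral => x _; case: (f x).
- rewrite -!RintegralZl// -RintegralD//; try exact: fZ.
  by apply: eq_Rintegral => x _; case: (f x).
Qed.

Lemma cint_conj f : cintegrable f -> cint (fun x => (f x)^*) = (cint f)^*.
Proof.
move=> /cintegrable_ReIm[f1 f2].
apply/eqP; rewrite eq_complex /cint/=; apply/andP; split; apply/eqP.
  by apply: eq_Rintegral => x _; case: (f x).
rewrite -mulN1r -RintegralZl//; apply: eq_Rintegral => x _.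
by rewrite mulN1r; case: (f x).
Qed.

Lemma cint_sum (I : Type) (r : seq I) (F : I -> T -> R[i]) :
  (forall i, cintegrable (F i)) ->
  cint (fun x => \sum_(i <- r) F i x) = \sum_(i <- r) cint (F i).
Proof.
move=> iF; elim: r => [|i r IHr].
  rewrite big_nil (_ : (fun x => _) = fun=> 0); last first.
    by apply/funext => x; rewrite big_nil.
  by rewrite /cint/= !Rintegral_cst//= !mul0r.
rewrite big_cons -IHr -cintD//; last exact: cintegrable_sum.
by congr cint; apply/funext => x; rewrite big_cons.
Qed.

Lemma eq_cint f g : f =1 g -> cint f = cint g.
Proof. by move=> /funext ->. Qed.

Lemma ae_eq_cint f g : cmeas f -> cmeas g ->
  {ae mu, forall x, f x = g x} -> cint f = cint g.
Proof.
move=> [f1 f2] [g1 g2] fg; rewrite /cint /Rintegral; congr (fine _ +i* fine _).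
- apply: ae_eq_integral => //; try exact/measurable_EFinP.
  by apply: filterS fg => x -> _.
- apply: ae_eq_integral => //; try exact/measurable_EFinP.
  by apply: filterS fg => x -> _.
Qed.

Lemma cintegrable_normc f : cintegrable f ->
  mu.-integrable [set: T] (EFin \o (fun x => normc (f x))).
Proof.
move=> [mf foo]; apply/integrableP; split.
  by apply/measurable_EFinP; exact: cmeas_normc.
by under eq_integral do rewrite /= ger0_norm ?normc_ge0//.
Qed.

(* The integral is rotated onto the positive real axis by a unimodular factor. *)
Lemma normc_cint_le f : cintegrable f ->
  ((normc (cint f))%:E <= \int[mu]_x (normc (f x))%:E)%E.
Proof.
move=> fi; have [z0|z0] := eqVneq (normc (cint f)) 0.
  by rewrite z0 integral_ge0// => x _; rewrite lee_fin normc_ge0.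
pose c := (cint f)^* * ((normc (cint f))^-1)%:C.
have c1 : normc c = 1.
  by rewrite normcM normc_conj normc_real normfV ger0_norm ?normc_ge0// divff.
have cz : c * cint f = (normc (cint f))%:C.
  have : cint f * (cint f)^* = (normc (cint f) ^+ 2)%:C.
    rewrite sqr_normcE; case: (cint f) => a b; apply/eqP.
    by rewrite eq_complex/=; apply/andP; split; apply/eqP; ring.
  rewrite /c mulrAC [_^* * _]mulrC => ->.
  by rewrite expr2 -rmorphM/= mulfK.
have [Rei _] := cintegrable_ReIm (cintegrableZ c fi).
have -> : (normc (cint f))%:E = (\int[mu]_x (complex.Re (c * f x))%:E)%E.
  rewrite -[RHS]fineK; last exact: integrable_fin_num Rei.
  by congr EFin; have := congr1 (@complex.Re R) cz; rewrite -cintZ.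
apply: le_integral => //; first exact: cintegrable_normc.
move=> x _; rewrite lee_fin (le_trans (ler_norm _))//.
by rewrite (le_trans (Re_le_normc _))// normcM c1 mul1r.
Qed.

End complex_integral.

(** * Measurable maps and linear change of variables *)

Section lebesgue_measure_properties.
Context (R : realType) (d : nat).
Local Notation mu := (leb R d).

Lemma leb_box (a b : 'cV[R]_d) : mu (box a b) = (box_vol a b)%:E.
Proof. exact: leb_outer_box. Qed.

Lemma measurable_coord (i : 'I_d) :
  measurable_fun [set: leb_space R d] (fun x : 'cV[R]_d => x i 0).
Proof.
apply: (measurability _ (RGenOInfty.measurableE R)) => //.
move=> _ [_ [c ->] <-]; rewrite setTI.
rewrite (_ : _ @^-1` _ = ~` [set x : 'cV[R]_d | x i 0 <= c]).
  by apply: measurableC; exact: measurable_halfspace.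
apply/seteqP; split => x /=; rewrite in_itv/= andbT ltNge; first by move/negP.
by move=> xc; apply/negP.
Qed.

Lemma measurable_box (a b : 'cV[R]_d) :
  measurable (box a b : set (leb_space R d)).
Proof.
have -> : box a b = \bigcap_(i in [set: 'I_d])
    (~` [set x : 'cV[R]_d | x i 0 <= a i 0] `&` [set x | x i 0 <= b i 0]).
  apply/seteqP; split => [x abx i _|x abx i].
    by have /andP[ax xb] := abx i; split => //=; apply/negP; rewrite -ltNge.
  by have [/negP + xb] := abx i I; rewrite -ltNge => ->.
apply: fin_bigcap_measurable => // i _.
by apply: measurableI; [apply: measurableC|]; exact: measurable_halfspace.
Qed.

Definition cube (n : nat) : set 'cV[R]_d :=
  box (const_mx (- n%:R)) (const_mx n%:R).

Lemma bigcup_cube : \bigcup_n cube n = [set: 'cV[R]_d].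
Proof.
apply/seteqP; split => // x _.
pose s := \sum_(i < d) `|x i 0|.
have s0 : 0 <= s by apply: sumr_ge0.
have /ltW sn := truncnS_gt s.
exists (Num.truncn s).+2 => // i; rewrite !mxE.
have xs : `|x i 0| <= s by rewrite /s (bigD1 i)//= lerDl sumr_ge0.
have : `|x i 0| < (Num.truncn s).+2%:R.
  by rewrite (le_lt_trans xs)// (le_lt_trans sn)// ltr_nat.
by rewrite ltr_norml => /andP[-> /ltW ->].
Qed.

Lemma leb_sigma_finite : sigma_finite [set: leb_space R d] mu.
Proof.
exists cube; first by rewrite bigcup_cube.
move=> n; split; first exact: measurable_box.
by rewrite leb_box ltry.
Qed.

HB.instance Definition _ :=
  Measure_isSigmaFinite.Build _ _ _ mu leb_sigma_finite.

Lemma measurable_linear (A : 'M[R]_d) : A \in unitmx ->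
  measurable_fun [set: leb_space R d] (mulmx A : leb_space R d -> leb_space R d).
Proof.
by move=> uA _ E mE; rewrite setTI; exact: measurable_linear_preimage.
Qed.

(** The image of [mu] under A, scaled by the absolute value of the determinant, is [mu] again. *)
Lemma ge0_integral_linear (A : 'M[R]_d) (f : leb_space R d -> \bar R) :
  A \in unitmx -> measurable_fun [set: leb_space R d] f ->
  (forall x, 0 <= f x)%E ->
  (`|\det A|%:E * \int[mu]_x f (A *m x) = \int[mu]_x f x)%E.
Proof.
move=> uA mf f0; have mA := measurable_linear uA.
have dA : 0 < `|\det A| by rewrite normr_gt0 -unitfE -unitmxE.
pose k : {nonneg R} := NngNum (normr_ge0 (\det A)).
have := ge0_integral_pushforward mA mu measurableT mf (fun x _ => f0 x).
rewrite preimage_setT => /esym fA; rewrite [X in (_ * X)%E]fA.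
rewrite -[`|_|]/(k%:num) -ge0_integral_mscale//.
apply: eq_measure_integral => E mE _; rewrite /mscale/= /pushforward.
have := leb_outer_linear (mulmx A @^-1` E) uA.
rewrite image_preimage; last first.
  apply/seteqP; split => // y _; exists (invmx A *m y) => //.
  by rewrite mulmxA mulmxV// mul1mx.
exact: esym.
Qed.

End lebesgue_measure_properties.

(** * Fubini's theorem for complex-valued functions *)

Section complex_fubini.
Context d1 d2 (T1 : measurableType d1) (T2 : measurableType d2) (R : realType).
Variables (m1 : {sigma_finite_measure set T1 -> \bar R}).
Variables (m2 : {sigma_finite_measure set T2 -> \bar R}).

Lemma cmeas_comp (phi : T1 -> T2) (f : T2 -> R[i]) :
  measurable_fun [set: T1] phi -> cmeas f -> cmeas (f \o phi).
Proof.
by move=> mphi [f1 f2]; split; [exact: (measurableT_comp f1)|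
  exact: (measurableT_comp f2)].
Qed.

Lemma Rfubini1 (u : T1 * T2 -> R) :
  (m1 \x m2)%E.-integrable [set: T1 * T2] (EFin \o u) ->
  \int[m1]_x \int[m2]_y u (x, y) = \int[(m1 \x m2)%E]_z u z.
Proof.
move=> iu; have mu := measurable_int _ iu.
rewrite /Rintegral -(integral12_prod_meas1 iu); congr fine.
have iF := integrable_fubini_F iu.
apply: ae_eq_integral => //.
- apply/measurable_EFinP; apply: measurableT_comp => //.
  exact: measurable_fubini_F iu.
- exact: measurable_fubini_F iu.
(* The inner integral is finite only almost everywhere; the default value that [fine] gives at
   infinity is confined to a null set. *)
apply: filterS (integrable_ae measurableT iF) => x /(_ I) Fx _.
by rewrite fineK.
Qed.

Lemma Rfubini2 (u : T1 * T2 -> R) :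
  (m1 \x m2)%E.-integrable [set: T1 * T2] (EFin \o u) ->
  \int[m2]_y \int[m1]_x u (x, y) = \int[(m1 \x m2)%E]_z u z.
Proof.
move=> iu; have mu := measurable_int _ iu.
rewrite /Rintegral -(integral21_prod_meas1 iu); congr fine.
apply: ae_eq_integral => //.
- apply/measurable_EFinP; apply: measurableT_comp => //.
  exact: measurable_fubini_G iu.
- exact: measurable_fubini_G iu.
apply: filterS (ae_integrable2 iu) => y iy _.
by rewrite fineK//; exact: integrable_fin_num.
Qed.

Lemma cfubini1 (f : T1 * T2 -> R[i]) : cintegrable (m1 \x m2)%E f ->
  cint m1 (fun x => cint m2 (fun y => f (x, y))) = cint (m1 \x m2)%E f.
Proof.
by move=> /cintegrable_ReIm[f1 f2]; rewrite /cint/= -Rfubini1// -Rfubini1.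
Qed.

Lemma cfubini2 (f : T1 * T2 -> R[i]) : cintegrable (m1 \x m2)%E f ->
  cint m2 (fun y => cint m1 (fun x => f (x, y))) = cint (m1 \x m2)%E f.
Proof.
by move=> /cintegrable_ReIm[f1 f2]; rewrite /cint/= -Rfubini2// -Rfubini2.
Qed.

Lemma cfubini (f : T1 * T2 -> R[i]) : cintegrable (m1 \x m2)%E f ->
  cint m1 (fun x => cint m2 (fun y => f (x, y))) =
  cint m2 (fun y => cint m1 (fun x => f (x, y))).
Proof. by move=> fi; rewrite cfubini1// cfubini2. Qed.

(** No integrability is assumed: by Tonelli the integrals of the positive and negative parts are
    measurable in x, and the default value of [fine] at infinity preserves measurability. *)
Lemma cmeas_cint (f : T1 * T2 -> R[i]) : cmeas f ->
  cmeas (fun x => cint m2 (fun y => f (x, y))).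
Proof.
have mint (u : T1 * T2 -> R) : measurable_fun [set: T1 * T2] u ->
    measurable_fun [set: T1] (fun x => \int[m2]_y u (x, y)).
  move=> mu; rewrite /Rintegral; apply: measurableT_comp => //.
  under eq_fun do rewrite integralE.
  have mEu : measurable_fun [set: T1 * T2] (EFin \o u) by exact/measurable_EFinP.
  apply: emeasurable_funB.
  - under eq_fun do under eq_integral do
      rewrite funeposE -[X in maxe X _]/((EFin \o u) (_, _)) -funeposE.
    by apply: measurable_fun_fubini_tonelli_F => //; exact: measurable_funepos.
  - under eq_fun do under eq_integral do
      rewrite funenegE -[X in maxe X _]/((\- (EFin \o u))%E (_, _)) -funenegE.
    by apply: measurable_fun_fubini_tonelli_F => //; exact: measurable_funeneg.
by move=> [f1 f2]; split; [exact: (mint _ f1)|exact: (mint _ f2)].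
Qed.

Lemma cintegrable_prodP (f : T1 * T2 -> R[i]) : cmeas f ->
  (\int[m1]_x \int[m2]_y (normc (f (x, y)))%:E < +oo)%E ->
  cintegrable (m1 \x m2)%E f.
Proof.
move=> mf foo; split => //; rewrite fubini_tonelli1//.
- by apply/measurable_EFinP; exact: cmeas_normc.
- by move=> x; rewrite lee_fin normc_ge0.
Qed.

Lemma cintegrable_tensor (f : T1 -> R[i]) (g : T2 -> R[i]) :
  cintegrable m1 f -> cintegrable m2 g ->
  cintegrable (m1 \x m2)%E (fun z => f z.1 * g z.2).
Proof.
move=> [[f1 f2] foo] [[g1 g2] goo]; apply: cintegrable_prodP => /=.
  apply: cmeasM; split; first [exact: (measurableT_comp f1)|
    exact: (measurableT_comp f2)|exact: (measurableT_comp g1)|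
    exact: (measurableT_comp g2)].
rewrite (_ : (\int[m1]_x _)%E =
    (\int[m1]_x (normc (f x))%:E * \int[m2]_y (normc (g y))%:E)%E).
  rewrite lte_mul_pinfty// ?ge0_fin_numE//; apply: integral_ge0 => x _;
    by rewrite lee_fin normc_ge0.
have gint : (\int[m2]_y (normc (g y))%:E)%E \is a fin_num.
  by rewrite ge0_fin_numE//; apply: integral_ge0 => x _; rewrite lee_fin normc_ge0.
rewrite -(fineK gint) -ge0_integralZr//.
- apply: eq_integral => x _; rewrite fineK// -ge0_integralZl//.
  + by apply: eq_integral => y _; rewrite normcM EFinM.
  + by apply/measurable_EFinP; exact: cmeas_normc.
  + by move=> y _; rewrite lee_fin normc_ge0.
  + by rewrite lee_fin normc_ge0.
- by apply/measurable_EFinP; exact: cmeas_normc.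
- by move=> y _; rewrite lee_fin normc_ge0.
- by rewrite fineK//; apply: integral_ge0 => x _; rewrite lee_fin normc_ge0.
Qed.

Lemma cint_tensor (f : T1 -> R[i]) (g : T2 -> R[i]) :
  cintegrable m1 f -> cintegrable m2 g ->
  cint (m1 \x m2)%E (fun z => f z.1 * g z.2) = cint m1 f * cint m2 g.
Proof.
move=> fi gi; rewrite -cfubini1; last exact: cintegrable_tensor.
under eq_cint do rewrite /= cintZ//.
by under eq_cint do rewrite mulrC; rewrite cintZ// mulrC.
Qed.

End complex_fubini.

(** * Integration along measure-preserving maps *)

Section complex_pushforward.
Context d1 d2 (T1 : measurableType d1) (T2 : measurableType d2) (R : realType).
Variables (m1 : {measure set T1 -> \bar R}) (m2 : {measure set T2 -> \bar R}).
Variable phi : T1 -> T2.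
Hypothesis mphi : measurable_fun [set: T1] phi.
Hypothesis m12 : forall A, measurable A -> m1 (phi @^-1` A) = m2 A.

Lemma ge0_integral_preserving (f : T2 -> \bar R) :
  measurable_fun [set: T2] f -> (forall x, 0 <= f x)%E ->
  (\int[m1]_x f (phi x) = \int[m2]_x f x)%E.
Proof.
move=> mf f0.
have := ge0_integral_pushforward mphi m1 measurableT mf (fun x _ => f0 x).
rewrite preimage_setT => /esym ->; apply: eq_measure_integral => A mA _.
exact: m12.
Qed.

Lemma cintegrable_preserving (f : T2 -> R[i]) :
  cintegrable m2 f -> cintegrable m1 (f \o phi).
Proof.
move=> [mf foo]; split; first exact: cmeas_comp.
rewrite (ge0_integral_preserving (f := fun x => (normc (f x))%:E))//.
- by apply/measurable_EFinP; exact: cmeas_normc.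
- by move=> x; rewrite lee_fin normc_ge0.
Qed.

Lemma cint_preserving (f : T2 -> R[i]) :
  cintegrable m2 f -> cint m1 (f \o phi) = cint m2 f.
Proof.
move=> fi; have [f1 f2] := cintegrable_ReIm fi.
have intE (u : T2 -> R) : m2.-integrable [set: T2] (EFin \o u) ->
    \int[m1]_x u (phi x) = \int[m2]_x u x.
  move=> iu; have mu := measurable_int _ iu.
  rewrite /Rintegral; congr fine; rewrite [RHS]integralE [LHS]integralE.
  congr (_ - _)%E.
  - rewrite -ge0_integral_preserving//; last exact: measurable_funepos.
    by apply: eq_integral => x _; rewrite !funeposE.
  - rewrite -ge0_integral_preserving//; last exact: measurable_funeneg.
    by apply: eq_integral => x _; rewrite !funenegE.
by rewrite /cint /= (intE _ f1) (intE _ f2).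
Qed.

End complex_pushforward.

(** * Product structure of R^d *)

Section borel_Rd.
Context (R : realType).

Definition boxes d : set (set 'cV[R]_d) := [set A | exists a b, A = box a b].
Arguments boxes : clear implicits.

(* The Caratheodory sigma-algebra of a product is not generated by measurable
   rectangles; Fubini's theorem is applied to the one generated by boxes. *)
Definition bor d := g_sigma_algebraType (boxes d).
HB.instance Definition _ d := Measurable.on (bor d).

Lemma measurable_bor_leb d (A : set (bor d)) :
  measurable A -> measurable (A : set (leb_space R d)).
Proof.
apply: smallest_sub; first exact: sigma_algebra_measurable.
by move=> _ [a [b ->]]; exact: measurable_box.
Qed.

Definition lebB d : set (bor d) -> \bar R := leb R d.

Section lebB_measure.
Context (d : nat).

Let lebB0 : lebB (set0 : set (bor d)) = 0%E.
Proof. exact: (measure0 (leb R d)). Qed.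

Let lebB_ge0 (A : set (bor d)) : (0 <= lebB A)%E.
Proof. exact: (measure_ge0 (leb R d)). Qed.

Let lebB_sigma_additive : semi_sigma_additive (@lebB d).
Proof.
move=> F mF tF mUF; apply: (@measure_semi_sigma_additive _ _ _ (leb R d)) => //.
  by move=> i; exact: measurable_bor_leb.
exact: measurable_bor_leb.
Qed.

HB.instance Definition _ := isMeasure.Build _ _ _ (@lebB d)
  lebB0 lebB_ge0 lebB_sigma_additive.

Lemma bor_measurable_box (a b : 'cV[R]_d) : measurable (box a b : set (bor d)).
Proof. by apply: sub_sigma_algebra; exists a, b. Qed.

Lemma lebB_sigma_finite : sigma_finite [set: bor d] (@lebB d).
Proof.
exists (@cube R d); first by rewrite bigcup_cube.
move=> n; split; first exact: bor_measurable_box.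
by rewrite /lebB leb_box ltry.
Qed.

HB.instance Definition _ :=
  Measure_isSigmaFinite.Build _ _ _ (@lebB d) lebB_sigma_finite.

Lemma measurable_bor_id :
  measurable_fun [set: leb_space R d] (id : leb_space R d -> bor d).
Proof. by move=> _ A mA; rewrite setTI; exact: measurable_bor_leb. Qed.

Lemma bor_measurable_halfspace (i : 'I_d) c :
  measurable ([set x : 'cV[R]_d | x i 0 <= c] : set (bor d)).
Proof.
have -> : [set x : 'cV[R]_d | x i 0 <= c] =
    \bigcup_n box (const_mx (- n%:R)) (updcv (const_mx n%:R) i c).
  apply/seteqP; split => [x xc|x [n _ /(_ i)]]; last first.
    by rewrite !mxE eqxx => /andP[].
  have [n _ xn] : (\bigcup_n cube n) x by rewrite bigcup_cube.
  exists n => // k; have := xn k; rewrite !mxE => /andP[-> kx].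
  by case: eqVneq => [->|].
by apply: bigcup_measurable => n _; exact: bor_measurable_box.
Qed.

Lemma bor_measurable_coord (i : 'I_d) :
  measurable_fun [set: bor d] (fun x : 'cV[R]_d => x i 0).
Proof.
apply: (measurability _ (RGenOInfty.measurableE R)) => //.
move=> _ [_ [c ->] <-]; rewrite setTI.
rewrite (_ : _ @^-1` _ = ~` [set x : 'cV[R]_d | x i 0 <= c]).
  by apply: measurableC; exact: bor_measurable_halfspace.
apply/seteqP; split => x /=; rewrite in_itv/= andbT ltNge; first by move/negP.
by move=> xc; apply/negP.
Qed.

End lebB_measure.

Lemma bor_measurable_tail d :
  measurable_fun [set: bor d.+1] (@tailcv R d : bor d.+1 -> bor d).
Proof.
apply: (@measurability _ _ (bor d.+1) (bor d) _ _ (boxes d)) => //.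
move=> _ [_ [a [b ->]] <-]; rewrite setTI.
have -> : @tailcv R d @^-1` box a b = \bigcap_(i in [set: 'I_d])
    (~` [set x : 'cV[R]_d.+1 | x (lift ord0 i) 0 <= a i 0] `&`
     [set x | x (lift ord0 i) 0 <= b i 0]).
  apply/seteqP; split => [x abx i _|x abx i].
    have := abx i; rewrite mxE => /andP[ax xb].
    by split => //=; apply/negP; rewrite -ltNge.
  by have [/negP + xb] := abx i I; rewrite -ltNge mxE => ->.
apply: fin_bigcap_measurable => // i _.
by apply: measurableI; [apply: measurableC|]; exact: bor_measurable_halfspace.
Qed.

Definition split_coord d (x : bor d.+1) : measurableTypeR R * bor d :=
  ((x : 'cV[R]_d.+1) ord0 0, tailcv x).

Lemma measurable_split_coord d : measurable_fun [set: bor d.+1] (@split_coord d).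
Proof.
apply/measurable_fun_pairP; split; first exact: bor_measurable_coord.
exact: bor_measurable_tail.
Qed.

Lemma setI_boxes d : setI_closed (boxes d).
Proof.
move=> _ _ [a [b ->]] [a' [b' ->]].
exists (\col_i Num.max (a i 0) (a' i 0)), (\col_i Num.min (b i 0) (b' i 0)).
apply/seteqP; split => [x [abx abx'] i|x abx].
  rewrite !mxE gt_max le_min.
  by have /andP[-> ->] := abx i; have /andP[-> ->] := abx' i.
by split => i; have := abx i; rewrite !mxE gt_max le_min
  => /andP[/andP[? ?] /andP[? ?]]; apply/andP.
Qed.

Lemma split_coord_box d (a b : R) (u v : 'cV[R]_d) :
  @split_coord d @^-1` (`]a, b]%classic `*` box u v) =
  box (conscv a u) (conscv b v).
Proof.
apply/seteqP; split => [x [/= + uvx]|x].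
  by rewrite in_itv/= => xab; apply/box_consE; rewrite !conscv0 !tailcvK.
by move=> /box_consE; rewrite !conscv0 !tailcvK => -[]; split => //=;
  rewrite in_itv.
Qed.

(** The image measure under separating the first coordinate, to be identified with the product
    measure. *)
Definition split_leb d : set (measurableTypeR R * bor d) -> \bar R :=
  fun X => lebB (@split_coord d @^-1` X).

Section split_leb_measure.
Context (d : nat).

Let split_leb0 : @split_leb d set0 = 0%E.
Proof. by rewrite /split_leb preimage_set0 measure0. Qed.

Let split_leb_ge0 X : (0 <= @split_leb d X)%E.
Proof. exact: measure_ge0. Qed.

Let split_leb_sigma_additive : semi_sigma_additive (@split_leb d).
Proof.
have mpre X : measurable X -> measurable (@split_coord d @^-1` X).
  by move=> mX; rewrite -[X in measurable X]setTI; exact: measurable_split_coord.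
move=> F mF tF mUF; rewrite /split_leb preimage_bigcup.
apply: measure_semi_sigma_additive.
- by move=> n; exact: mpre.
- apply/trivIsetP => /= i j _ _ ij; rewrite -preimage_setI.
  by move/trivIsetP : tF => /(_ _ _ _ _ ij) ->//; rewrite preimage_set0.
- by rewrite -preimage_bigcup; exact: mpre.
Qed.

HB.instance Definition _ := isMeasure.Build _ _ _ (@split_leb d)
  split_leb0 split_leb_ge0 split_leb_sigma_additive.

End split_leb_measure.
End borel_Rd.
Arguments boxes : clear implicits.

(** * Measures on a product with one factor fixed *)

Section rectangle_measures.
Context d1 d2 (T1 : measurableType d1) (T2 : measurableType d2) (R : realType).
Variable m : {measure set (T1 * T2) -> \bar R}.

(** Fixing one side of a rectangle lets the uniqueness theorem for measures be applied to one factor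
    at a time. The measurability proof is an argument so that the measure structure can be inferred
    from the term. *)
Definition rect_measure2 (A : set T1) (mA : measurable A) : set T2 -> \bar R :=
  fun B => m (A `*` B).

Definition rect_measure1 (B : set T2) (mB : measurable B) : set T1 -> \bar R :=
  fun A => m (A `*` B).

Section rect_measure2_measure.
Variables (A : set T1) (mA : measurable A).

Let rect20 : rect_measure2 mA set0 = 0%E.
Proof. by rewrite /rect_measure2 setX0 measure0. Qed.

Let rect2_ge0 B : (0 <= rect_measure2 mA B)%E.
Proof. exact: measure_ge0. Qed.

Let rect2_sigma_additive : semi_sigma_additive (rect_measure2 mA).
Proof.
move=> F mF tF mUF; rewrite /rect_measure2 setX_bigcupr.
apply: measure_semi_sigma_additive.
- by move=> n; exact: measurableX.
- apply/trivIsetP => i j _ _ ij; rewrite -setXI.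
  by move/trivIsetP : tF => /(_ _ _ _ _ ij) ->//; rewrite setX0.
- by rewrite -setX_bigcupr; exact: measurableX.
Qed.

HB.instance Definition _ := isMeasure.Build _ _ _ (rect_measure2 mA)
  rect20 rect2_ge0 rect2_sigma_additive.

End rect_measure2_measure.

Section rect_measure1_measure.
Variables (B : set T2) (mB : measurable B).

Let rect10 : rect_measure1 mB set0 = 0%E.
Proof. by rewrite /rect_measure1 set0X measure0. Qed.

Let rect1_ge0 A : (0 <= rect_measure1 mB A)%E.
Proof. exact: measure_ge0. Qed.

Let rect1_sigma_additive : semi_sigma_additive (rect_measure1 mB).
Proof.
move=> F mF tF mUF; rewrite /rect_measure1 setX_bigcupl.
apply: measure_semi_sigma_additive.
- by move=> n; exact: measurableX.
- apply/trivIsetP => i j _ _ ij; rewrite -setXI.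
  by move/trivIsetP : tF => /(_ _ _ _ _ ij) ->//; rewrite set0X.
- by rewrite -setX_bigcupl; exact: measurableX.
Qed.

HB.instance Definition _ := isMeasure.Build _ _ _ (rect_measure1 mB)
  rect10 rect1_ge0 rect1_sigma_additive.

End rect_measure1_measure.
End rectangle_measures.

(** * Lebesgue measure as a product measure *)

Section lebesgue_product.
Context (R : realType).

(** With the interval fixed, both sides are measures in B that agree on boxes, which are stable
    under intersection. *)
Lemma split_leb_itv d (a b : R) (B : set (bor R d)) : measurable B ->
  split_leb (`]a, b]%classic `*` B) =
  (lebesgue_measure (`]a, b]%classic : set R) * lebB B)%E.
Proof.
have mab : measurable (`]a, b]%classic : set (measurableTypeR R)) by exact: measurable_itv.
rewrite lebesgue_measure_oc => mB.
have k0 : 0 <= Num.max 0 (b - a) by rewrite le_max lexx.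
pose k : {nonneg R} := NngNum k0.
rewrite -[LHS]/(rect_measure2 (@split_leb R d) mab B).
rewrite -[RHS]/(mscale k (@lebB R d) B).
apply: (@measure_unique _ R (bor R d) (boxes R d) (@cube R d) _ _ _ _
  (rect_measure2 (@split_leb R d) mab) (mscale k (@lebB R d))) => //.
- exact: setI_boxes.
- by move=> n; exists (const_mx (- n%:R)), (const_mx n%:R).
- exact: bigcup_cube.
- move=> _ [u [v ->]].
  rewrite /rect_measure2/= /split_leb split_coord_box /mscale/=.
  rewrite /lebB !leb_box -EFinM box_vol_consE.
  by rewrite !conscv0 !tailcvK.
- move=> n; rewrite /rect_measure2/= /split_leb split_coord_box /lebB leb_box.
  by rewrite ltry.
Qed.

(** Now B is fixed and both sides are measures in A that agree on half-open intervals. [mscale]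
    takes a real factor, whence the finite measure of B. *)
Lemma split_leb_rect d (A : set (measurableTypeR R)) (B : set (bor R d)) :
  measurable A -> measurable B -> (lebB B < +oo)%E ->
  split_leb (A `*` B) = (lebesgue_measure A * lebB B)%E.
Proof.
move=> mA mB Boo.
have Bfin : lebB B \is a fin_num by rewrite ge0_fin_numE// measure_ge0.
pose k : {nonneg R} := NngNum (fine_ge0 (measure_ge0 (@lebB R d) B)).
rewrite muleC -(fineK Bfin).
have oc n : ocitv (`](- n%:R)%R, n%:R%R]%classic : set R).
  by exists (- n%:R, n%:R).
rewrite -[LHS]/(rect_measure1 (@split_leb R d) mB A).
rewrite -[RHS]/(mscale k (@lebesgue_measure R) A).
apply: (@measure_unique _ R (measurableTypeR R) (@ocitv R) (fun n => `](- n%:R)%R, n%:R%R]%classic)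
  _ _ _ _ (rect_measure1 (@split_leb R d) mB)
  (mscale k (@lebesgue_measure R))) => //.
- exact: ocitvI.
- exact: bigcup_itvT.
- move=> _ [[a b] _ <-]; rewrite /rect_measure1/= split_leb_itv// muleC.
  by rewrite /mscale/= fineK.
- move=> n; rewrite /rect_measure1/= split_leb_itv// lebesgue_measure_oc.
  by rewrite lte_mul_pinfty// ?lee_fin ?le_max ?lexx// ltry.
Qed.

Lemma split_lebE d (X : set (measurableTypeR R * bor R d)) : measurable X ->
  split_leb X = (lebesgue_measure \x @lebB R d)%E X.
Proof.
(* Rectangles with a second side of finite measure still generate the product sigma-algebra, since
   any second side is a union of its traces on cubes. *)
pose C : set (set (measurableTypeR R * bor R d)) := [set A `*` B | A in measurable &
  B in [set B : set (bor R d) | measurable B /\ (lebB B < +oo)%E]].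
have mcube n : measurable (@cube R d n : set (bor R d)).
  exact: bor_measurable_box.
have cubeoo n : (lebB (@cube R d n : set (bor R d)) < +oo)%E.
  by rewrite /lebB leb_box ltry.
have mitv n : measurable (`](- n%:R)%R, n%:R%R]%classic : set R).
  exact: measurable_itv.
apply: (measure_unique C
  (fun n => `](- n%:R)%R, n%:R%R]%classic `*` @cube R d n)) => //.
- rewrite measurable_prod_measurableType; apply/seteqP; split.
    apply: smallest_sub; first exact: smallest_sigma_algebra.
    move=> _ [A mA] [B mB] <-.
    rewrite (_ : _ `*` _ = \bigcup_n (A `*` (B `&` @cube R d n))); last first.
      by rewrite -setX_bigcupr -setI_bigcupr bigcup_cube setIT.
    apply: sigma_algebra_bigcup => n; apply: sub_sigma_algebra.
    exists A => //; exists (B `&` @cube R d n) => //; split.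
      exact: measurableI.
    by apply: le_lt_trans (cubeoo n); apply: le_measure; rewrite ?inE//;
      exact: measurableI.
  apply: smallest_sub; first exact: smallest_sigma_algebra.
  move=> _ [A mA] [B [mB _]] <-; apply: sub_sigma_algebra.
  by exists A => //; exists B.
- move=> _ _ [A mA [B [mB Boo] <-]] [A' mA' [B' [mB' B'oo] <-]].
  exists (A `&` A'); first exact: measurableI.
  exists (B `&` B'); last by rewrite setXI.
  split; first exact: measurableI.
  by apply: le_lt_trans Boo; apply: le_measure; rewrite ?inE//;
    exact: measurableI.
- by move=> n; exists `](- n%:R)%R, n%:R%R]%classic => //; exists (@cube R d n).
- apply/seteqP; split => // -[t v] _.
  have [n _ tn] : (\bigcup_n `](- n%:R)%R, n%:R%R]%classic) t.
    by rewrite bigcup_itvT.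
  have [k _ vk] : (\bigcup_n @cube R d n) v by rewrite bigcup_cube.
  exists (maxn n k) => //; split => /=.
    move: tn; rewrite /= !in_itv/= => /andP[tn nt].
    rewrite (le_lt_trans _ tn) ?lerN2 ?ler_nat ?leq_maxl//=.
    by rewrite (le_trans nt)// ler_nat leq_maxl.
  move=> i; have := vk i; rewrite !mxE => /andP[vi iv].
  rewrite (le_lt_trans _ vi) ?lerN2 ?ler_nat ?leq_maxr//=.
  by rewrite (le_trans iv)// ler_nat leq_maxr.
- move=> _ [A mA [B [mB Boo] <-]].
  by rewrite [RHS]product_measure1E// [LHS]split_leb_rect.
- move=> n; rewrite [ltLHS]split_leb_itv// lebesgue_measure_oc.
  by rewrite lte_mul_pinfty// ?lee_fin ?le_max ?lexx// ltry.
Qed.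

(** The space is one point, a box whose volume is an empty product; this starts the induction on the
    dimension. *)
Lemma lebB_setT0 : lebB [set: bor R 0] = 1%E.
Proof.
rewrite /lebB (_ : setT = box 0 0) ?leb_box ?/box_vol ?big_ord0//.
by apply/seteqP; split => // x _ [].
Qed.

Lemma cint_lebB_prod d (k : 'I_d -> R -> R[i]) :
  (forall i, cintegrable lebesgue_measure (k i)) ->
  cintegrable (@lebB R d) (fun x : 'cV[R]_d => \prod_(i < d) k i (x i 0)) /\
  cint (@lebB R d) (fun x : 'cV[R]_d => \prod_(i < d) k i (x i 0)) =
    \prod_(i < d) cint lebesgue_measure (k i).
Proof.
elim: d k => [|d IHd] k ik.
  rewrite big_ord0 (_ : (fun x => _) = fun=> 1); last first.
    by apply/funext => x; rewrite big_ord0.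
  split; last first.
    by rewrite /cint/= !Rintegral_cst//= lebB_setT0/= mulr1 mul0r.
  split; first exact: cmeas_cst.
  rewrite integral_cst// normc1 mul1e [X in (X < _)%E]lebB_setT0.
  exact: ltry.
have [iF IF] := IHd (fun i => k (lift ord0 i)) (fun i => ik _).
pose F (v : bor R d) := \prod_(i < d) k (lift ord0 i) ((v : 'cV[R]_d) i 0).
have -> : (fun x : 'cV[R]_d.+1 => \prod_(i < d.+1) k i (x i 0)) =
    (fun z => k ord0 z.1 * F z.2) \o @split_coord R d.
  apply/funext => x; rewrite big_ord_recl/=; congr (_ * _).
  by apply: eq_bigr => i _; rewrite mxE.
have pres := @split_lebE d.
have iT := cintegrable_tensor (ik ord0) iF.
split.
  exact: (cintegrable_preserving (@measurable_split_coord R d) pres iT).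
rewrite (cint_preserving (@measurable_split_coord R d) pres iT).
by rewrite big_ord_recl -IF; exact: (cint_tensor (ik ord0) iF).
Qed.

(** The identity from Lebesgue to Borel sets preserves the measure, so the Borel statement carries
    over. *)
Lemma cint_leb_prod d (k : 'I_d -> R -> R[i]) :
  (forall i, cintegrable lebesgue_measure (k i)) ->
  cintegrable (leb R d) (fun x : 'cV[R]_d => \prod_(i < d) k i (x i 0)) /\
  cint (leb R d) (fun x : 'cV[R]_d => \prod_(i < d) k i (x i 0)) =
    \prod_(i < d) cint lebesgue_measure (k i).
Proof.
move=> ik; have [iF <-] := cint_lebB_prod ik.
split; first exact: (cintegrable_preserving (@measurable_bor_id R d) _ iF).
exact: (cint_preserving (@measurable_bor_id R d) _ iF).
Qed.

End lebesgue_product.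

(** * Plancherel's theorem for step functions *)

Section real_derivatives.
Context (R : realType).
Implicit Types (f g : R -> R) (x a b : R).

Lemma is_derive1_continuous f x a : is_derive x 1 f a -> {for x, continuous f}.
Proof. by move=> [df _]; apply: differentiable_continuous; exact/derivable1_diffP. Qed.

(** The fundamental theorem of calculus on a half-line. Differentiability of f supplies its
    continuity, and instance resolution through [is_derive_eq] computes it at each use. *)
Lemma ge0_integral_0y (f F f' : R -> R) (l : R) :
  (forall x, 0 <= x -> 0 <= f x) ->
  (forall x, is_derive x 1 f (f' x)) -> (forall x, is_derive x 1 F (f x)) ->
  F x @[x --> +oo] --> l ->
  (\int[lebesgue_measure]_(x in `]0%R, +oo[) (f x)%:E = (l - F 0)%:E)%E.
Proof.
move=> f0 df dF Fl; have cf : continuous f.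
  by move=> x; exact: is_derive1_continuous (df x).
rewrite integral_itv_obnd_cbnd; last first.
  apply/measurable_EFinP; apply: measurable_funTS.
  exact: continuous_measurable_fun.
rewrite EFinB; apply: ge0_continuous_FTC2y => //.
- exact: continuous_subspaceT.
- by apply: cvg_at_right_filter; exact: is_derive1_continuous (dF 0).
- by move=> x _; rewrite derive1E; have [_] := dF x.
Qed.

Lemma cvg_scale_pinfty (c : R) : 0 < c -> c * x @[x --> +oo] --> +oo.
Proof.
move=> c0; apply/cvgryPge => M; near=> x.
rewrite mulrC -ler_pdivrMr//; near: x; exact: nbhs_pinfty_ge.
Unshelve. all: by end_near. Qed.

Lemma cvg_expR_bounded (F : R -> R) (K c : R) : 0 < c ->
  (forall x, 0 <= x -> `|F x| <= K * expR (- (c * x))) -> F x @[x --> +oo] --> 0.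
Proof.
move=> c0 FK.
have e0 : K * expR (- (c * x)) @[x --> +oo] --> 0.
  rewrite -(mulr0 K); apply: cvgM; first exact: cvg_cst.
  exact: (cvg_comp _ _ (cvg_scale_pinfty c0) (@cvgr_expR R)).
apply: (@squeeze_cvgr _ _ _ _ (fun x => - (K * expR (- (c * x))))
  (fun x => K * expR (- (c * x)))) => //.
- near=> x; rewrite -ler_norml FK//; near: x; exact: nbhs_pinfty_ge.
- by rewrite -oppr0; exact: cvgN.
Unshelve. all: by end_near. Qed.

Lemma integral_id_expR (xi : R) : 0 < xi ->
  (\int[lebesgue_measure]_(s in `]0%R, +oo[) (s * expR (- xi * s))%:E =
   (xi ^- 2)%:E)%E.
Proof.
move=> xi0.
pose F s := - ((xi^-1 * s + xi ^- 2) * expR (- xi * s)).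
apply: etrans; [apply: (@ge0_integral_0y
  (fun s => s * expR (- xi * s)) F
  (fun s => s * (expR (- xi * s) * - xi) + expR (- xi * s) * 1) 0)|
    by rewrite sub0r /F opprK !mulr0 add0r expR0 mulr1].
- by move=> x x0; rewrite mulr_ge0// expR_ge0.
- by move=> x; apply: is_derive_eq; rewrite /GRing.scale/=; ring.
- by move=> x; apply: is_derive_eq; rewrite /GRing.scale/=; field; rewrite gt_eqF.
(* Half of the exponent absorbs the linear factor: [1 + xi * x <= 2 * (1 + xi / 2 * x) <= 2 * expR
   (xi / 2 * x)]. *)
apply: (@cvg_expR_bounded _ (2 * xi ^- 2) (xi / 2)); first by rewrite divr_gt0.
move=> x x0; rewrite normrN normrM (ger0_norm (expR_ge0 _)) ger0_norm; last first.
  by rewrite addr_ge0 ?mulr_ge0 ?invr_ge0 ?exprn_ge0// ltW.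
have -> : - xi * x = - (xi / 2 * x) + - (xi / 2 * x) by field.
rewrite expRD mulrA ler_pM2r ?expR_gt0// -ler_pdivlMr ?expR_gt0//.
rewrite -expRN opprK; have := expR_ge1Dx (xi / 2 * x).
have -> : xi^-1 * x + xi ^- 2 = xi ^- 2 * (1 + xi * x) by field; rewrite gt_eqF.
move: (expR _) => e h; have -> : 2 / xi ^+ 2 * e = xi ^- 2 * (2 * e) by ring.
rewrite ler_pM2l ?invr_gt0 ?exprn_gt0//.
have := mulr_ge0 (ltW xi0) x0; lra.
Qed.

(** The Laplace transform of [1 - cos (t * x)]; multiplied by s it becomes the Poisson kernel
    [t ^+ 2 / (s ^+ 2 + t ^+ 2)]. *)
Lemma integral_cos_expR (t s : R) : 0 < s ->
  (\int[lebesgue_measure]_(x in `]0%R, +oo[)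
     ((1 - cos (t * x)) * expR (- s * x))%:E =
   (s^-1 - s / (s ^+ 2 + t ^+ 2))%:E)%E.
Proof.
move=> s0; have st0 : s ^+ 2 + t ^+ 2 != 0.
  by rewrite gt_eqF// ltr_wpDr ?sqr_ge0// exprn_gt0.
pose c := (s ^+ 2 + t ^+ 2)^-1.
pose F x := expR (- s * x) * (c * (s * cos (t * x) + - (t * sin (t * x))) - s^-1).
apply: etrans; [apply: (@ge0_integral_0y
  (fun x => (1 - cos (t * x)) * expR (- s * x)) F
  (fun x => (1 - cos (t * x)) * (expR (- s * x) * - s) +
    expR (- s * x) * (0 + - (- sin (t * x) * t))) 0)|
    by rewrite sub0r /F !mulr0 expR0 cos0 sin0 mulr0 oppr0 addr0 mulr1
      mul1r opprB [c * s]mulrC].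
- by move=> x x0; rewrite mulr_ge0 ?expR_ge0// subr_ge0 cos_le1.
- by move=> x; apply: is_derive_eq; rewrite /GRing.scale/=; ring.
- by move=> x; apply: is_derive_eq; rewrite /GRing.scale/= /c; field; rewrite st0 gt_eqF.
have c0 : 0 <= c by rewrite invr_ge0 addr_ge0 ?sqr_ge0.
apply: (@cvg_expR_bounded _ (c * (`|s| + `|t|) + `|s^-1|) s) => // x x0.
rewrite normrM (ger0_norm (expR_ge0 _)) mulrC mulNr ler_pM2r ?expR_gt0//.
rewrite (le_trans (ler_normB _ _))// lerD2r normrM ger0_norm// ler_wpM2l//.
rewrite (le_trans (ler_normB _ _))// !normrM lerD// ler_piMr//.
  by rewrite ler_norml cos_geN1 cos_le1.
by rewrite ler_norml sin_geN1 sin_le1.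
Qed.

Lemma integral_poisson (t : R) : 0 < t ->
  (\int[lebesgue_measure]_(s in `]0%R, +oo[) (t ^+ 2 / (s ^+ 2 + t ^+ 2))%:E =
   (t * (pi / 2))%:E)%E.
Proof.
move=> t0; have st0 s : s ^+ 2 + t ^+ 2 != 0.
  by rewrite gt_eqF// ltr_wpDl ?sqr_ge0// exprn_gt0.
pose F s := t * atan (t^-1 * s).
have df x : is_derive x 1 (fun s : R => t ^+ 2 / (s ^+ 2 + t ^+ 2))
    (t ^+ 2 * (- (x ^+ 2 + t ^+ 2) ^- 2 * (x + x))).
  by apply: is_derive_eq; rewrite /GRing.scale/=; ring.
apply: etrans; [apply: (@ge0_integral_0y _ F _ (t * (pi / 2)) _ df)|
  by rewrite /F mulr0 atan0 mulr0 subr0].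
- by move=> x x0; rewrite divr_ge0 ?addr_ge0 ?sqr_ge0.
- move=> x; apply: is_derive_eq; rewrite /GRing.scale/=.
  by field; rewrite (gt_eqF t0) st0.
apply: cvgM; first exact: cvg_cst.
apply: (cvg_comp _ _ _ (@cvgy_atan R)).
by apply: cvg_scale_pinfty; rewrite invr_gt0.
Qed.

(** Writing [1 / x ^+ 2] as the integral of [s * expR (- x * s)] over s > 0 and exchanging the
    integrals leaves s times a Laplace transform, that is, the Poisson kernel. The integrand is
    nonnegative, so Tonelli applies to its extension [H] by 0 to the plane. *)
Lemma integral_1Bcos (t : R) : 0 < t ->
  (\int[lebesgue_measure]_(x in `]0%R, +oo[) ((1 - cos (t * x)) / x ^+ 2)%:E =
   (t * (pi / 2))%:E)%E.
Proof.
move=> t0; rewrite -integral_poisson//.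
pose D : set R := `]0, +oo[%classic.
have DE x : (x \in D) = (0 < x) by rewrite mem_setE in_itv/= andbT.
have mD : measurable D by exact: measurable_itv.
pose h (z : R * R) := ((1 - cos (t * z.1)) * (z.2 * expR (- z.1 * z.2)))%:E.
pose H := h \_ (D `*` D).
have HE x y : H (x, y) = if (x \in D) && (y \in D) then h (x, y) else 0%E.
  by rewrite /H /patch in_setX.
have mcos : measurable_fun [set: R] (@cos R).
  by apply: continuous_measurable_fun => x; exact: continuous_cos.
have mH : measurable_fun [set: R * R] H.
  apply/(measurable_restrictT _ _).1; first exact: measurableX.
  apply: measurable_funTS; apply/measurable_EFinP; apply: measurable_funM.
    apply: measurable_funB => //; apply: measurableT_comp => //.
    by apply: measurable_funM.
  apply: measurable_funM => //; apply: measurableT_comp => //.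
  by apply: measurable_funM => //; exact: measurable_funN.
have H0 z : (0 <= H z)%E.
  case: z => x y; rewrite HE; case: ifP => // /andP[]; rewrite !DE => x0 y0.
  by rewrite lee_fin !mulr_ge0 ?expR_ge0 ?subr_ge0 ?cos_le1// ltW.
have := @fubini_tonelli _ _ (measurableTypeR R) (measurableTypeR R) R
  lebesgue_measure lebesgue_measure H mH H0.
rewrite /fubini_F /fubini_G => HF.
move: H HE mH H0 HF => H HE _ _ HF; rewrite -/D.
transitivity (\int[lebesgue_measure]_x \int[lebesgue_measure]_y H (x, y))%E.
  rewrite integral_mkcond; apply: eq_integral => x _; rewrite /patch.
  case: ifPn => xD; last first.
    by apply/esym/integral0_eq => y _; rewrite HE (negbTE xD).
  move: (xD); rewrite DE => x0.
  transitivity (\int[lebesgue_measure]_(y in D)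
      ((1 - cos (t * x))%:E * (y * expR (- x * y))%:E))%E.
    rewrite ge0_integralZl//.
    - by rewrite integral_id_expR.
    - apply/measurable_EFinP; apply: measurable_funTS.
      by apply: measurable_funM => //; apply: measurableT_comp.
    - by move=> y /mem_set; rewrite DE => y0; rewrite lee_fin mulr_ge0 ?expR_ge0// ltW.
  by rewrite integral_mkcond; apply: eq_integral => y _; rewrite HE xD.
rewrite HF.
rewrite [RHS]integral_mkcond; apply: eq_integral => y _; rewrite /patch.
case: ifPn => yD; last first.
  by apply: integral0_eq => x _; rewrite HE (negbTE yD) andbF.
move: (yD); rewrite DE => y0.
transitivity (\int[lebesgue_measure]_(x in D)
    (y%:E * ((1 - cos (t * x)) * expR (- y * x))%:E))%E.
  rewrite [RHS]integral_mkcond; apply: eq_integral => x _; rewrite HE yD andbT.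
  rewrite /patch; case: ifP => // _; rewrite /h/= -EFinM; congr EFin.
  by rewrite mulrCA mulNr [x * y]mulrC -mulNr.
rewrite ge0_integralZl//.
- rewrite integral_cos_expR// -EFinM; congr EFin; field.
  by rewrite (gt_eqF y0) andbT gt_eqF// addr_gt0 ?exprn_gt0.
- apply/measurable_EFinP; apply: measurable_funTS; apply: measurable_funM.
    by apply: measurable_funB => //; apply: measurableT_comp.
  by apply: measurableT_comp.
- by rewrite lee_fin ltW.
Qed.

End real_derivatives.

Section complex_conjugation.
Context (R : realType).

Lemma conj_RtoC (a : R) : (a%:C)^* = a%:C.
Proof. exact: conjc_real. Qed.

End complex_conjugation.

(** * Transforms of intervals and the Fejer kernel *)

Section interval_kernel.
Context (R : realType).
Local Notation lambda := (@lebesgue_measure R).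

(** Away from 0, half the squared modulus of the transform of an interval of length [|t|]. At
    [xi = 0] the value is 0. *)
Definition fejer (t xi : R) : R := (1 - cos (2 * pi * t * xi)) / (2 * pi * xi) ^+ 2.

Lemma fejer_ge0 t xi : 0 <= fejer t xi.
Proof. by rewrite divr_ge0 ?sqr_ge0// subr_ge0 cos_le1. Qed.

Lemma fejerN t xi : fejer t (- xi) = fejer t xi.
Proof. by rewrite /fejer !mulrN cosN sqrrN. Qed.

Lemma fejer_norm t xi : fejer `|t| xi = fejer t xi.
Proof.
by rewrite /fejer; case: ger0P => // _; rewrite mulrN mulNr cosN.
Qed.

Lemma measurable_inv_sqr (c : R) :
  measurable_fun [set: R] (fun x : R => ((c * x) ^+ 2)^-1).
Proof.
rewrite (_ : (fun x => _) = (fun x => ((c * x) ^+ 2) `^ (-1))).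
  apply: (measurableT_comp (measurable_powR (-1))).
  by apply: measurable_funX; exact: measurable_funM.
by apply/funext => x; rewrite powR_inv1// sqr_ge0.
Qed.

Lemma measurable_fejer t : measurable_fun [set: R] (fejer t).
Proof.
apply: measurable_funM; last exact: measurable_inv_sqr.
apply: measurable_funB => //; apply: measurableT_comp; last exact: measurable_funM.
by apply: continuous_measurable_fun => x; exact: continuous_cos.
Qed.

Lemma integral_even (f : R -> R) : measurable_fun [set: R] f ->
  (forall x, 0 <= f x) -> f 0 = 0 -> (forall x, f (- x) = f x) ->
  (\int[lambda]_x (f x)%:E = 2%:E * \int[lambda]_(x in `]0%R, +oo[) (f x)%:E)%E.
Proof.
move=> mf f0 f00 fN.
pose g x := f x * (0 < x)%R%:R.
have mg : measurable_fun [set: R] g.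
  apply: measurable_funM => //.
  rewrite (_ : (fun x => _) = \1_(`]0, +oo[%classic : set R)).
    by apply: measurable_indic; exact: measurable_itv.
  by apply/funext => x; rewrite indicE mem_setE in_itv/= andbT.
have g0 x : 0 <= g x by rewrite mulr_ge0.
have gint : (\int[lambda]_(x in `]0%R, +oo[) (f x)%:E = \int[lambda]_x (g x)%:E)%E.
  rewrite integral_mkcond; apply: eq_integral => x _.
  rewrite /patch mem_setE in_itv/= andbT /g; case: ifP => _.
    by rewrite mulr1.
  by rewrite mulr0.
have fg x : f x = g x + g (- x).
  rewrite /g oppr_gt0 fN; case: ltgtP => x0.
  - by rewrite mulr1 mulr0 addr0.
  - by rewrite mulr1 mulr0 add0r.
  - by rewrite -x0 f00 !mul0r addr0.
under eq_integral do rewrite fg EFinD.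
rewrite ge0_integralD//; last 4 first.
- by move=> x _; rewrite lee_fin.
- exact/measurable_EFinP.
- by move=> x _; rewrite lee_fin.
- by apply/measurable_EFinP; apply: (measurableT_comp mg); exact: oppr_measurable.
rewrite gint mule_natl mule2n; congr (_ + _)%E.
apply: (@ge0_integral_preserving _ _ (measurableTypeR R) (measurableTypeR R) R
  lambda lambda -%R _ _ (fun x => (g x)%:E)).
- exact: oppr_measurable.
- by move=> A mA; exact: lebesgue_measureN.
- exact/measurable_EFinP.
- by move=> x; rewrite lee_fin.
Qed.

Lemma integral_fejer t : (\int[lambda]_xi (fejer t xi)%:E = (`|t| / 2)%:E)%E.
Proof.
have [->|t0] := eqVneq t 0.
  rewrite normr0 mul0r integral0_eq// => x _.
  by rewrite /fejer mulr0 mul0r cos0 subrr mul0r.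
have tp : 0 < 2 * pi * `|t| by rewrite !mulr_gt0 ?pi_gt0 ?normr_gt0.
rewrite integral_even//; last 4 first.
- exact: measurable_fejer.
- exact: fejer_ge0.
- by rewrite /fejer !mulr0 cos0 subrr mul0r.
- exact: fejerN.
transitivity (2%:E * \int[lambda]_(x in `]0%R, +oo[)
    (((2 * pi) ^- 2)%:E * ((1 - cos (2 * pi * `|t| * x)) / x ^+ 2)%:E))%E.
  congr (_ * _)%E; apply: eq_integral => x _; rewrite -EFinM; congr EFin.
  by rewrite -fejer_norm /fejer [(_ * x) ^+ 2]exprMn invfM mulrCA.
rewrite ge0_integralZl//; last 3 first.
- apply/measurable_EFinP; apply: measurable_funTS; apply: measurable_funM.
    apply: measurable_funB => //; apply: measurableT_comp => //.
    by apply: continuous_measurable_fun => x; exact: continuous_cos.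
  by have := measurable_inv_sqr 1; under eq_fun do rewrite mul1r.
- by move=> x _; rewrite lee_fin divr_ge0 ?sqr_ge0// subr_ge0 cos_le1.
- by rewrite lee_fin invr_ge0 sqr_ge0.
rewrite integral_1Bcos// -!EFinM; congr EFin.
by have := pi_gt0 R; move: (@pi R) => q q0; field; rewrite gt_eqF.
Qed.

Definition interval_wave (a b xi t : R) : R[i] :=
  (\1_(`]a, b]%classic : set R) t)%:C * expi (- (2 * pi * (t * xi))).

Definition interval_hat (a b xi : R) : R[i] := cint lambda (interval_wave a b xi).

Lemma cmeas_interval_wave a b xi :
  @cmeas _ (measurableTypeR R) R (interval_wave a b xi).
Proof.
apply: cmeasM.
  by apply: cmeas_real; apply: measurable_indic; exact: measurable_itv.
apply: cmeas_expi; apply: measurable_funN; apply: measurable_funM => //.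
exact: measurable_funM.
Qed.

Lemma cintegrable_interval_wave a b xi : cintegrable lambda (interval_wave a b xi).
Proof.
split; first exact: cmeas_interval_wave.
under eq_integral do rewrite normcM normc_expi mulr1 normc_real ger0_norm//.
by rewrite integral_indic// setIT [ltLHS]lebesgue_measure_oc ltry.
Qed.

Lemma integral_trig (F f f' : R -> R) (a b : R) : a <= b ->
  (forall x : R, is_derive x 1 F (f x)) ->
  (forall x : R, is_derive x 1 f (f' x)) ->
  \int[lambda]_x (\1_(`]a, b]%classic : set R) x * f x) = F b - F a.
Proof.
move=> ab dF df; have cf : continuous f.
  by move=> x; exact: is_derive1_continuous (df x).
have mf : measurable_fun [set: R] f by exact: continuous_measurable_fun.
rewrite /Rintegral (_ : (\int[lambda]_x _)%E =
    (\int[lambda]_(x in `]a, b]) (f x)%:E)%E); last first.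
  rewrite [RHS]integral_mkcond; apply: eq_integral => x _.
  by rewrite /patch indicE; case: ifP; rewrite ?mul1r ?mul0r.
move: ab; rewrite le_eqVlt => /predU1P[->|ab].
  by rewrite set_itvoc0 integral_set0 subrr.
rewrite integral_itv_obnd_cbnd; last first.
  by apply/measurable_EFinP; exact: measurable_funTS.
rewrite (@continuous_FTC2 _ f F)//.
- exact: continuous_subspaceT.
- split.
  + by move=> x _; have [] := dF x.
  + by apply: cvg_at_right_filter; exact: is_derive1_continuous (dF a).
  + by apply: cvg_at_left_filter; exact: is_derive1_continuous (dF b).
- by move=> x _; rewrite derive1E; have [_] := dF x.
Qed.

Lemma interval_hatE a b xi : a <= b -> xi != 0 ->
  interval_hat a b xi =
  ((sin (2 * pi * b * xi) - sin (2 * pi * a * xi)) / (2 * pi * xi)) +i*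
  ((cos (2 * pi * b * xi) - cos (2 * pi * a * xi)) / (2 * pi * xi)).
Proof.
move=> ab xi0; pose w := 2 * pi * xi.
have w0 : w != 0 by rewrite mulf_neq0// gt_eqF// mulr_gt0 ?pi_gt0.
have wE c : 2 * pi * c * xi = w * c by rewrite /w; ring.
have wE' t : - (2 * pi * (t * xi)) = - (w * t) by rewrite /w; ring.
have dsin (x : R) : is_derive x 1 (fun x => sin (w * x) / w) (cos (w * x)).
  by apply: is_derive_eq; rewrite /GRing.scale/=; field.
have dcos (x : R) : is_derive x 1 (fun x => cos (w * x)) (- sin (w * x) * w).
  by apply: is_derive_eq; rewrite /GRing.scale/=; ring.
have dcosw (x : R) : is_derive x 1 (fun x => cos (w * x) / w) (- sin (w * x)).
  by apply: is_derive_eq; rewrite /GRing.scale/=; field.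
have dsinN (x : R) : is_derive x 1 (fun x => - sin (w * x)) (- (cos (w * x) * w)).
  by apply: is_derive_eq; rewrite /GRing.scale/=; ring.
rewrite /interval_hat /cint; congr (_ +i* _).
- rewrite (_ : \int[_]_x _ =
    \int[lambda]_x (\1_(`]a, b]%classic : set R) x * cos (w * x))); last first.
    by apply: eq_Rintegral => x _; rewrite /interval_wave wE'/= cosN mul0r subr0.
  by rewrite (integral_trig ab dsin dcos) !wE mulrBl.
- rewrite (_ : \int[_]_x _ =
    \int[lambda]_x (\1_(`]a, b]%classic : set R) x * - sin (w * x))); last first.
    by apply: eq_Rintegral => x _; rewrite /interval_wave wE'/= sinN mul0r addr0.
  by rewrite (integral_trig ab dcosw dsinN) !wE mulrBl.
Qed.

Lemma interval_hat0 a b xi : b < a -> interval_hat a b xi = 0.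
Proof.
move=> ba; rewrite /interval_hat (_ : interval_wave a b xi = fun=> 0).
  by rewrite /cint/= !Rintegral_cst//= !mul0r.
apply/funext => t; rewrite /interval_wave indicE mem_setE itv_ge ?mul0r//.
by rewrite -leNgt bnd_simp ltW.
Qed.

Lemma cmeas_interval_hat a b : @cmeas _ (measurableTypeR R) R (interval_hat a b).
Proof.
apply: (@cmeas_cint _ _ (measurableTypeR R) (measurableTypeR R) R lambda
  (fun z => interval_wave a b z.1 z.2)).
apply: cmeasM.
  by apply: cmeas_real; apply: measurableT_comp.
apply: cmeas_expi; apply: measurable_funN; apply: measurable_funM => //.
exact: measurable_funM.
Qed.

Let ae_lambda_filter : Filter (almost_everywhere lambda) :=
  @ae_filter_ringOfSetsType _ (measurableTypeR R) R lambda.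

Lemma ae_neq0 : {ae lambda, forall xi : R, xi != 0}.
Proof.
exists [set 0]; split => //; first exact: lebesgue_measure_set1.
by move=> x /= /negP; rewrite negbK => /eqP.
Qed.

Lemma integrable_fejer t : lambda.-integrable [set: R] (EFin \o fejer t).
Proof.
apply/integrableP; split; first by apply/measurable_EFinP; exact: measurable_fejer.
under eq_integral do rewrite /= ger0_norm ?fejer_ge0//.
by rewrite integral_fejer ltry.
Qed.

Lemma Rintegral_fejer t : \int[lambda]_xi fejer t xi = `|t| / 2.
Proof. by rewrite /Rintegral integral_fejer. Qed.

(** Expanding the product leaves four cosines of differences of endpoints, two of each sign; the
    constants cancel, so each cosine can be completed to [1 - cos] and becomes separately
    integrable. *)
Lemma Re_interval_hatM a b c d xi : a <= b -> c <= d -> xi != 0 ->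
  complex.Re (interval_hat a b xi * (interval_hat c d xi)^*) =
  fejer (b - c) xi + fejer (a - d) xi - (fejer (b - d) xi + fejer (a - c) xi).
Proof.
move=> ab cd xi0; rewrite !interval_hatE//= /fejer.
rewrite !mulrBr !mulrBl !cosB.
have : 2 * pi * xi != 0 by rewrite mulf_neq0// gt_eqF// mulr_gt0 ?pi_gt0.
move: (2 * pi * xi) => w w0.
by field.
Qed.

Lemma sqnorm_interval_hat a b xi : a <= b -> xi != 0 ->
  normc (interval_hat a b xi) ^+ 2 = 2 * fejer (b - a) xi.
Proof.
move=> ab xi0; have := Re_interval_hatM ab ab xi0.
rewrite -(opprB b a) !subrr -[fejer (- _) _]fejer_norm normrN fejer_norm.
have -> : fejer 0 xi = 0 by rewrite /fejer mulr0 mul0r cos0 subrr mul0r.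
rewrite addr0 subr0 mulr2n mulrDl !mul1r => <-.
by rewrite sqr_normcE; case: (interval_hat a b xi) => u v /=; rewrite mulrN opprK.
Qed.

Lemma interval_hatN a b xi : interval_hat a b (- xi) = (interval_hat a b xi)^*.
Proof.
rewrite -cint_conj; last exact: cintegrable_interval_wave.
apply: eq_cint => t; rewrite /interval_wave rmorphM/= -expiN !mulrN opprK.
by rewrite conj_RtoC.
Qed.

Lemma cintegrable_interval_hatM a b c d : a <= b -> c <= d ->
  cintegrable lambda (fun xi => interval_hat a b xi * (interval_hat c d xi)^*).
Proof.
move=> ab cd; have mab := cmeas_interval_hat a b; have mcd := cmeas_interval_hat c d.
have mK : cmeas (fun xi => interval_hat a b xi * (interval_hat c d xi)^*).
  by apply: cmeasM => //; exact: cmeas_conj.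
split => //.
(* The arithmetic-geometric inequality: each squared modulus is twice a Fejer kernel. *)
apply: (@le_lt_trans _ _ (\int[lambda]_xi (fejer (b - a) xi + fejer (d - c) xi)%:E)%E).
  apply: ae_ge0_le_integral => //.
  - by move=> x _; rewrite lee_fin normc_ge0.
  - by apply/measurable_EFinP; exact: cmeas_normc.
  - by move=> x _; rewrite lee_fin addr_ge0 ?fejer_ge0.
  - by apply/measurable_EFinP; apply: measurable_funD; exact: measurable_fejer.
  have := ae_neq0; apply: (@filterS _ _ ae_lambda_filter) => xi xi0 _.
  rewrite lee_fin normcM normc_conj.
  have := sqnorm_interval_hat ab xi0; have := sqnorm_interval_hat cd xi0.
  have := sqr_ge0 (normc (interval_hat a b xi) - normc (interval_hat c d xi)).
  by rewrite sqrrB; lra.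
under eq_integral do rewrite EFinD.
rewrite ge0_integralD//.
- by rewrite !integral_fejer -EFinD ltry.
- by move=> x _; rewrite lee_fin fejer_ge0.
- by apply/measurable_EFinP; exact: measurable_fejer.
- by move=> x _; rewrite lee_fin fejer_ge0.
- by apply/measurable_EFinP; exact: measurable_fejer.
Qed.

(** The reflection of [xi] conjugates the integrand and preserves the measure, so the integral
    equals its own conjugate. *)
Lemma Im_cint_interval_hatM a b c d : a <= b -> c <= d ->
  complex.Im (cint lambda
    (fun xi => interval_hat a b xi * (interval_hat c d xi)^*)) = 0.
Proof.
move=> ab cd; have iK := cintegrable_interval_hatM ab cd.
have := @cint_preserving _ _ (measurableTypeR R) (measurableTypeR R) R
  lambda lambda -%R (@oppr_measurable R _) (@lebesgue_measureN R) _ iK.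
rewrite [LHS](_ : _ = (cint lambda
    (fun xi => interval_hat a b xi * (interval_hat c d xi)^*))^*).
  by case: (cint _ _) => u v /= [] vN; lra.
rewrite -cint_conj//; apply: eq_cint => xi /=.
by rewrite !interval_hatN rmorphM.
Qed.

Lemma Re_cint_interval_hatM a b c d : a <= b -> c <= d ->
  complex.Re (cint lambda
    (fun xi => interval_hat a b xi * (interval_hat c d xi)^*)) =
  (`|b - c| + `|a - d| - (`|b - d| + `|a - c|)) / 2.
Proof.
move=> ab cd; have [[mK _] _] := cintegrable_interval_hatM ab cd.
transitivity (\int[lambda]_xi (fejer (b - c) xi + fejer (a - d) xi -
    (fejer (b - d) xi + fejer (a - c) xi))).
  rewrite /cint/= /Rintegral; congr fine; apply: ae_eq_integral => //.
  - exact/measurable_EFinP.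
  - by apply/measurable_EFinP; apply: measurable_funB; apply: measurable_funD;
      exact: measurable_fejer.
  - have := ae_neq0; apply: (@filterS _ _ ae_lambda_filter) => xi xi0 _; congr EFin.
    exact: Re_interval_hatM.
have iD s t : lambda.-integrable [set: R] (EFin \o (fun xi => fejer s xi + fejer t xi)).
  rewrite (_ : _ \o _ = ((EFin \o fejer s) \+ (EFin \o fejer t))%E)//.
  by apply: integrableD => //; exact: integrable_fejer.
rewrite RintegralB// !RintegralD//; try exact: integrable_fejer.
by rewrite !Rintegral_fejer; lra.
Qed.

Lemma cint_interval_hatM a b c d :
  cintegrable lambda (fun xi => interval_hat a b xi * (interval_hat c d xi)^*) /\
  cint lambda (fun xi => interval_hat a b xi * (interval_hat c d xi)^*) =
    (Num.max 0 (Num.min b d - Num.max a c))%:C.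
Proof.
have cint0 : cintegrable lambda (fun=> 0) /\ cint lambda (fun=> 0) = 0 :> R[i].
  split; last by rewrite /cint/= !Rintegral_cst//= !mul0r.
  split; first exact: cmeas_cst.
  by under eq_integral do rewrite normc0; rewrite integral0.
have [ba|ab] := ltP b a.
  under eq_fun do rewrite interval_hat0// mul0r.
  by rewrite max_l//; rewrite /Num.max /Num.min; repeat case: ifPn; lra.
have [dc|cd] := ltP d c.
  under eq_fun do rewrite (@interval_hat0 c)// rmorph0 mulr0.
  by rewrite max_l//; rewrite /Num.max /Num.min; repeat case: ifPn; lra.
split; first exact: cintegrable_interval_hatM.
apply/eqP; rewrite eq_complex Re_cint_interval_hatM// Im_cint_interval_hatM//.
rewrite eqxx andbT /=; apply/eqP.
(* For ordered endpoints, half the combination of the four distances is the length of the overlap;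
   this is checked on every ordering. *)
rewrite /Num.max /Num.min; do 4 case: ger0P => ?; repeat case: ifPn; lra.
Qed.

End interval_kernel.

(** * Norms of finite combinations from Gram matrices *)

Section gram_sums.
Context d (T : measurableType d) (R : realType) (mu : {measure set T -> \bar R}).

Lemma mulc_conj (z : R[i]) : z * z^* = (normc z ^+ 2)%:C.
Proof.
rewrite sqr_normcE; case: z => a b; apply/eqP.
by rewrite eq_complex/=; apply/andP; split; apply/eqP; ring.
Qed.

Lemma integral_sqnormc (f : T -> R[i]) :
  cintegrable mu (fun x => f x * (f x)^*) ->
  (\int[mu]_x (normc (f x) ^+ 2)%:E =
   (complex.Re (cint mu (fun x => f x * (f x)^*)))%:E)%E.
Proof.
move=> fi; have [fr _] := cintegrable_ReIm fi.
rewrite /cint/= /Rintegral fineK; last exact: integrable_fin_num fr.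
by apply: eq_integral => x _; rewrite mulc_conj.
Qed.

(** The norm of a combination depends on the family only through its Gram matrix, so Plancherel's
    theorem for step functions reduces to pairs of boxes. *)
Lemma cint_gram (I : Type) (u : I -> T -> R[i]) (G : I -> I -> R[i])
    (s : seq (R[i] * I)) :
  (forall i j, cintegrable mu (fun x => u i x * (u j x)^*) /\
               cint mu (fun x => u i x * (u j x)^*) = G i j) ->
  let U x := \sum_(k <- s) k.1 * u k.2 x in
  cintegrable mu (fun x => U x * (U x)^*) /\
  cint mu (fun x => U x * (U x)^*) =
    \sum_(k <- s) \sum_(l <- s) k.1 * l.1^* * G k.2 l.2.
Proof.
move=> uG U.
have UE : (fun x => U x * (U x)^*) = (fun x => \sum_(k <- s) \sum_(l <- s)
    (k.1 * l.1^*) * (u k.2 x * (u l.2 x)^*)).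
  apply/funext => x; rewrite /U rmorph_sum/= mulr_suml; apply: eq_bigr => k _.
  by rewrite mulr_sumr; apply: eq_bigr => l _; rewrite rmorphM/= mulrACA.
have iterm (k l : R[i] * I) :
    cintegrable mu (fun x => (k.1 * l.1^*) * (u k.2 x * (u l.2 x)^*)).
  by apply: cintegrableZ; have [] := uG k.2 l.2.
rewrite UE; split.
  by apply: cintegrable_sum => k; apply: cintegrable_sum => l.
rewrite cint_sum; last by move=> k; apply: cintegrable_sum => l.
apply: eq_bigr => k _; rewrite cint_sum//; apply: eq_bigr => l _.
by have [ik <-] := uG k.2 l.2; rewrite cintZ.
Qed.

End gram_sums.

(** * Transforms of boxes and of step functions *)

Section plancherel_steps.
Context (R : realType) (d : nat).
Local Notation mu := (leb R d).
Local Notation boxes2 := ('cV[R]_d * 'cV[R]_d)%type.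
Implicit Types (x xi : 'cV[R]_d).

Definition fourier (f : 'cV[R]_d -> R[i]) (xi : 'cV[R]_d) : R[i] :=
  cint mu (fun x => f x * expi (- (2 * pi * dotp x xi))).

Lemma expi_sum (I : Type) (r : seq I) (t : I -> R) :
  expi (\sum_(i <- r) t i) = \prod_(i <- r) expi (t i).
Proof. by apply: (big_morph _ (@expiD R) (@expi0 R)). Qed.

Lemma charf_box (a b x : 'cV[R]_d) :
  charf (box a b) x =
  \prod_(i < d) (\1_(`]a i 0, b i 0]%classic : set R) (x i 0))%:C.
Proof.
rewrite -rmorph_prod/= /charf; congr (_%:C); rewrite indicE.
case: (boolP (x \in box a b)) => [/set_mem abx|abx].
  rewrite big1// => i _; rewrite indicE mem_set//=.
  by rewrite in_itv; exact: abx.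
have [i /negP xi] : exists i, ~ (a i 0 < x i 0 <= b i 0).
  by apply/existsNP => abx'; move/negP: abx; apply; exact/mem_set.
rewrite (bigD1 i)//= indicE memNset ?mul0r//= in_itv/=.
exact/negP.
Qed.

Lemma box_waveE (a b x xi : 'cV[R]_d) :
  charf (box a b) x * expi (- (2 * pi * dotp x xi)) =
  \prod_(i < d) interval_wave (a i 0) (b i 0) (xi i 0) (x i 0).
Proof.
rewrite charf_box /interval_wave big_split/=; congr (_ * _).
by rewrite -expi_sum sumrN -mulr_sumr.
Qed.

Lemma cintegrable_box_wave (a b xi : 'cV[R]_d) :
  cintegrable mu (fun x => charf (box a b) x * expi (- (2 * pi * dotp x xi))).
Proof.
rewrite (_ : (fun x => _) = fun x => \prod_(i < d)
    interval_wave (a i 0) (b i 0) (xi i 0) (x i 0)); last first.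
  by apply/funext => x; rewrite box_waveE.
have [] := @cint_leb_prod R d
  (fun i => interval_wave (a i 0) (b i 0) (xi i 0)) => // i.
exact: cintegrable_interval_wave.
Qed.

Lemma fourier_box (a b xi : 'cV[R]_d) :
  fourier (charf (box a b)) xi =
  \prod_(i < d) interval_hat (a i 0) (b i 0) (xi i 0).
Proof.
rewrite /fourier; under eq_cint do rewrite box_waveE.
have [|_ ->//] := @cint_leb_prod R d
  (fun i => interval_wave (a i 0) (b i 0) (xi i 0)).
by move=> i; exact: cintegrable_interval_wave.
Qed.

(** The volume of the intersection of the two boxes. *)
Definition box_gram (i j : boxes2) : R[i] :=
  (\prod_(k < d) Num.max 0 (Num.min (i.2 k 0) (j.2 k 0) -
                            Num.max (i.1 k 0) (j.1 k 0)))%:C.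

Lemma cint_fourier_boxM (i j : boxes2) :
  cintegrable mu (fun xi => fourier (charf (box i.1 i.2)) xi *
    (fourier (charf (box j.1 j.2)) xi)^*) /\
  cint mu (fun xi => fourier (charf (box i.1 i.2)) xi *
    (fourier (charf (box j.1 j.2)) xi)^*) = box_gram i j.
Proof.
rewrite (_ : (fun xi => _) = (fun xi : 'cV[R]_d => \prod_(k < d)
    (fun t => interval_hat (i.1 k 0) (i.2 k 0) t *
              (interval_hat (j.1 k 0) (j.2 k 0) t)^*) (xi k 0))); last first.
  by apply/funext => xi; rewrite !fourier_box rmorph_prod/= big_split.
have [|iK ->] := @cint_leb_prod R d (fun k t =>
    interval_hat (i.1 k 0) (i.2 k 0) t * (interval_hat (j.1 k 0) (j.2 k 0) t)^*).
  by move=> k; have [] := cint_interval_hatM (i.1 k 0) (i.2 k 0) (j.1 k 0) (j.2 k 0).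
split => //; rewrite /box_gram rmorph_prod/=; apply: eq_bigr => k _.
by have [] := cint_interval_hatM (i.1 k 0) (i.2 k 0) (j.1 k 0) (j.2 k 0).
Qed.

Lemma charf_box_conj (a b x : 'cV[R]_d) : (charf (box a b) x)^* = charf (box a b) x.
Proof. exact: conj_RtoC. Qed.

Lemma setI_box (i j : boxes2) : box i.1 i.2 `&` box j.1 j.2 =
  box (\col_k Num.max (i.1 k 0) (j.1 k 0)) (\col_k Num.min (i.2 k 0) (j.2 k 0)).
Proof.
apply/seteqP; split => [x [xi xj] k|x xij].
  rewrite !mxE gt_max le_min.
  by have /andP[-> ->] := xi k; have /andP[-> ->] := xj k.
by split => k; have := xij k; rewrite !mxE gt_max le_min
  => /andP[/andP[? ?] /andP[? ?]]; apply/andP.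
Qed.

Lemma cint_charf_box (a b : 'cV[R]_d) :
  cintegrable mu (charf (box a b)) /\
  cint mu (charf (box a b)) = (box_vol a b)%:C.
Proof.
have mb : measurable (box a b : set (leb_space R d)) by exact: measurable_box.
split.
  split; first by apply: cmeas_real; exact: measurable_indic.
  under eq_integral do rewrite normc_real ger0_norm//.
  by rewrite integral_indic// setIT [ltLHS]leb_box ltry.
rewrite /cint /= Rintegral_cst// mul0r; congr (_ +i* _).
by rewrite /Rintegral integral_indic// setIT [X in fine X]leb_box.
Qed.

Lemma cint_charf_boxM (i j : boxes2) :
  cintegrable mu (fun x => charf (box i.1 i.2) x * (charf (box j.1 j.2) x)^*) /\
  cint mu (fun x => charf (box i.1 i.2) x * (charf (box j.1 j.2) x)^*) =
    box_gram i j.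
Proof.
rewrite (_ : (fun x => _) = charf (box i.1 i.2 `&` box j.1 j.2)); last first.
  apply/funext => x; rewrite charf_box_conj /charf -rmorphM/=.
  by congr (_%:C); rewrite indicI.
rewrite setI_box; have [ib ->] := cint_charf_box
  (\col_k Num.max (i.1 k 0) (j.1 k 0)) (\col_k Num.min (i.2 k 0) (j.2 k 0)).
split => //; rewrite /box_gram /box_vol; congr (_%:C).
by apply: eq_bigr => k _; rewrite !mxE.
Qed.

Definition stepf (s : seq (R[i] * boxes2)) (x : 'cV[R]_d) : R[i] :=
  \sum_(k <- s) k.1 * charf (box k.2.1 k.2.2) x.

Lemma fourier_stepf s xi :
  fourier (stepf s) xi = \sum_(k <- s) k.1 * fourier (charf (box k.2.1 k.2.2)) xi.
Proof.
rewrite /fourier; under eq_cint do rewrite /stepf mulr_suml.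
under eq_cint do under eq_bigr do rewrite -mulrA.
have iw (k : R[i] * boxes2) := cintegrable_box_wave k.2.1 k.2.2 xi.
rewrite cint_sum; last by move=> k; apply: cintegrableZ; exact: iw.
by apply: eq_bigr => k _; rewrite cintZ//; exact: iw.
Qed.

Lemma plancherel_stepf s :
  (sqnorm2 (fourier (stepf s)) = sqnorm2 (stepf s) /\
   sqnorm2 (stepf s) < +oo)%E.
Proof.
have [iF IF] := cint_gram s cint_fourier_boxM.
have [iS IS] := cint_gram s cint_charf_boxM.
have -> : fourier (stepf s) = fun xi =>
    \sum_(k <- s) k.1 * fourier (charf (box k.2.1 k.2.2)) xi.
  by apply/funext => xi; rewrite fourier_stepf.
by rewrite /sqnorm2 !integral_sqnormc// IF IS; split=> //; exact: ltry.
Qed.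

End plancherel_steps.

(** * Density of step functions *)

Section step_algebra.
Context (R : realType) (d : nat).
Local Notation boxes2 := ('cV[R]_d * 'cV[R]_d)%type.

Definition is_step (f : 'cV[R]_d -> R[i]) := exists s, forall x, f x = stepf s x.

Lemma is_step_box (i : boxes2) : is_step (charf (box i.1 i.2)).
Proof. by exists [:: (1, i)] => x; rewrite /stepf big_seq1 mul1r. Qed.

Lemma is_step0 : is_step (fun=> 0).
Proof. by exists [::] => x; rewrite /stepf big_nil. Qed.

Lemma is_stepD f g : is_step f -> is_step g -> is_step (fun x => f x + g x).
Proof. by move=> [s fs] [t gt]; exists (s ++ t) => x; rewrite /stepf big_cat fs gt. Qed.

Lemma is_stepZ c f : is_step f -> is_step (fun x => c * f x).
Proof.
move=> [s fs]; exists [seq (c * k.1, k.2) | k <- s] => x.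
by rewrite fs /stepf big_map mulr_sumr; apply: eq_bigr => k _; rewrite mulrA.
Qed.

Lemma is_step_boxM (i : boxes2) t :
  is_step (fun x => charf (box i.1 i.2) x * stepf t x).
Proof.
elim: t => [|l t [q IHt]].
  by exists [::] => x; rewrite /stepf !big_nil mulr0.
exists ((l.1, (\col_k Num.max (i.1 k 0) (l.2.1 k 0),
               \col_k Num.min (i.2 k 0) (l.2.2 k 0))) :: q) => x.
rewrite {1}/stepf big_cons mulrDr -/(stepf t x) IHt [RHS]/stepf big_cons; congr (_ + _).
rewrite mulrCA; congr (_ * _); rewrite -setI_box /charf -rmorphM/=.
by congr (_%:C); rewrite indicI.
Qed.

Lemma is_stepM f g : is_step f -> is_step g -> is_step (fun x => f x * g x).
Proof.
move=> [s fs] [t gt].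
suff : is_step (fun x => \sum_(k <- s) k.1 * (charf (box k.2.1 k.2.2) x * stepf t x)).
  move=> [r fr]; exists r => x; rewrite fs gt -fr /stepf mulr_suml.
  by apply: eq_bigr => k _; rewrite mulrA.
elim: s {fs} => [|k s [r IHs]]; first by exists [::] => x; rewrite /stepf !big_nil.
have [q kq] := is_stepZ k.1 (is_step_boxM k.2 t).
by exists (q ++ r) => x; rewrite big_cons IHs kq /stepf big_cat.
Qed.

Lemma is_step_setU (A B : set 'cV[R]_d) :
  is_step (charf A) -> is_step (charf B) -> is_step (charf (A `|` B)).
Proof.
move=> sA sB.
have [s fs] := is_stepD (is_stepD sA sB) (is_stepZ (-1) (is_stepM sA sB)).
exists s => x; rewrite -fs /charf !indicE in_setU.
case: (x \in A) (x \in B) => [] []; rewrite /= ?mulr1 ?mulr0 ?addr0 ?add0r//.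
by rewrite addrK.
Qed.

Lemma is_step_bigsetU n (B : nat -> set 'cV[R]_d) :
  (forall i, is_step (charf (B i))) ->
  is_step (charf (\big[setU/set0]_(i < n) B i)).
Proof.
move=> sB; elim: n => [|n IHn]; last by rewrite big_ord_recr; exact: is_step_setU.
rewrite big_ord0; have [s fs] := is_step0; exists s => x.
by rewrite -fs /charf indic0.
Qed.

Lemma cmeas_is_step f : is_step f -> @cmeas _ (leb_space R d) R f.
Proof.
move=> [s fs]; rewrite (_ : f = stepf s); last exact/funext.
apply: cmeas_sum => k; apply: cmeasM; first exact: cmeas_cst.
by apply: cmeas_real; apply: measurable_indic; exact: measurable_box.
Qed.

End step_algebra.

Lemma cvge_exists_le (R : realType) (u : nat -> \bar R) (l c : \bar R) :
  u @ \oo --> l -> (l < c)%E -> exists n, (u n <= c)%E.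
Proof.
move=> ul lc; apply: contrapT => /forallNP uc; move: lc; apply/negP; rewrite -leNgt.
rewrite -(cvg_lim _ ul)//; apply: lime_ge; first by apply/cvg_ex; exists l.
by apply: nearW => n; apply: ltW; rewrite ltNge; apply/negP; exact: uc.
Qed.

Import HBNNSimple.

(** * Approximation by step functions in a weighted sense *)

Section density.
Context (R : realType) (d : nat) (theta : R) (theta0 : 0 <= theta).
Local Notation mu := (leb R d).
Local Notation lmeas := (@cmeas _ (leb_space R d) R).
Implicit Types f g : 'cV[R]_d -> R[i].

(* theta = 0 gives approximation in L^2, theta = 1 in L^1 and L^2 at once. *)
Definition wt (z : R[i]) : R := theta * normc z + normc z ^+ 2.

Definition wint f : \bar R := (\int[mu]_x (wt (f x))%:E)%E.

Lemma wt_ge0 z : 0 <= wt z.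
Proof. by rewrite addr_ge0 ?sqr_ge0// mulr_ge0// normc_ge0. Qed.

Lemma le_wt z w : normc z <= normc w -> wt z <= wt w.
Proof.
move=> zw; rewrite lerD ?ler_wpM2l//.
by rewrite ler_sqr ?nnegrE ?normc_ge0.
Qed.

Lemma wtD z w : wt (z + w) <= 2 * (wt z + wt w).
Proof.
have h := le_normcD z w; have := normc_ge0 z; have := normc_ge0 w.
have := normc_ge0 (z + w); rewrite /wt.
move: (normc z) (normc w) (normc (z + w)) h => a b c h c0 b0 a0.
have h1 : theta * c <= theta * (a + b) by rewrite ler_wpM2l.
have h2 : c ^+ 2 <= (a + b) ^+ 2 by rewrite ler_sqr ?nnegrE// addr_ge0.
have := mulr_ge0 theta0 a0; have := mulr_ge0 theta0 b0; have := sqr_ge0 (a - b).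
rewrite sqrrB; move: h2; rewrite sqrrD; lra.
Qed.

Lemma wtZ c z : wt (c * z) <= (normc c + normc c ^+ 2) * wt z.
Proof.
rewrite /wt normcM exprMn.
have := normc_ge0 c; have := normc_ge0 z.
move: (normc z) (normc c) => a b a0 b0.
have := mulr_ge0 (mulr_ge0 theta0 a0) (sqr_ge0 b); have := mulr_ge0 b0 (sqr_ge0 a).
by nra.
Qed.

Lemma measurable_wt f : lmeas f ->
  measurable_fun [set: leb_space R d] (fun x => wt (f x)).
Proof.
move=> mf; have mn := cmeas_normc mf.
by apply: measurable_funD; [exact: measurable_funM|exact: measurable_funX].
Qed.

Lemma wint_ge0 f : (0 <= wint f)%E.
Proof. by apply: integral_ge0 => x _; rewrite lee_fin wt_ge0. Qed.

Lemma le_wint f g : lmeas f -> lmeas g -> (forall x, normc (f x) <= normc (g x)) ->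
  (wint f <= wint g)%E.
Proof.
move=> mf mg fg; apply: ge0_le_integral; first exact: measurableT.
- by move=> x _; rewrite lee_fin wt_ge0.
- by apply/measurable_EFinP; exact: measurable_wt.
- by apply/measurable_EFinP; exact: measurable_wt.
- by move=> x _; rewrite lee_fin le_wt.
Qed.

Lemma wintD f g : lmeas f -> lmeas g ->
  (wint (fun x => f x + g x)%R <= 2%:E * (wint f + wint g))%E.
Proof.
move=> mf mg; have mfg := cmeasD mf mg.
have mEf := measurable_wt mf; have mEg := measurable_wt mg.
rewrite -(ge0_integralD mu measurableT); first last.
- exact/measurable_EFinP.
- by move=> x _; rewrite lee_fin wt_ge0.
- exact/measurable_EFinP.
- by move=> x _; rewrite lee_fin wt_ge0.
rewrite -(ge0_integralZl mu measurableT); first last.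
- by rewrite lee_fin.
- by move=> x _; rewrite -EFinD lee_fin addr_ge0 ?wt_ge0.
- by apply/measurable_EFinP; exact: measurable_funD.
apply: ge0_le_integral; first exact: measurableT.
- by move=> x _; rewrite lee_fin wt_ge0.
- by apply/measurable_EFinP; exact: measurable_wt.
- apply: emeasurable_funM; first exact: measurable_cst.
  by apply/measurable_EFinP; exact: measurable_funD.
- by move=> x _; rewrite -EFinD -EFinM lee_fin wtD.
Qed.

Lemma wintZ (c : R[i]) f : lmeas f ->
  (wint (fun x => c * f x)%R <= (normc c + normc c ^+ 2)%:E * wint f)%E.
Proof.
move=> mf; have mc : lmeas (fun x => c * f x).
  by apply: cmeasM mf; exact: cmeas_cst.
have c0 : 0 <= normc c + normc c ^+ 2 by rewrite addr_ge0 ?sqr_ge0 ?normc_ge0.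
rewrite -(ge0_integralZl mu measurableT); first last.
- by rewrite lee_fin.
- by move=> x _; rewrite lee_fin wt_ge0.
- by apply/measurable_EFinP; exact: measurable_wt.
apply: ge0_le_integral; first exact: measurableT.
- by move=> x _; rewrite lee_fin wt_ge0.
- by apply/measurable_EFinP; exact: measurable_wt.
- by apply: emeasurable_funM; [exact: measurable_cst|apply/measurable_EFinP; exact: measurable_wt].
- by move=> x _; rewrite -EFinM lee_fin wtZ.
Qed.

Definition step_approx f := lmeas f /\ forall e : R, 0 < e ->
  exists2 s, is_step s & (wint (fun x => f x - s x)%R <= e%:E)%E.

Lemma cmeasB f g : lmeas f -> lmeas g ->
  lmeas (fun x => f x - g x).
Proof.
move=> mf mg; rewrite (_ : (fun x => _) = fun x => f x + (-1) * g x).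
  by apply: (cmeasD mf); apply: cmeasM mg; exact: cmeas_cst.
by apply/funext => x; rewrite mulN1r.
Qed.

Lemma step_approxD f g : step_approx f -> step_approx g ->
  step_approx (fun x => f x + g x).
Proof.
move=> [mf af] [mg ag]; split; first exact: cmeasD.
move=> e e0; have e40 : 0 < e / 4 by rewrite divr_gt0.
have [s ss fs] := af _ e40; have [t st gt] := ag _ e40.
exists (fun x => s x + t x); first exact: is_stepD.
rewrite (_ : (fun x => _) = fun x => (f x - s x) + (g x - t x)); last first.
  by apply/funext => x; rewrite opprD addrACA.
apply: le_trans (wintD _ _) _.
- by apply: cmeasB; [|exact: cmeas_is_step].
- by apply: cmeasB; [|exact: cmeas_is_step].
rewrite (_ : e = 2 * (e / 4 + e / 4)); last by field.
by rewrite EFinM lee_pmul2l// EFinD leeD.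
Qed.

Lemma step_approxZ c f : step_approx f -> step_approx (fun x => c * f x).
Proof.
move=> [mf af]; split; first by apply: cmeasM mf; exact: cmeas_cst.
move=> e e0; pose K := normc c + normc c ^+ 2 + 1.
have K0 : 0 < K by rewrite ltr_wpDl// addr_ge0 ?sqr_ge0 ?normc_ge0.
have [s ss fs] := af (e / K) (divr_gt0 e0 K0).
exists (fun x => c * s x); first exact: is_stepZ.
rewrite (_ : (fun x => _) = fun x => c * (f x - s x)); last first.
  by apply/funext => x; rewrite mulrBr.
apply: le_trans (wintZ _ _) _; first by apply: cmeasB; [|exact: cmeas_is_step].
apply: (@le_trans _ _ (K%:E * wint (fun x => f x - s x)%R)%E).
  by rewrite lee_wpmul2r ?wint_ge0// lee_fin lerDl.
rewrite (_ : e = K * (e / K)); last by rewrite mulrC divfK// gt_eqF.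
by rewrite EFinM lee_pmul2l.
Qed.

Lemma step_approx0 : step_approx (fun=> 0).
Proof.
split; first exact: cmeas_cst.
move=> e e0; exists (fun=> 0); first exact: is_step0.
rewrite /wint integral0_eq ?lee_fin ?ltW// => x _.
by rewrite subrr /wt normc0 mulr0 expr0n addr0.
Qed.

Lemma step_approx_sum (I : Type) (r : seq I) (F : I -> 'cV[R]_d -> R[i]) :
  (forall i, step_approx (F i)) -> step_approx (fun x => \sum_(i <- r) F i x).
Proof.
move=> aF; elim: r => [|i r IHr].
  rewrite (_ : (fun x => _) = fun=> 0); first exact: step_approx0.
  by apply/funext => x; rewrite big_nil.
rewrite (_ : (fun x => _) = fun x => F i x + \sum_(i <- r) F i x).
  exact: step_approxD.
by apply/funext => x; rewrite big_cons.
Qed.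

Lemma step_approx_limit f : lmeas f ->
  (forall e : R, 0 < e -> exists2 g, step_approx g &
     (wint (fun x => f x - g x)%R <= e%:E)%E) -> step_approx f.
Proof.
move=> mf fg; split => // e e0; have e40 : 0 < e / 4 by rewrite divr_gt0.
have [g [mg ag] fge] := fg _ e40; have [s ss gs] := ag _ e40.
exists s => //.
rewrite (_ : (fun x => _) = fun x => (f x - g x) + (g x - s x)); last first.
  by apply/funext => x; rewrite addrA subrK.
apply: le_trans (wintD _ _) _.
- exact: cmeasB.
- by apply: cmeasB; [|exact: cmeas_is_step].
rewrite (_ : e = 2 * (e / 4 + e / 4)); last by field.
by rewrite EFinM lee_pmul2l// EFinD leeD.
Qed.


Lemma cmeas_charf (E : set (leb_space R d)) : measurable E -> lmeas (charf E).
Proof. by move=> mE; apply: cmeas_real; exact: measurable_indic. Qed.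

Lemma wint_charfB (A B : set (leb_space R d)) : measurable A -> measurable B ->
  (wint (fun x => charf A x - charf B x)%R =
  (theta + 1)%R%:E * mu ((A `\` B) `|` (B `\` A)))%E.
Proof.
move=> mA mB; have mAB : measurable ((A `\` B) `|` (B `\` A)).
  by apply: measurableU; exact: measurableD.
rewrite -[X in mu X]setIT -integral_indic// -(ge0_integralZl mu measurableT); first last.
- by rewrite lee_fin addr_ge0.
- by move=> x _; rewrite lee_fin.
- by apply/measurable_EFinP; exact: measurable_indic.
apply: eq_integral => x _; rewrite -EFinM; congr (_%:E).
rewrite /wt /charf -rmorphB normc_real !indicE in_setU !in_setD.
case: (x \in A) (x \in B) => [] []; rewrite /= ?subrr ?subr0 ?sub0r ?normrN ?normr1 ?normr0; ring.
Qed.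

(** By definition of the outer measure, countably many boxes cover E with excess [e1]; finitely many
    of them miss at most [e1] of their union. The symmetric difference is thus at most [e1 + e1],
    and [theta + 1] is the weight [wt] of a unit value. *)
Lemma step_approx_charf (E : set (leb_space R d)) : measurable E ->
  (mu E < +oo)%E -> step_approx (charf E).
Proof.
move=> mE Eoo; split; first exact: cmeas_charf.
move=> e e0; pose e1 := e / (2 * (theta + 1)).
have th0 : 0 < 2 * (theta + 1) by rewrite mulr_gt0// ltr_wpDl.
have e10 : 0 < e1 by rewrite divr_gt0.
have Efin : leb_outer E \is a fin_num by rewrite ge0_fin_numE// outer_measure_ge0.
have [_ [D [cD ED] <-] Dlt] := lb_ereal_inf_adherent e10 Efin.
have [B [sB mB EB Ble]] : exists B : nat -> set (leb_space R d),
    [/\ forall i, is_step (charf (B i)), forall i, measurable (B i),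
      E `<=` \bigcup_i B i & (mu (\bigcup_i B i) <= mu E + e1%:E)%E].
  have s0 : is_step (charf (set0 : set 'cV[R]_d)).
    by have [s fs] := @is_step0 R d; exists s => x; rewrite -fs /charf indic0.
  have [D0|[P [u [uP DE]]]] := countable_set_image cD.
    exists (fun=> set0); split => //.
      by move: ED; rewrite D0 bigcup_set0 => /subset_trans; exact.
    by rewrite bigcup0// measure0 adde_ge0// lee_fin ltW.
  pose B i := if i \in P then box (u i).1 (u i).2 else set0.
  have BE : \bigcup_i B i = \bigcup_(ab in D) box ab.1 ab.2.
    rewrite DE bigcup_image; apply/seteqP; split => [x [i _]|x [i Pi xi]].
      by rewrite /B; case: ifPn => // /set_mem Pi xi; exists i.
    by exists i => //; rewrite /B mem_set.
  exists B; split.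
  - by move=> i; rewrite /B; case: ifP => // _; exact: is_step_box.
  - by move=> i; rewrite /B; case: ifP => // _; exact: measurable_box.
  - by rewrite BE.
  - rewrite BE; apply: le_trans (ltW Dlt);
    apply: le_trans (leb_outer_esum cD (@subset_refl _ _)) _.
    by under eq_esum do rewrite leb_outer_box.
pose F n := \big[setU/set0]_(i < n) B i.
have mF n : measurable (F n) by exact: bigsetU_measurable.
have mU : measurable (\bigcup_i B i) by exact: bigcup_measurable.
have UF : \bigcup_i B i = \bigcup_n F n.+1 by rewrite [RHS]bigcup_bigsetU_bigcup.
have Uoo : (mu (\bigcup_i B i) < +oo)%E.
  by apply: le_lt_trans Ble _; exact: lte_add_pinfty (ltry _).
have [n Fn] : exists n, (mu (\bigcup_i B i) <= mu (F n.+1) + e1%:E)%E.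
  have cF : mu \o (fun n => F n.+1) @ \oo --> mu (\bigcup_i B i).
    rewrite UF; apply: nondecreasing_cvg_mu => //; first by rewrite -UF.
    by apply/nondecreasing_seqP => n; apply/subsetPset; exact: subset_bigsetU.
  apply: contrapT => /forallNP Fn.
  have Ufin : mu (\bigcup_i B i) \is a fin_num by rewrite ge0_fin_numE.
  suff : (mu (\bigcup_i B i) <= mu (\bigcup_i B i) - e1%:E)%E.
    by move: (mu _) Ufin => [r| |]// _; rewrite -EFinB lee_fin lerDl oppr_ge0 leNgt e10.
  rewrite -[leLHS](cvg_lim _ cF)//; apply: lime_le.
    by apply/cvg_ex; exists (mu (\bigcup_i B i)).
  apply: nearW => n; rewrite leeBrDr//; apply: ltW.
  by rewrite ltNge; apply/negP; exact: Fn.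
exists (charf (F n.+1)); first exact: is_step_bigsetU.
rewrite wint_charfB// (_ : e = (theta + 1) * (e1 + e1)); last first.
  by rewrite /e1; field; rewrite gt_eqF// ltr_wpDl.
rewrite EFinM lee_pmul2l ?lte_fin ?ltr_wpDl//.
apply: (le_trans (measureU2 _ _ _)); [exact: measurableD|exact: measurableD|].
rewrite EFinD; apply: leeD.
  have FU : F n.+1 `<=` \bigcup_i B i.
    by rewrite /F -bigcup_mkord; apply: bigcup_sub => i _; exact: bigcup_sup.
  apply: (@le_trans _ _ (mu (\bigcup_i B i `\` F n.+1))).
    by apply: le_measure; rewrite ?inE; [exact: measurableD|exact: measurableD|exact: setSD].
  by rewrite measureD// (setIidr FU) leeBlDl// ge0_fin_numE//;
    apply: le_lt_trans Uoo; apply: le_measure; rewrite ?inE.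
apply: (@le_trans _ _ (mu (\bigcup_i B i `\` E))).
  apply: le_measure; rewrite ?inE; [exact: measurableD|exact: measurableD|].
  apply: setSD; rewrite /F -bigcup_mkord; apply: bigcup_sub => i _; exact: bigcup_sup.
by rewrite measureD// (setIidr EB) leeBlDl.
Qed.

Lemma step_approx_nnsfun (f : {nnsfun (leb_space R d) >-> R}) :
  (wint (fun x => (f x)%:C) < +oo)%E -> step_approx (fun x => (f x)%:C).
Proof.
move=> foo; pose E c : set (leb_space R d) := f @^-1` [set c].
have mE c : measurable (E c) by exact: measurable_sfunP.
have fE (x : 'cV[R]_d) : (f x)%:C =
    \sum_(c <- finmap.enum_fset (fset_set (range f))) c%:C * charf (E c) x.
  rewrite {1}(fimfunE f x) fsbig_finite//= rmorph_sum/=; apply: eq_bigr => c _.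
  by rewrite /charf -rmorphM.
rewrite (_ : (fun x => _) = fun x : 'cV[R]_d =>
    \sum_(c <- finmap.enum_fset (fset_set (range f))) c%:C * charf (E c) x); last exact/funext.
apply: step_approx_sum => c {fE}.
(* The zero level may have infinite measure but contributes nothing; any other level has finite
   measure because [c ^+ 2 * mu (E c)] is bounded by the weighted integral. *)
have [->|c0] := eqVneq c 0.
  rewrite (_ : (fun x => _) = fun=> 0); first exact: step_approx0.
  by apply/funext => x; rewrite mul0r.
apply: step_approxZ; apply: step_approx_charf => //.
have : ((c ^+ 2)%:E * mu (E c) < +oo)%E.
  apply: le_lt_trans foo; rewrite -[X in mu X]setIT -integral_indic//.
  rewrite -(ge0_integralZl mu measurableT); first last.
  - by rewrite lee_fin sqr_ge0.
  - by move=> x _; rewrite lee_fin.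
  - by apply/measurable_EFinP; exact: measurable_indic.
  apply: ge0_le_integral; first exact: measurableT.
  - by move=> x _; rewrite -EFinM lee_fin mulr_ge0// sqr_ge0.
  - apply: emeasurable_funM; first exact: measurable_cst.
    by apply/measurable_EFinP; exact: measurable_indic.
  - by apply/measurable_EFinP; apply: measurable_wt; apply: cmeas_real.
  move=> x _; rewrite -EFinM lee_fin /wt normc_real indicE.
  case: (boolP (x \in E c)) => [/set_mem <-|_].
    by rewrite mulr1 real_normK ?num_real// lerDr mulr_ge0.
  by rewrite mulr0 addr_ge0 ?sqr_ge0// mulr_ge0.
have c20 : 0 < c ^+ 2 by rewrite exprn_even_gt0.
by case: (mu (E c)) => [r _| |]//; [exact: ltry|rewrite gt0_muley].
Qed.

Lemma step_approx_ge0 (f : leb_space R d -> R) : measurable_fun setT f ->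
  (forall x, 0 <= f x) -> (wint (fun x => (f x)%:C) < +oo)%E ->
  step_approx (fun x => (f x)%:C).
Proof.
move=> mf f0 foo.
have mEf : measurable_fun setT (EFin \o f) by exact/measurable_EFinP.
have f0' (x : leb_space R d) : [set: leb_space R d] x -> (0 <= (EFin \o f) x)%E by rewrite lee_fin.
pose g := nnsfun_approx measurableT mEf.
have gf n x : g n x <= f x.
  rewrite -lee_fin /g nnsfun_approxE.
  exact: (@le_approx _ _ _ setT (EFin \o f) n x f0' I).
have cg x : (g n x) @[n --> \oo] --> f x.
  have := @cvg_nnsfun_approx _ _ _ _ measurableT (EFin \o f) mEf f0' x I.
  by move=> /fine_cvgP[_].
have mfC : lmeas (fun x => (f x)%:C) by exact: cmeas_real.
have mgC n : lmeas (fun x => (g n x)%:C) by apply: cmeas_real.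
apply: step_approx_limit => // e e0.
pose h n x := (wt ((f x)%:C - (g n x)%:C))%:E.
have mh n : measurable_fun [set: leb_space R d] (h n).
  by apply/measurable_EFinP; apply: measurable_wt; exact: cmeasB.
(* The weight of f itself dominates, as [0 <= f - g n <= f]. *)
have [||||_ _ ch] := @dominated_convergence _ _ _ mu _ measurableT h (cst 0%E)
  (fun x => (wt (f x)%:C)%:E) mh.
- exact: measurable_cst.
- apply: aeW => x _; apply: cvg_EFin; first exact: nearW.
  rewrite (_ : fine \o _ = fun n => theta * `|f x - g n x| + `|f x - g n x| * `|f x - g n x|); last first.
    by apply/funext => n; rewrite /h/= -rmorphB /wt normc_real.
  have dg : `|f x - g n x| @[n --> \oo] --> (0 : R).
    by rewrite -[X in _ --> X](normr0 R) -(subrr (f x)); apply: cvg_norm;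
      apply: cvgB => //; exact: cvg_cst.
  rewrite -[X in _ --> X](_ : theta * 0 + 0 * 0 = 0); last by rewrite !mulr0 addr0.
  by apply: cvgD; apply: cvgM => //; exact: cvg_cst.
- apply/integrableP; split; first by apply/measurable_EFinP; exact: measurable_wt.
  by under eq_integral do rewrite abse_EFin ger0_norm ?wt_ge0//.
- apply: aeW => x n _; rewrite /h abse_EFin ger0_norm ?wt_ge0// lee_fin; apply: le_wt.
  rewrite -rmorphB !normc_real ger0_norm ?subr_ge0// ger0_norm//.
  by rewrite gerBl.
rewrite integral0 in ch; have e0E : (0 < e%:E)%E by rewrite lte_fin.
have [n hn] := cvge_exists_le ch e0E.
exists (fun x => (g n x)%:C) => //; apply: step_approx_nnsfun.
apply: le_lt_trans foo; apply: le_wint => // x; rewrite !normc_real !ger0_norm//.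
Qed.

Lemma step_approx_wint f : lmeas f -> (wint f < +oo)%E -> step_approx f.
Proof.
move=> mf foo; have [mr mi] := mf.
have part (u : leb_space R d -> R) : measurable_fun setT u ->
    (forall x, 0 <= u x) -> (forall x, u x <= normc (f x)) ->
    step_approx (fun x => (u x)%:C).
  move=> mu0 u0 uf; apply: (step_approx_ge0 mu0 u0).
  apply: le_lt_trans foo; apply: le_wint; [exact: cmeas_real|exact: mf|move=> x].
  by rewrite normc_real ger0_norm.
have parts (u : leb_space R d -> R) : measurable_fun setT u ->
    (forall x, `|u x| <= normc (f x)) -> step_approx (fun x => (u x)%:C).
  move=> mu0 uf; rewrite (_ : (fun x => _) = fun x : 'cV[R]_d =>
      (Num.max (u x) 0)%:C + (-1) * (Num.max (- u x) 0)%:C); last first.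
    apply/funext => x; rewrite mulN1r -rmorphB; congr (_%:C).
    by case: (leP (u x) 0) => h; [rewrite max_l ?oppr_ge0//|rewrite max_r ?oppr_le0 1?ltW//]; ring.
  apply: step_approxD; last apply: step_approxZ; apply: part.
  - by apply: measurable_maxr => //; exact: measurable_cst.
  - by move=> x; rewrite le_max lexx orbT.
  - by move=> x; rewrite ge_max normc_ge0 (le_trans (ler_norm _) (uf x)).
  - by apply: measurable_maxr; [exact: measurableT_comp (@oppr_measurable R setT) mu0|exact: measurable_cst].
  - by move=> x; rewrite le_max lexx orbT.
  - by move=> x; rewrite ge_max normc_ge0 (le_trans (ler_norm _)) ?normrN.
rewrite (_ : f = fun x => (complex.Re (f x))%:C + 'i * (complex.Im (f x))%:C); last first.
  by apply/funext => x; rewrite -complexE; case: (f x).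
apply: step_approxD; last apply: step_approxZ; apply: parts => //.
  by move=> x; exact: Re_le_normc.
by move=> x; exact: Im_le_normc.
Qed.

End density.

(** * Square-integrable functions *)

Section L2_theory.
Context (R : realType) (d : nat).
Local Notation mu := (leb R d).
Local Notation lmeas := (@cmeas _ (leb_space R d) R).
Implicit Types f g r : 'cV[R]_d -> R[i].

Lemma measurable_sqnormc f : lmeas f ->
  measurable_fun [set: leb_space R d] (fun x => (normc (f x) ^+ 2)%:E).
Proof.
by move=> mf; apply/measurable_EFinP; apply: measurable_funX; exact: cmeas_normc.
Qed.

Lemma wint0E f : wint 0 f = sqnorm2 f.
Proof. by apply: eq_integral => x _; rewrite /wt mul0r add0r. Qed.

Lemma sqnorm2_ge0 f : (0 <= sqnorm2 f)%E.
Proof. by apply: integral_ge0 => x _; rewrite lee_fin sqr_ge0. Qed.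

Lemma le_sqnorm2_wint f : lmeas f -> (sqnorm2 f <= wint 1 f)%E.
Proof.
move=> mf; apply: ge0_le_integral; first exact: measurableT.
- by move=> x _; rewrite lee_fin sqr_ge0.
- exact: measurable_sqnormc.
- by apply/measurable_EFinP; exact: measurable_wt.
- by move=> x _; rewrite lee_fin /wt mul1r lerDr normc_ge0.
Qed.

Lemma L2D f g : L2 f -> L2 g -> L2 (fun x => f x + g x).
Proof.
move=> [mf foo] [mg goo]; split; first exact: (cmeasD mf mg).
rewrite -wint0E; apply: le_lt_trans (wintD (lexx 0) mf mg) _.
by rewrite !wint0E lte_mul_pinfty// lte_add_pinfty.
Qed.

Lemma L2Z (c : R[i]) f : L2 f -> L2 (fun x => c * f x).
Proof.
move=> [mf foo]; split; first by apply: (cmeasM _ mf); exact: cmeas_cst.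
rewrite -wint0E; apply: le_lt_trans (wintZ (lexx 0) c mf) _.
rewrite wint0E lte_mul_pinfty// lee_fin addr_ge0 ?sqr_ge0//; exact: normc_ge0.
Qed.

Lemma L2B f g : L2 f -> L2 g -> L2 (fun x => f x - g x).
Proof.
move=> Lf Lg; rewrite (_ : (fun x => _) = fun x => f x + (-1) * g x).
  exact: (L2D Lf (L2Z (-1) Lg)).
by apply/funext => x; rewrite mulN1r.
Qed.

Lemma L2_step f : is_step f -> L2 f.
Proof.
move=> sf; split; first exact: cmeas_is_step.
by have [s fs] := sf; rewrite (_ : f = stepf s); [have [] := plancherel_stepf s|exact/funext].
Qed.

Lemma ge0_integralDZ (a b : R) (u v : leb_space R d -> \bar R) : 0 <= a -> 0 <= b ->
  measurable_fun setT u -> measurable_fun setT v ->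
  (forall x, 0 <= u x)%E -> (forall x, 0 <= v x)%E ->
  (\int[mu]_x (a%:E * u x + b%:E * v x) =
   a%:E * \int[mu]_x u x + b%:E * \int[mu]_x v x)%E.
Proof.
move=> a0 b0 mu0 mv u0 v0.
rewrite (ge0_integralD mu measurableT); first last.
- by apply: emeasurable_funM mv; exact: measurable_cst.
- by move=> x _; rewrite mule_ge0// lee_fin.
- by apply: emeasurable_funM mu0; exact: measurable_cst.
- by move=> x _; rewrite mule_ge0// lee_fin.
rewrite (ge0_integralZl mu measurableT mu0); first last.
- by rewrite lee_fin.
- by move=> x _; exact: u0.
by rewrite (ge0_integralZl mu measurableT mv).
Qed.

Lemma cintegrable_L2M f g : L2 f -> L2 g ->
  cintegrable mu (fun x => f x * (g x)^*).
Proof.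
move=> [mf foo] [mg goo].
have mn u : lmeas u -> measurable_fun [set: leb_space R d] (fun x => normc (u x) ^+ 2).
  by move=> mu0; apply: measurable_funX; exact: cmeas_normc.
apply: (@cintegrable_le _ (leb_space R d) _ mu _ (fun x => normc (f x) ^+ 2 + normc (g x) ^+ 2)).
- by apply: (cmeasM mf); exact: cmeas_conj.
- by apply: measurable_funD; exact: mn.
- move=> x; rewrite normcM normc_conj.
  have := sqr_ge0 (normc (f x) - normc (g x)).
  have := sqr_ge0 (normc (f x) + normc (g x)).
  rewrite sqrrB sqrrD; lra.
under eq_integral do rewrite EFinD -[(normc (f _) ^+ 2)%:E]mul1e -[(normc (g _) ^+ 2)%:E]mul1e.
rewrite (ge0_integralDZ ler01 ler01); first 1 last.
- exact: measurable_sqnormc.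
- exact: measurable_sqnormc.
- by move=> x; rewrite lee_fin sqr_ge0.
- by move=> x; rewrite lee_fin sqr_ge0.
by rewrite !mul1e lte_add_pinfty.
Qed.

Lemma inner2D f r g : L2 f -> L2 r -> L2 g ->
  inner2 (fun x => f x + r x) g = inner2 f g + inner2 r g.
Proof.
move=> Lf Lr Lg; rewrite -[RHS](cintD (cintegrable_L2M Lf Lg) (cintegrable_L2M Lr Lg)).
by apply: eq_cint => x; rewrite mulrDl.
Qed.

(* Weighted AM-GM: ab <= a^2/e + e b^2 replaces the Cauchy-Schwarz inequality. *)
Lemma normc_inner2_small e r g : 0 < e -> L2 r -> L2 g ->
  (sqnorm2 r <= (e ^+ 2)%:E)%E -> normc (inner2 r g) <= e * (1 + fine (sqnorm2 g)).
Proof.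
move=> e0 Lr Lg re; have [mr _] := Lr; have [mg goo] := Lg.
have gfin : sqnorm2 g \is a fin_num by rewrite ge0_fin_numE// sqnorm2_ge0.
have e1 : 0 < e^-1 by rewrite invr_gt0.
rewrite -lee_fin; apply: (le_trans (normc_cint_le (cintegrable_L2M Lr Lg))).
apply: (@le_trans _ _ (\int[mu]_x (e^-1%:E * (normc (r x) ^+ 2)%:E +
    e%:E * (normc (g x) ^+ 2)%:E))%E).
  apply: ge0_le_integral; first exact: measurableT.
  - by move=> x _; rewrite lee_fin; exact: normc_ge0.
  - apply/measurable_EFinP; apply: cmeas_normc.
    by have [] := cintegrable_L2M Lr Lg.
  - by apply: emeasurable_funD; (apply: emeasurable_funM; first exact: measurable_cst);
      exact: measurable_sqnormc.
  move=> x _; rewrite -!EFinM -EFinD lee_fin normcM normc_conj.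
  move: (normc (r x)) (normc (g x)) (normc_ge0 (r x)) (normc_ge0 (g x)) => a b a0 b0.
  have h1 : 0 <= e^-1 * (a - e * b) ^+ 2 by rewrite mulr_ge0 ?sqr_ge0// ltW.
  have ab0 : 0 <= a * b by rewrite mulr_ge0.
  have -> : e^-1 * a ^+ 2 + e * b ^+ 2 = e^-1 * (a - e * b) ^+ 2 + 2 * (a * b).
    by field; rewrite gt_eqF.
  lra.
rewrite (ge0_integralDZ (ltW e1) (ltW e0)); first 1 last.
- exact: measurable_sqnormc.
- exact: measurable_sqnormc.
- by move=> x; rewrite lee_fin sqr_ge0.
- by move=> x; rewrite lee_fin sqr_ge0.
rewrite mulrDr mulr1 EFinD EFinM fineK//; apply: leeD => //.
rewrite (_ : e%:E = (e^-1)%:E * (e ^+ 2)%:E)%E.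
  by rewrite lee_pmul2l// ?lte_fin.
by rewrite -EFinM expr2 mulKf ?gt_eqF.
Qed.

(** What the square of a seminorm satisfies: [2 * a * b <= eta * a ^+ 2 + b ^+ 2 / eta] gives the
    factors [1 + eta] and [1 + 1 / eta], and the latter is at most [2 / eta] for [eta <= 1]. This
    form sums over indices and makes sense for infinite values. *)
Definition quasi_triangle (q : ('cV[R]_d -> R[i]) -> \bar R) :=
  forall f r eta, L2 f -> L2 r -> 0 < eta <= 1 ->
    (q (fun x => f x + r x)%R <= (1 + eta)%:E * q f + (2 / eta)%:E * q r)%E.

Definition continuous_at0 (q : ('cV[R]_d -> R[i]) -> \bar R) :=
  forall e : R, 0 < e -> exists2 e1, 0 < e1 &
    forall r, L2 r -> (sqnorm2 r <= e1%:E -> q r <= e%:E)%E.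

Lemma sqr_quasi_triangle (a b c eta : R) : 0 <= a -> 0 <= b -> 0 <= c ->
  c <= a + b -> 0 < eta <= 1 -> c ^+ 2 <= (1 + eta) * a ^+ 2 + 2 / eta * b ^+ 2.
Proof.
move=> a0 b0 c0 cab /andP[e0 e1].
have h1 : c ^+ 2 <= (a + b) ^+ 2 by rewrite ler_sqr ?nnegrE// addr_ge0.
have h2 : 0 <= eta^-1 * (eta * a - b) ^+ 2 by rewrite mulr_ge0 ?sqr_ge0// invr_ge0 ltW.
have h3 : 0 <= (eta^-1 - 1) * b ^+ 2.
  by rewrite mulr_ge0 ?sqr_ge0// subr_ge0 invf_ge1.
have -> : (1 + eta) * a ^+ 2 + 2 / eta * b ^+ 2 =
   (a + b) ^+ 2 + eta^-1 * (eta * a - b) ^+ 2 + (eta^-1 - 1) * b ^+ 2.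
  by field; rewrite gt_eqF.
lra.
Qed.

Lemma quasi_triangle_sqnorm2 (c : R) : 0 <= c ->
  quasi_triangle (fun f => c%:E * sqnorm2 f)%E.
Proof.
move=> c0 f r eta [mf foo] [mr roo] eta01; have /andP[e0 e1] := eta01.
rewrite muleCA [X in (_ <= _ + X)%E]muleCA -ge0_muleDr; first last.
- by rewrite mule_ge0 ?sqnorm2_ge0// lee_fin divr_ge0// ltW.
- by rewrite mule_ge0 ?sqnorm2_ge0// lee_fin addr_ge0// ltW.
rewrite lee_wpmul2l//.
rewrite -ge0_integralDZ; first last.
- by move=> x; rewrite lee_fin sqr_ge0.
- by move=> x; rewrite lee_fin sqr_ge0.
- exact: measurable_sqnormc.
- exact: measurable_sqnormc.
- by rewrite divr_ge0// ltW.
- by rewrite addr_ge0// ltW.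
apply: ge0_le_integral; first exact: measurableT.
- by move=> x _; rewrite lee_fin sqr_ge0.
- by apply: measurable_sqnormc; exact: (cmeasD mf mr).
- by apply: emeasurable_funD; (apply: emeasurable_funM; first exact: measurable_cst);
    exact: measurable_sqnormc.
move=> x _; rewrite -!EFinM -EFinD lee_fin.
by apply: sqr_quasi_triangle => //;
  [exact: normc_ge0|exact: normc_ge0|exact: normc_ge0|exact: le_normcD].
Qed.

Lemma continuous_at0_sqnorm2 (c : R) : 0 <= c ->
  continuous_at0 (fun f => c%:E * sqnorm2 f)%E.
Proof.
move=> c0 e e0; have c1 : 0 < c + 1 by rewrite ltr_wpDl.
exists (e / (c + 1)) => [|r Lr re]; first by rewrite divr_gt0.
apply: (@le_trans _ _ ((c + 1)%:E * sqnorm2 r)%E).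
  by rewrite lee_wpmul2r ?sqnorm2_ge0// lee_fin lerDl.
rewrite (_ : e = (c + 1) * (e / (c + 1))); last by rewrite mulrC divfK// gt_eqF.
by rewrite EFinM lee_pmul2l.
Qed.

Lemma quasi_triangle_esum (I : choiceType) (D : set I) (g : I -> 'cV[R]_d -> R[i]) :
  (forall i, L2 (g i)) ->
  quasi_triangle (fun f => \esum_(i in D) (normc (inner2 f (g i)) ^+ 2)%:E)%E.
Proof.
move=> Lg f r eta Lf Lr eta01; have /andP[e0 e1] := eta01.
have s0 u i : (0 <= (normc (inner2 u (g i)) ^+ 2)%:E)%E by rewrite lee_fin sqr_ge0.
have a0 : 0 < 1 + eta by rewrite addr_gt0.
have b0 : 0 < 2 / eta by rewrite divr_gt0.
rewrite -(ge0_esumZl D a0 (s0 f)) -(ge0_esumZl D b0 (s0 r)).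
rewrite -esumD; first last.
- by move=> i _; rewrite mule_ge0// lee_fin ltW.
- by move=> i _; rewrite mule_ge0// lee_fin ltW.
apply: le_esum => i _; rewrite -!EFinM -EFinD lee_fin inner2D//.
by apply: sqr_quasi_triangle => //;
  [exact: normc_ge0|exact: normc_ge0|exact: normc_ge0|exact: le_normcD].
Qed.

Lemma continuous_at0_esum (I : choiceType) (D : set I) (g : I -> 'cV[R]_d -> R[i]) :
  finite_set D -> (forall i, L2 (g i)) ->
  continuous_at0 (fun f => \esum_(i in D) (normc (inner2 f (g i)) ^+ 2)%:E)%E.
Proof.
move=> fD Lg e e0; pose k i := (1 + fine (sqnorm2 (g i))) ^+ 2.
pose K := 1 + \sum_(i <- finmap.enum_fset (fset_set D)) k i.
have K0 : 0 < K by rewrite ltr_wpDr// sumr_ge0// => i _; rewrite sqr_ge0.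
exists (e / K) => [|r Lr re]; first by rewrite divr_gt0.
rewrite esum_fset//; last by move=> i _; rewrite lee_fin sqr_ge0.
rewrite fsbig_finite// sumEFin lee_fin.
pose e1 := Num.sqrt (e / K).
have e10 : 0 < e1 by rewrite sqrtr_gt0 divr_gt0.
have e1E : e1 ^+ 2 = e / K by rewrite sqr_sqrtr// ltW// divr_gt0.
apply: (@le_trans _ _ (\sum_(i <- finmap.enum_fset (fset_set D)) (e / K) * k i)).
  apply: ler_sum => i _; rewrite -e1E -exprMn.
  apply: lerXn2r; rewrite ?nnegrE; first exact: normc_ge0.
    by rewrite mulr_ge0 ?(ltW e10)// addr_ge0// fine_ge0// sqnorm2_ge0.
  by apply: normc_inner2_small => //; rewrite e1E.
rewrite -mulr_sumr mulrAC ler_pdivrMr// ler_wpM2l ?ltW// /K; lra.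
Qed.

(** With s a step function close to f, [q1 f] is compared with [q1 s], then with [q2 s], then with
    [q2 f]; each change of function costs a factor [1 + eta] and a small remainder. *)
Lemma le_L2_of_step (q1 q2 : ('cV[R]_d -> R[i]) -> \bar R) :
  quasi_triangle q1 -> quasi_triangle q2 ->
  continuous_at0 q1 -> continuous_at0 q2 ->
  (forall f, 0 <= q2 f)%E ->
  (forall s, is_step s -> q1 s <= q2 s)%E -> forall f, L2 f -> (q1 f <= q2 f)%E.
Proof.
move=> t1 t2 c1 c2 q20 q12 f Lf; have [mf foo] := Lf.
have [q2oo|] := eqVneq (q2 f) +oo%E; first by rewrite q2oo leey.
rewrite -ltey => q2oo; have q2fin : q2 f \is a fin_num by rewrite ge0_fin_numE.
rewrite -(fineK q2fin); set b := fine (q2 f).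
have b0 : 0 <= b by rewrite fine_ge0.
apply/lee_addgt0Pr => e e0.
(* Both factors and both remainders together exceed b by at most [eta * (3 * b + 6)], using
   [eta <= 1] on the quadratic terms. *)
pose eta := Num.min 1 (e / (3 * b + 6)).
have b6 : 0 < 3 * b + 6 by rewrite ltr_wpDl// mulr_ge0.
have eta0 : 0 < eta by rewrite lt_min ltr01/= divr_gt0.
have eta1 : eta <= 1 by rewrite ge_min lexx.
have etae : eta * (3 * b + 6) <= e by rewrite -ler_pdivlMr// ge_min lexx orbT.
have eta2 : 0 < eta ^+ 2 by rewrite exprn_gt0.
(* The tolerance [eta ^+ 2] offsets the factor [2 / eta], leaving [2 * eta]. *)
have [d1 d10 cq1] := c1 _ eta2; have [d2 d20 cq2] := c2 _ eta2.
have foo0 : (wint 0 f < +oo)%E by rewrite wint0E.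
have [_ ap] := step_approx_wint (lexx 0) mf foo0.
have d120 : 0 < Num.min d1 d2 by rewrite lt_min d10.
have [s ss] := ap _ d120; rewrite wint0E => fs {ap}.
have Ls := L2_step ss.
have Lfs := L2B Lf Ls; have Lsf := L2B Ls Lf.
have sfE : sqnorm2 (fun x => s x - f x) = sqnorm2 (fun x => f x - s x).
  by apply: eq_integral => x _; rewrite -opprB normcN.
have eta01 : 0 < eta <= 1 by rewrite eta0.
have r1 : (q1 (fun x => f x - s x)%R <= (eta ^+ 2)%:E)%E.
  by apply: (cq1 _ Lfs); apply: le_trans fs _; rewrite lee_fin ge_min lexx.
have r2 : (q2 (fun x => s x - f x)%R <= (eta ^+ 2)%:E)%E.
  apply: (cq2 _ Lsf); rewrite sfE; apply: le_trans fs _.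
  by rewrite lee_fin ge_min lexx orbT.
have h1 := t1 _ _ _ Ls Lfs eta01; have h2 := t2 _ _ _ Lf Lsf eta01.
rewrite (_ : (fun x => s x + (f x - s x)) = f) in h1; last first.
  by apply/funext => x; rewrite addrC subrK.
rewrite (_ : (fun x => f x + (s x - f x)) = s) in h2; last first.
  by apply/funext => x; rewrite addrC subrK.
have x0 : (0 <= (1 + eta)%:E)%E by rewrite lee_fin addr_ge0// ltW.
have y0 : (0 <= (2 / eta)%:E)%E by rewrite lee_fin divr_ge0// ltW.
have h3 : (q2 s <= ((1 + eta) * b + 2 * eta)%:E)%E.
  apply: le_trans h2 _; rewrite [leRHS]EFinD; apply: leeD.
    by rewrite [leRHS]EFinM /b fineK.
  apply: le_trans (lee_wpmul2l y0 r2) _; rewrite -EFinM lee_fin expr2 mulrA divfK ?gt_eqF//.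
apply: le_trans h1 _.
apply: (@le_trans _ _ (((1 + eta) * ((1 + eta) * b + 2 * eta))%:E + (2 * eta)%:E)%E).
  apply: leeD.
    by rewrite EFinM; apply: (lee_wpmul2l x0); exact: (le_trans (q12 _ ss) h3).
  by apply: le_trans (lee_wpmul2l y0 r1) _; rewrite -EFinM lee_fin expr2 mulrA divfK ?gt_eqF.
rewrite -!EFinD lee_fin; apply: le_trans (_ : b + eta * (3 * b + 6) <= _); last by rewrite lerD2l.
have hb : 0 <= eta * b by rewrite mulr_ge0// ltW.
have hbb : eta * (eta * b) <= eta * b by rewrite ler_piMl.
have hee : eta * eta <= eta by rewrite ler_piMl// ltW.
rewrite (_ : (1 + eta) * ((1 + eta) * b + 2 * eta) + 2 * eta =
  b + 2 * (eta * b) + eta * (eta * b) + 4 * eta + 2 * (eta * eta)); last by ring.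
rewrite (_ : b + eta * (3 * b + 6) = b + 3 * (eta * b) + 6 * eta); last by ring.
lra.
Qed.

End L2_theory.

(** * The Fourier transform *)

Section fourier_transform.
Context (R : realType) (d : nat).
Local Notation mu := (leb R d).
Local Notation L := (leb_space R d).
Local Notation lmeas := (@cmeas _ (leb_space R d) R).
Implicit Types (f g h : 'cV[R]_d -> R[i]) (x y xi : 'cV[R]_d).

Lemma dotpC x y : dotp x y = dotp y x.
Proof. by apply: eq_bigr => i _; rewrite mulrC. Qed.

Lemma dotpBl x y xi : dotp (x - y) xi = dotp x xi - dotp y xi.
Proof. by rewrite /dotp -sumrB; apply: eq_bigr => i _; rewrite !mxE mulrBl. Qed.

Lemma dotp_mulmx (A : 'M[R]_d) x xi : dotp (A *m x) xi = dotp x (A^T *m xi).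
Proof.
rewrite /dotp; under eq_bigr do rewrite mxE mulr_suml.
rewrite exchange_big; apply: eq_bigr => i _.
rewrite mxE mulr_sumr; apply: eq_bigr => j _.
by rewrite mxE mulrA [A j i * _]mulrC.
Qed.

Lemma measurable_dotp d1 (T : measurableType d1) (u v : T -> L) :
  measurable_fun setT u -> measurable_fun setT v ->
  measurable_fun setT (fun t => dotp (u t) (v t)).
Proof.
move=> mu0 mv; apply: measurable_sum => i; apply: measurable_funM.
  exact: (measurableT_comp (measurable_coord i) mu0).
exact: (measurableT_comp (measurable_coord i) mv).
Qed.

Lemma cmeas_wave d1 (T : measurableType d1) (c : R) (u v : T -> L) :
  measurable_fun setT u -> measurable_fun setT v ->
  cmeas (fun t => expi (c * dotp (u t) (v t))).
Proof.
move=> mu0 mv; apply: cmeas_expi; apply: measurable_funM; first exact: measurable_cst.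
exact: measurable_dotp.
Qed.

Lemma waveNE x xi : expi (- (2 * pi * dotp x xi)) = expi (- (2 * pi) * dotp x xi) :> R[i].
Proof. by rewrite mulNr. Qed.

Lemma cintegrable_wave (c : R) f xi : cintegrable mu f ->
  cintegrable mu (fun x => f x * expi (c * dotp x xi)).
Proof.
move=> fi; rewrite (_ : (fun x => _) = fun x => expi (c * dotp x xi) * f x); last first.
  by apply/funext => x; rewrite mulrC.
apply: (@cintegrableMl _ L R mu _ 1 f _ _ fi).
  exact: (@cmeas_wave _ L c id (fun=> xi) (@measurable_id _ _ _) (@measurable_cst _ _ _ _ _ _)).
by move=> x; rewrite normc_expi.
Qed.

Lemma cmeas_fourier f : lmeas f -> lmeas (fourier f).
Proof.
move=> mf; apply: (@cmeas_cint _ _ L L R mu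
  (fun z => f z.2 * expi (- (2 * pi * dotp z.2 z.1)))).
apply: cmeasM; first exact: (cmeas_comp measurable_snd mf).
rewrite (_ : (fun z => _) = fun z : L * L => expi (- (2 * pi) * dotp z.2 z.1)).
  exact: cmeas_wave.
by apply/funext => z; rewrite waveNE.
Qed.

Lemma normc_fourier_le f xi : cintegrable mu f ->
  ((normc (fourier f xi))%:E <= \int[mu]_x (normc (f x))%:E)%E.
Proof.
move=> fi; have := cintegrable_wave (- (2 * pi)) xi fi.
under eq_fun do rewrite -waveNE.
move=> /normc_cint_le => /le_trans; apply.
by under eq_integral do rewrite normcM normc_expi mulr1.
Qed.

Lemma integral_normc_le_wint f : lmeas f ->
  (\int[mu]_x (normc (f x))%:E <= wint 1 f)%E.
Proof.
move=> mf; apply: ge0_le_integral; first exact: measurableT.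
- by move=> x _; rewrite lee_fin; exact: normc_ge0.
- by apply/measurable_EFinP; exact: cmeas_normc.
- by apply/measurable_EFinP; exact: measurable_wt.
- by move=> x _; rewrite lee_fin /wt mul1r lerDl sqr_ge0.
Qed.

Lemma cintegrable_wint f : lmeas f -> (wint 1 f < +oo)%E -> cintegrable mu f.
Proof.
move=> mf foo; split; first exact: mf.
exact: le_lt_trans (integral_normc_le_wint mf) foo.
Qed.

Lemma ler_dist_normc (z w : R[i]) : `|normc z - normc w| <= normc (z - w).
Proof.
have h1 := le_normcD (z - w) w; have h2 := le_normcD (w - z) z.
rewrite subrK in h1; rewrite subrK -opprB normcN in h2.
by rewrite ler_norml; apply/andP; split; lra.
Qed.

Lemma fourierB f g xi : cintegrable mu f -> cintegrable mu g ->
  fourier (fun x => f x - g x) xi = fourier f xi - fourier g xi.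
Proof.
move=> fi gi; have fw := cintegrable_wave (- (2 * pi)) xi fi.
have gw := cintegrable_wave (- (2 * pi)) xi gi.
rewrite /fourier; under eq_cint do rewrite waveNE.
under [X in _ = X - _]eq_cint do rewrite waveNE.
under [X in _ = _ - X]eq_cint do rewrite waveNE.
rewrite -[X in _ = _ + X]mulN1r -(cintZ (-1) gw) -(cintD fw (cintegrableZ (-1) gw)).
by apply: eq_cint => x; rewrite mulrBl mulN1r.
Qed.

Lemma limn_einf_le (u : (\bar R)^nat) (c : \bar R) : (forall n, u n <= c)%E ->
  (limn_einf u <= c)%E.
Proof.
move=> uc; rewrite limn_einf_lim; apply: lime_le; first exact: is_cvg_einfs.
apply: nearW => n; apply: le_trans (uc n).
by apply: ereal_inf_lbound; exists n => /=.
Qed.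

(** Convergence in L^1 makes the transforms converge pointwise, while the L^2 part of the weight
    bounds their norms through Plancherel. Only finiteness is wanted, so the factor 2 of [wintD]
    does no harm. *)
Lemma sqnorm2_fourier_lty f : lmeas f -> (wint 1 f < +oo)%E ->
  (sqnorm2 (fourier f) < +oo)%E.
Proof.
move=> mf foo; have fi := cintegrable_wint mf foo.
have [_ ap] := step_approx_wint ler01 mf foo.
have [s sP] : {s : nat -> 'cV[R]_d -> R[i] & forall n, is_step (s n) /\
    (wint 1 (fun x => f x - s n x)%R <= (n.+1%:R^-1)%:E)%E}.
  apply: (@choice _ _ (fun n (s : 'cV[R]_d -> R[i]) => is_step s /\
    (wint 1 (fun x => f x - s x)%R <= (n.+1%:R^-1)%:E)%E)) => n.
  have n0 : (0 : R) < n.+1%:R^-1 by rewrite invr_gt0.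
  by have [s ss fs] := ap _ n0; exists s.
have ms n : lmeas (s n) by apply: cmeas_is_step; have [] := sP n.
have mfs n : lmeas (fun x => f x - s n x) := cmeasB mf (ms n).
have msf n : lmeas (fun x => s n x - f x) := cmeasB (ms n) mf.
have fsoo n : (wint 1 (fun x => f x - s n x)%R < +oo)%E.
  by apply: le_lt_trans (ltry _); have [_] := sP n; exact.
have sbound n : (wint 1 (s n) <= 2%:E * (wint 1 f + 1%:E))%E.
  rewrite (_ : s n = fun x => f x + (s n x - f x)); last first.
    by apply/funext => x; rewrite addrC subrK.
  apply: (le_trans (wintD ler01 mf (msf n))).
  rewrite lee_pmul2l// leeD2l//.
  rewrite (_ : wint 1 _ = wint 1 (fun x => f x - s n x)); last first.
    by apply: eq_integral => x _; rewrite /wt -opprB normcN.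
  have [_ /le_trans] := sP n; apply.
  by rewrite lee_fin invf_le1// ler1n.
have soo n : (wint 1 (s n) < +oo)%E.
  by apply: le_lt_trans (sbound n) _; rewrite lte_mul_pinfty// lte_add_pinfty// ltry.
have si n := cintegrable_wint (ms n) (soo n).
have fsi n := cintegrable_wint (mfs n) (fsoo n).
have cvg_s xi : (normc (fourier (s n) xi) ^+ 2)%:E @[n --> \oo] -->
    (normc (fourier f xi) ^+ 2)%:E.
  apply: cvg_EFin; first exact: nearW.
  have cn : normc (fourier (s n) xi) @[n --> \oo] --> normc (fourier f xi).
    apply/cvgrPdist_le => e e0; near=> n.
    have : normc (fourier f xi - fourier (s n) xi) <= e.
      rewrite -fourierB// -lee_fin.
      apply: (le_trans (normc_fourier_le xi (fsi n))).
      apply: (@le_trans _ _ (wint 1 (fun x => f x - s n x))).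
        exact: integral_normc_le_wint (mfs n).
      have [_ /le_trans] := sP n; apply; rewrite lee_fin.
      apply: ltW; near: n; exact: (near_infty_natSinv_lt (PosNum e0)).
    exact: le_trans (ler_dist_normc _ _).
  rewrite (_ : fine \o _ = fun n => normc (fourier (s n) xi) * normc (fourier (s n) xi)).
    by rewrite expr2; apply: cvgM.
  by apply/funext => n; rewrite /= expr2.
have mF g : lmeas g -> measurable_fun [set: L] (fun xi => (normc (fourier g xi) ^+ 2)%:E).
  by move=> mg; apply: measurable_sqnormc; exact: cmeas_fourier.
apply: (@le_lt_trans _ _ (2%:E * (wint 1 f + 1%:E))%E); last first.
  by rewrite lte_mul_pinfty// lte_add_pinfty// ltry.
rewrite /sqnorm2 (_ : \int[mu]_x _ = \int[mu]_xi
    limn_einf (fun n => (normc (fourier (s n) xi) ^+ 2)%:E))%E; last first.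
  apply: eq_integral => xi _; rewrite is_cvg_limn_einfE; last first.
    by apply/cvg_ex; exists ((normc (fourier f xi) ^+ 2)%:E); exact: cvg_s.
  by apply/esym/cvg_lim; [|exact: cvg_s].
apply: le_trans (fatou mu measurableT (fun n => mF _ (ms n)) _) _.
  by move=> n x _; rewrite lee_fin sqr_ge0.
apply: limn_einf_le => n; apply: le_trans (sbound n).
apply: le_trans (le_sqnorm2_wint (ms n)).
have [[t st] _] := sP n; rewrite (_ : s n = stepf t); last exact/funext.
by have [<- _] := plancherel_stepf t.
Unshelve. all: by end_near.
Qed.

(** This transfers measurability and square-integrability from [fourier] to the inverse
    transform. *)
Lemma inv_fourierE h y : cintegrable mu h ->
  inv_fourier h y = (fourier (fun xi => (h xi)^*) y)^*.
Proof.
move=> hi; have hw := cintegrable_wave (2 * pi) y hi.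
rewrite (_ : inv_fourier h y = cint mu (fun xi =>
    h xi * expi (2 * pi * dotp xi y))); last first.
  by apply: eq_cint => xi; rewrite dotpC.
rewrite (_ : fourier _ y = cint mu (fun xi => (h xi * expi (2 * pi * dotp xi y))^*)).
  by rewrite cint_conj// conjCK.
by apply: eq_cint => xi; rewrite rmorphM/= expiN.
Qed.

Lemma L2_inv_fourier h : lmeas h -> (wint 1 h < +oo)%E -> L2 (inv_fourier h).
Proof.
move=> mh hoo; have hi := cintegrable_wint mh hoo.
have mch : lmeas (fun xi => (h xi)^*) := cmeas_conj mh.
rewrite (_ : inv_fourier h = fun y => (fourier (fun xi => (h xi)^*) y)^*); last first.
  by apply/funext => y; exact: inv_fourierE.
split; first exact: (cmeas_conj (cmeas_fourier mch)).
rewrite (_ : sqnorm2 _ = sqnorm2 (fourier (fun xi => (h xi)^*))); last first.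
  by apply: eq_integral => y _; rewrite normc_conj.
apply: sqnorm2_fourier_lty; first exact: mch.
apply: le_lt_trans hoo; rewrite le_eqVlt; apply/orP; left; apply/eqP.
by apply: eq_integral => y _; rewrite /wt normc_conj.
Qed.

Lemma inv_fourierB h x y : inv_fourier h (y - x) =
  inv_fourier (fun xi => h xi * expi (- (2 * pi * dotp x xi))) y.
Proof.
apply: eq_cint => xi; rewrite -[RHS]mulrA -expiD; congr (_ * expi _).
by rewrite dotpBl mulrBr addrC.
Qed.

Lemma L2_linear (A : 'M[R]_d) f : A \in unitmx -> L2 f -> L2 (fun y => f (A *m y)).
Proof.
move=> uA [mf foo]; split; first exact: (cmeas_comp (measurable_linear uA) mf).
have dA : 0 < `|\det A| by rewrite normr_gt0 -unitfE -unitmxE.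
have := @ge0_integral_linear R d A (fun x => (normc (f x) ^+ 2)%:E) uA (measurable_sqnormc mf).
move=> /(_ (fun x => _)) AE; rewrite -/(sqnorm2 f) in AE.
have {}AE : (`|\det A|%:E * sqnorm2 (fun y => f (A *m y)) = sqnorm2 f)%E.
  by apply: AE => x; rewrite lee_fin sqr_ge0.
move: foo; rewrite -AE; have := sqnorm2_ge0 (fun y => f (A *m y)).
by case: (sqnorm2 _) => [r _ _| |]//; [exact: ltry|rewrite gt0_muley].
Qed.

Lemma L2_atom (A : 'M[R]_d) (c : R[i]) x h : A \in unitmx ->
  lmeas h -> (wint 1 h < +oo)%E ->
  L2 (fun y => c * inv_fourier h (A *m y - x)).
Proof.
move=> uA mh hoo; apply: L2Z.
(* The translation by x is absorbed into h as a modulation, which leaves the modulus unchanged. *)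
pose H xi := h xi * expi (- (2 * pi * dotp x xi)).
have mH : lmeas H.
  apply: (cmeasM mh); rewrite (_ : (fun xi => _) = fun xi => expi (- (2 * pi) * dotp x xi)).
    exact: (@cmeas_wave _ L _ (fun=> x) id (@measurable_cst _ _ _ _ _ _) (@measurable_id _ _ _)).
  by apply/funext => xi; rewrite waveNE.
have Hoo : (wint 1 H < +oo)%E.
  apply: le_lt_trans hoo; rewrite le_eqVlt; apply/orP; left; apply/eqP.
  by apply: eq_integral => y _; rewrite /wt /H normcM normc_expi mulr1.
rewrite (_ : (fun y => _) = fun y => inv_fourier H (A *m y)); last first.
  by apply/funext => y; rewrite inv_fourierB.
exact: L2_linear uA (L2_inv_fourier mH Hoo).
Qed.

Lemma inner2_atom (A : 'M[R]_d) (c : R) x s h : A \in unitmx ->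
  cintegrable mu s -> cintegrable mu h ->
  inner2 s (fun y => c%:C * inv_fourier h (A *m y - x)) =
  cint mu (fun xi => c%:C * fourier s (A^T *m xi) * (h xi)^* * expi (2 * pi * dotp x xi)).
Proof.
move=> uA si hi; have [ms soo] := si; have [mh hoo] := hi.
pose k (z : L * L) := s z.1 * (c%:C * (h z.2 * expi (2 * pi * dotp (A *m z.1 - x) z.2)))^*.
(* Up to a unimodular factor, k is a tensor product of two integrable functions. Fubini thus needs
   only s and h to be integrable, not the inverse transform of h. *)
have ki : cintegrable (mu \x mu)%E k.
  rewrite (_ : k = fun z => expi (- (2 * pi) * dotp (A *m z.1 - x) z.2) *
      (s z.1 * (c%:C * (h z.2)^*))); last first.
    apply/funext => z; rewrite /k !rmorphM/= -expiN conj_RtoC mulNr.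
    by ring.
  apply: (@cintegrableMl _ _ _ _ _ 1); last first.
  - exact: (cintegrable_tensor si (cintegrableZ c%:C (cintegrable_conj hi))).
  - by move=> z; rewrite normc_expi.
  - apply: cmeas_expi; apply: measurable_funM; first exact: measurable_cst.
    under eq_fun do rewrite dotpBl.
    apply: measurable_funB; last exact: measurable_dotp.
    apply: measurable_dotp; last exact: measurable_snd.
    exact: (measurableT_comp (measurable_linear uA) measurable_fst).
rewrite (_ : inner2 _ _ = cint mu (fun y => cint mu (fun xi => k (y, xi)))); last first.
  apply: eq_cint => y; have hw := cintegrable_wave (2 * pi) (A *m y - x) hi.
  have hw' : cintegrable mu (fun xi => h xi * expi (2 * pi * dotp (A *m y - x) xi)).
    by under eq_fun do rewrite dotpC.
  rewrite /k /inv_fourier -/(cint mu _) -(cintZ c%:C hw') -(cint_conj (cintegrableZ c%:C hw')).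
  by rewrite -(cintZ (s y) (cintegrable_conj (cintegrableZ c%:C hw'))).
rewrite (cfubini ki); apply: eq_cint => xi; rewrite /k/=.
have sw := cintegrable_wave (- (2 * pi)) (A^T *m xi) si.
rewrite (_ : fourier s (A^T *m xi) = cint mu (fun y => s y * expi (- (2 * pi) * dotp y (A^T *m xi)))).
  rewrite (_ : _ * expi (2 * pi * dotp x xi) =
      c%:C * (h xi)^* * expi (2 * pi * dotp x xi) *
      cint mu (fun y => s y * expi (- (2 * pi) * dotp y (A^T *m xi)))); last by ring.
  rewrite -(cintZ _ sw); apply: eq_cint => y.
  rewrite !rmorphM/= -expiN conj_RtoC dotpBl dotp_mulmx.
  rewrite (_ : - (2 * pi * (dotp y (A^T *m xi) - dotp x xi)) =
     - (2 * pi) * dotp y (A^T *m xi) + 2 * pi * dotp x xi); last by ring.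
  by rewrite expiD; ring.
by apply: eq_cint => y; rewrite waveNE.
Qed.

End fourier_transform.

Local Instance ae_leb_filter (R : realType) (d : nat) :
  Filter (almost_everywhere (leb R d)) := ae_filter_ringOfSetsType (leb R d).

(** * The frame inequality *)

Section support.
Context (R : realType) (d : nat).
Local Notation mu := (leb R d).
Local Notation L := (leb_space R d).
Implicit Types (f g h : 'cV[R]_d -> R[i]) (x y xi : 'cV[R]_d).

Lemma open_rat_box (U : set 'cV[R]_d) x : open U -> U x ->
  exists q : 'cV[rat]_d * 'cV[rat]_d,
    box (map_mx ratr q.1) (map_mx ratr q.2) x /\
    box (map_mx ratr q.1) (map_mx ratr q.2) `<=` U.
Proof.
move=> oU Ux; have /nbhs_ballP[e /= e0 eU] : nbhs x U by exact: open_nbhs_nbhs.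
have lx i : x i 0 - e < x i 0 by rewrite ltrBlDr ltrDl.
have rx i : x i 0 < x i 0 + e by rewrite ltrDl.
have [a aP] : {a : 'I_d -> rat & forall i, ratr (a i) \in `]x i 0 - e, x i 0[}.
  apply: (@choice _ _ (fun i q => ratr q \in `]x i 0 - e, x i 0[)) => i.
  by have [q qP] := rat_in_itvoo (lx i); exists q.
have [b bP] : {b : 'I_d -> rat & forall i, ratr (b i) \in `]x i 0, x i 0 + e[}.
  apply: (@choice _ _ (fun i q => ratr q \in `]x i 0, x i 0 + e[)) => i.
  by have [q qP] := rat_in_itvoo (rx i); exists q.
exists (\col_i a i, \col_i b i); split => /=.
  move=> i; rewrite !mxE; have := aP i; have := bP i.
  by rewrite !in_itv/= => /andP[h1 _] /andP[_ h2]; rewrite h2 ltW.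
move=> y yab; apply: eU; split=> // i j; rewrite (ord1 j).
have := yab i; rewrite !mxE; have := aP i; have := bP i.
rewrite !in_itv/= => /andP[h1 h2] /andP[h3 h4] /andP[h5 h6].
by rewrite /ball/= ltr_distlC; apply/andP; split; lra.
Qed.

(** The complement of the support is a union of possibly uncountably many open sets on each of which
    f vanishes almost everywhere. Boxes with rational corners reduce it to countably many null
    sets. *)
Lemma ae_supp0 f : {ae mu, forall x, ~ supp f x -> f x = 0}.
Proof.
pose B (q : 'cV[rat]_d * 'cV[rat]_d) : set 'cV[R]_d :=
  box (map_mx ratr q.1) (map_mx ratr q.2).
(* Rational boxes are coded by natural numbers, with a vacuous condition where n codes none. *)
pose P (n : nat) x := if @unpickle ('cV[rat]_d * 'cV[rat]_d)%type n is Some q then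
  {ae mu, forall y, B q y -> f y = 0} -> B q x -> f x = 0 else True.
have : {ae mu, forall x, forall n, P n x}.
  apply: ae_foralln => n; rewrite /P; case: unpickle => [q|]; last exact: aeW.
  have [Bq|nBq] := pselect {ae mu, forall y, B q y -> f y = 0}.
    by apply: filterS Bq => x h _.
  by apply: aeW => x /nBq.
apply: filterS => x Px; rewrite /supp => /contrapT[U [oU fU] Ux].
have [q [Bx BU]] := open_rat_box oU Ux.
have := Px (pickle q); rewrite /P pickleK; apply => //.
by apply: filterS fU => y h By; apply: h; exact: BU.
Qed.

Lemma subset_supp f g : {ae mu, forall x, f x = 0 -> g x = 0} -> supp g `<=` supp f.
Proof.
move=> fg; apply: subsetC => x [U [oU fU] Ux]; exists U => //; split => //.
by apply: filterS2 fg fU => y h1 h2 /h2.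
Qed.

End support.

(** * Localization of transforms to Q *)

Section frame.
Context (R : realType) (d : nat).
Local Notation mu := (leb R d).
Local Notation L := (leb_space R d).
Local Notation lmeas := (@cmeas _ (leb_space R d) R).
Implicit Types (f g h : 'cV[R]_d -> R[i]) (x y xi : 'cV[R]_d).

(** Integrability of h comes from the finite measure of Q: [a + a ^+ 2 <= 1 + 2 * a ^+ 2] on Q, and
    h vanishes almost everywhere outside. *)
Lemma wint1_of_supp h (Q : set 'cV[R]_d) : measurable (Q : set L) ->
  (mu Q < +oo)%E -> L2 h -> supp h `<=` Q -> (wint 1 h < +oo)%E.
Proof.
move=> mQ Qoo [mh hoo] hQ.
apply: (@le_lt_trans _ _ (1%:E * \int[mu]_x (\1_Q x)%:E +
    2%:E * \int[mu]_x (normc (h x) ^+ 2)%:E)%E); last first.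
  rewrite integral_indic// setIT mul1e lte_add_pinfty// lte_mul_pinfty//.
have mI : measurable_fun [set: L] (fun x => (\1_Q x)%:E : \bar R).
  by apply/measurable_EFinP; exact: measurable_indic.
rewrite -(ge0_integralDZ ler01 (ler0n _ 2) mI (measurable_sqnormc mh)); first last.
- by move=> x; rewrite lee_fin sqr_ge0.
- by move=> x; rewrite lee_fin.
apply: ae_ge0_le_integral; first exact: measurableT.
- by move=> x _; rewrite lee_fin wt_ge0.
- by apply/measurable_EFinP; exact: measurable_wt.
- move=> x _; rewrite mul1e; apply: adde_ge0; first by rewrite lee_fin.
  by apply: mule_ge0; rewrite lee_fin// sqr_ge0.
- apply: emeasurable_funD; (apply: emeasurable_funM; first exact: measurable_cst).
    exact: mI.
  exact: measurable_sqnormc.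
apply: filterS (ae_supp0 h) => x hx _; rewrite -!EFinM -EFinD lee_fin /wt indicE.
case: (boolP (x \in Q)) => [_|/negP xQ].
  move: (normc (h x)) => a; have := sqr_ge0 (a - 1); have := sqr_ge0 a.
  by rewrite (_ : (a - 1) ^+ 2 = a ^+ 2 - 2 * a + 1) ?mulr1n; [lra|ring].
rewrite hx; first by rewrite normc0 !mulr0 expr0n/= mulr0 addr0.
by move=> sx; apply: xQ; apply/mem_set; exact: hQ.
Qed.

Lemma cintegrable_step s : is_step s -> cintegrable mu s.
Proof.
move=> [t st]; rewrite (_ : s = stepf t); last exact/funext.
apply: cintegrable_sum => k; apply: cintegrableZ.
by have [] := cint_charf_box k.2.1 k.2.2.
Qed.

Definition localized (A : 'M[R]_d) h s xi : R[i] :=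
  (Num.sqrt `|\det A|)%:C * fourier s (A^T *m xi) * (h xi)^*.

(** A step function is integrable, so its transform is bounded by its L^1 norm, and a bounded
    multiple of h stays in L^2. *)
Lemma localized_L2 (A : 'M[R]_d) h s : A \in unitmx -> L2 h -> is_step s ->
  L2 (localized A h s).
Proof.
move=> uA [mh hoo] ss; have si := cintegrable_step ss; have [ms soo] := si.
have uAT : A^T \in unitmx by rewrite unitmx_tr.
have mF : lmeas (fun xi => (Num.sqrt `|\det A|)%:C * fourier s (A^T *m xi)).
  apply: cmeasM; first exact: cmeas_cst.
  exact: (cmeas_comp (measurable_linear uAT) (cmeas_fourier ms)).
split; first exact: (cmeasM mF (cmeas_conj mh)).
pose C := Num.sqrt `|\det A| * fine (\int[mu]_x (normc (s x))%:E)%E.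
have sfin : (\int[mu]_x (normc (s x))%:E)%E \is a fin_num.
  by rewrite ge0_fin_numE// integral_ge0// => x _; rewrite lee_fin; exact: normc_ge0.
have FC xi : normc ((Num.sqrt `|\det A|)%:C * fourier s (A^T *m xi)) <= C.
  rewrite normcM normc_real ger0_norm ?sqrtr_ge0// ler_wpM2l ?sqrtr_ge0//.
  by rewrite -lee_fin fineK//; exact: normc_fourier_le.
apply: (@le_lt_trans _ _ ((C ^+ 2)%:E * sqnorm2 h)%E).
  rewrite -(ge0_integralZl mu measurableT (measurable_sqnormc mh)); first last.
  - by rewrite lee_fin sqr_ge0.
  - by move=> x _; rewrite lee_fin sqr_ge0.
  apply: ge0_le_integral; first exact: measurableT.
  - by move=> x _; rewrite lee_fin sqr_ge0.
  - by apply: measurable_sqnormc; exact: (cmeasM mF (cmeas_conj mh)).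
  - by apply: emeasurable_funM; [exact: measurable_cst|exact: measurable_sqnormc].
  move=> x _; rewrite -EFinM lee_fin /localized normcM normc_conj exprMn.
  rewrite ler_wpM2r ?sqr_ge0//; apply: lerXn2r; rewrite ?nnegrE; last exact: FC.
    exact: normc_ge0.
  exact: le_trans (normc_ge0 _) (FC x).
by rewrite lte_mul_pinfty// lee_fin sqr_ge0.
Qed.

Lemma localized_K (A : 'M[R]_d) h s (Q : set 'cV[R]_d) : A \in unitmx ->
  L2 h -> supp h `<=` Q -> is_step s -> K_ Q (localized A h s).
Proof.
move=> uA Lh hQ ss; split; first exact: localized_L2.
apply: subset_trans (@subset_closure _ Q); apply: subset_trans hQ.
apply: subset_supp; apply: aeW => x hx.
by rewrite /localized hx rmorph0 mulr0.
Qed.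

(** The square of the normalizing factor is the Jacobian of the substitution, so no determinant
    remains. *)
Lemma sqnorm2_localized (A : 'M[R]_d) h s : A \in unitmx -> L2 h -> is_step s ->
  sqnorm2 (localized A h s) = (\int[mu]_xi
    ((normc (fourier s xi) ^+ 2) * (normc (h (invmx A^T *m xi)) ^+ 2))%:E)%E.
Proof.
move=> uA [mh hoo] ss; have si := cintegrable_step ss; have [ms soo] := si.
have uAT : A^T \in unitmx by rewrite unitmx_tr.
have uB : invmx A^T \in unitmx by rewrite unitmx_inv.
have mhB : lmeas (fun xi => h (invmx A^T *m xi)) := cmeas_comp (measurable_linear uB) mh.
rewrite -(ge0_integral_linear uAT); first last.
- by move=> x; rewrite lee_fin mulr_ge0 ?sqr_ge0.
- apply/measurable_EFinP; apply: measurable_funM; apply: measurable_funX.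
    exact: (cmeas_normc (cmeas_fourier ms)).
  exact: (cmeas_normc mhB).
rewrite -(ge0_integralZl mu measurableT); first last.
- by rewrite lee_fin.
- by move=> x _; rewrite lee_fin mulr_ge0 ?sqr_ge0.
- apply/measurable_EFinP; apply: measurable_funM; apply: measurable_funX.
    exact: (cmeas_normc (cmeas_comp (measurable_linear uAT) (cmeas_fourier ms))).
  exact: (cmeas_normc (cmeas_comp (measurable_linear uAT) mhB)).
apply: eq_integral => x _; rewrite -EFinM mulKmx// det_tr; congr (_%:E).
rewrite /localized !normcM normc_conj normc_real !exprMn ger0_norm ?sqrtr_ge0//.
by rewrite sqr_sqrtr ?normr_ge0 ?mulrA.
Qed.

(** The indicator of Q can be inserted under the integral because h vanishes almost everywhere
    outside Q. *)
Lemma inner2_localized (A : 'M[R]_d) h s (Q : set 'cV[R]_d) x :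
  A \in unitmx -> measurable (Q : set L) -> L2 h -> (wint 1 h < +oo)%E ->
  supp h `<=` Q -> is_step s ->
  inner2 s (fun y => (Num.sqrt `|\det A|)%:C * inv_fourier h (A *m y - x)) =
  inner2 (localized A h s) (fun xi => e_ x xi * charf Q xi).
Proof.
move=> uA mQ Lh hoo hQ ss; have [mh _] := Lh.
have [mF _] := localized_L2 uA Lh ss.
have mw : lmeas (fun xi => expi (2 * pi * dotp x xi)).
  exact: (@cmeas_wave _ _ _ L _ (fun=> x) id (@measurable_cst _ _ _ _ _ _) (@measurable_id _ _ _)).
rewrite (inner2_atom _ _ uA (cintegrable_step ss) (cintegrable_wint mh hoo)).
rewrite (_ : inner2 _ _ = cint mu (fun xi =>
    localized A h s xi * (expi (2 * pi * dotp x xi) * charf Q xi))); last first.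
  apply: eq_cint => xi; congr (_ * _).
  by rewrite rmorphM/= /e_ expiN conjCK conj_RtoC.
apply: ae_eq_cint.
- exact: (cmeasM mF mw).
- exact: (cmeasM mF (cmeasM mw (cmeas_charf mQ))).
apply: filterS (ae_supp0 h) => xi hxi; rewrite mulrA /localized.
have [xQ|xQ] := boolP (xi \in Q).
  by rewrite /charf indicE xQ mulr1.
rewrite hxi ?rmorph0 ?mulr0 ?mul0r// => /hQ.
by move/negP: xQ => nQ /mem_set.
Qed.

End frame.

(** Enumerating J turns the sum into a series of nonnegative functions, to which monotone
    convergence applies. *)
Lemma ge0_integral_esum dT (T : measurableType dT) (R : realType)
    (mu : {measure set T -> \bar R}) (J : countType) (f : J -> T -> \bar R) :
  (forall j, measurable_fun [set: T] (f j)) -> (forall j x, 0 <= f j x)%E ->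
  measurable_fun [set: T] (fun x => \esum_(j in [set: J]) f j x)%E /\
  (\int[mu]_x (\esum_(j in [set: J]) f j x) =
   \esum_(j in [set: J]) \int[mu]_x f j x)%E.
Proof.
move=> mf f0; have [J0|[P [e [einj JP]]]] := countable_set_image (countableP [set: J]).
  rewrite J0 esum_set0; under eq_fun do rewrite esum_set0.
  by split; [exact: measurable_cst|rewrite integral0].
pose g n := if n \in P then f (e n) else cst 0%E.
have g0 n x : (0 <= g n x)%E by rewrite /g; case: ifP.
have fg x : (\esum_(j in [set: J]) f j x = \sum_(n <oo) g n x)%E.
  rewrite JP esum_set_image// eseries_mkcond; apply: eq_eseriesr => n _.
  by rewrite /g; case: ifP.
have mg n : measurable_fun setT (g n).
  by rewrite /g; case: ifP => // _; exact: measurable_cst.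
split; first by under eq_fun do rewrite fg; exact: ge0_emeasurable_sum.
under eq_integral do rewrite fg.
rewrite integral_nneseries// JP esum_set_image//; last first.
  by move=> n _; exact: integral_ge0.
rewrite [RHS]eseries_mkcond; apply: eq_eseriesr => n _; rewrite /g.
by case: ifP => // _; rewrite integral0.
Qed.

(** * Summation over both indices and conclusion *)

Section frame_sums.
Context (R : realType) (d : nat) (J K : countType).
Local Notation mu := (leb R d).
Local Notation L := (leb_space R d).
Local Notation lmeas := (@cmeas _ (leb_space R d) R).

Lemma sum_sqnorm2_localized (h : 'cV[R]_d -> R[i]) (A : J -> 'M[R]_d) (p P : R)
    (s : 'cV[R]_d -> R[i]) :
  (forall j, A j \in unitmx) -> L2 h -> is_step s ->
  Riesz_partition_of_unity (fun j xi => h (invmx (A j)^T *m xi)) p P ->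
  (p%:E * sqnorm2 s <= \esum_(j in [set: J]) sqnorm2 (localized (A j) h s)
    <= P%:E * sqnorm2 s)%E.
Proof.
move=> uA Lh ss [p0 pP mh riesz]; have [ms _] := cintegrable_step ss.
have mfs := cmeas_fourier ms.
have sE : sqnorm2 s = sqnorm2 (fourier s).
  have [t st] := ss; rewrite (_ : s = stepf t); last exact/funext.
  by have [-> _] := plancherel_stepf t.
pose f j xi := ((normc (fourier s xi) ^+ 2) * (normc (h (invmx (A j)^T *m xi)) ^+ 2))%:E.
have f0 j x : (0 <= f j x)%E by rewrite lee_fin mulr_ge0 ?sqr_ge0.
have mf j : measurable_fun [set: L] (f j).
  apply/measurable_EFinP; apply: measurable_funM; apply: measurable_funX.
    exact: (cmeas_normc mfs).
  exact: (cmeas_normc (mh j)).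
have [mS intS] := ge0_integral_esum mu mf f0.
rewrite (_ : \esum_(j in _) _ = \int[mu]_x \esum_(j in [set: J]) f j x)%E; last first.
  by rewrite intS; apply: eq_esum => j _; exact: sqnorm2_localized.
have S0 x : (0 <= \esum_(j in [set: J]) f j x)%E by apply: esum_ge0 => j _; exact: f0.
have fE x : (\esum_(j in [set: J]) f j x = (normc (fourier s x) ^+ 2)%:E *
    \esum_(j in [set: J]) (normc (h (invmx (A j)^T *m x)) ^+ 2)%:E)%E.
  (* [ge0_esumZl] takes a positive factor, so points where the transform vanishes are treated
     apart. *)
  have [s0|s0] := eqVneq (normc (fourier s x) ^+ 2) 0.
    by rewrite s0 mul0e esum1// => j _; rewrite /f s0 mul0r.
  by rewrite -ge0_esumZl// ?lt_def ?s0 ?sqr_ge0// => j; rewrite lee_fin sqr_ge0.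
have cE (c : R) : 0 <= c -> (c%:E * sqnorm2 s =
    \int[mu]_x (c%:E * (normc (fourier s x) ^+ 2)%:E))%E.
  move=> c0; rewrite sE (ge0_integralZl mu measurableT (measurable_sqnormc mfs))//.
  by move=> x _; rewrite lee_fin sqr_ge0.
have mc (c : R) : measurable_fun [set: L] (fun x => c%:E * (normc (fourier s x) ^+ 2)%:E)%E.
  by apply: emeasurable_funM; [exact: measurable_cst|exact: measurable_sqnormc].
have c0 (c : R) x : 0 <= c -> (0 <= c%:E * (normc (fourier s x) ^+ 2)%:E)%E.
  by move=> c0; apply: mule_ge0; rewrite lee_fin// sqr_ge0.
have pp := ltW p0; have PP := le_trans pp pP.
rewrite (cE p pp) (cE P PP); apply/andP; split.
- apply: ae_ge0_le_integral; first exact: measurableT.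
  + by move=> x _; exact: c0.
  + exact: mc.
  + by move=> x _; exact: S0.
  + exact: mS.
  apply: filterS riesz => x /andP[px _] _; rewrite fE muleC.
  by apply: lee_wpmul2l px; rewrite lee_fin sqr_ge0.
- apply: ae_ge0_le_integral; first exact: measurableT.
  + by move=> x _; exact: S0.
  + exact: mS.
  + by move=> x _; exact: c0.
  + exact: mc.
  apply: filterS riesz => x /andP[_ px] _; rewrite fE [leRHS]muleC.
  by apply: lee_wpmul2l px; rewrite lee_fin sqr_ge0.
Qed.

Lemma esum_pair (a : J -> K -> \bar R) : (forall j k, 0 <= a j k)%E ->
  (\esum_(jk in [set: J * K]) a jk.1 jk.2 =
   \esum_(j in [set: J]) \esum_(k in [set: K]) a j k)%E.
Proof.
move=> a0; rewrite esum_esum//; congr (esum _ _).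
by apply/seteqP; split.
Qed.

End frame_sums.

Theorem theorem3p1 (R : realType) (d : nat) (J K : countType)
    (Q : set 'cV[R]_d) (h : 'cV[R]_d -> R[i]) (A : J -> 'M[R]_d)
    (p P : R) (x : J -> K -> 'cV[R]_d) (m_ M_ : J -> R) (m M : R) :
  let B := fun j => invmx (A j)^T in
  let S := fun j => [set (A j)^T *m q | q in Q] in
  let h_ := fun j xi => h (B j *m xi) in
  let psi := inv_fourier h in
  measurable (Q : set (leb_space R d)) ->
  (leb R d Q < +oo)%E ->
  L2 h ->
  (forall j, A j \in unitmx) ->
  \bigcup_j S j = [set: 'cV[R]_d] ->
  Riesz_partition_of_unity h_ p P ->
  supp h `<=` Q ->
  (forall j, is_frame (K_ Q) (fun k xi => e_ (x j k) xi * charf Q xi)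
               (m_ j) (M_ j)) ->
  m%:E = ereal_inf (range (fun j => (m_ j)%:E)) -> 0 < m ->
  M%:E = ereal_sup (range (fun j => (M_ j)%:E)) ->
  is_frame (@L2 R d)
    (fun (jk : J * K) y =>
       (Num.sqrt `|\det (A jk.1)|)%:C * psi (A jk.1 *m y - x jk.1 jk.2))
    (m * p) (M * P).
Proof.
move=> B S h_ psi mQ Qoo Lh uA cover riesz hQ fr mE m0 ME.
have [p0 pP _ _] := riesz; have P0 := lt_le_trans p0 pP.
have mm j : m <= m_ j by rewrite -lee_fin mE; apply: ereal_inf_lbound; exists j.
have MM j : M_ j <= M by rewrite -lee_fin ME; apply: ereal_sup_ubound; exists j.
(* The origin lies in some [S j], so J is inhabited and M is at least a positive [M_ j]. *)
have M0 : 0 < M.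
  have : [set: 'cV[R]_d] 0 by [].
  by rewrite -cover => -[j _ _]; have [_ Mj _ _] := fr j; exact: lt_le_trans Mj (MM j).
have hoo := wint1_of_supp mQ Qoo Lh hQ; have [mh _] := Lh.
set g := fun (jk : J * K) y => _.
have Lg jk : L2 (g jk) by exact: L2_atom (uA jk.1) mh hoo.
pose T f := (\esum_(jk in [set: J * K]) (normc (inner2 f (g jk)) ^+ 2)%:E)%E.
have step s : is_step s ->
    ((m * p)%:E * sqnorm2 s <= T s <= (M * P)%:E * sqnorm2 s)%E.
  move=> ss; pose F j := localized (A j) h s.
  pose a j k := (normc (inner2 (F j) (fun xi => e_ (x j k) xi * charf Q xi)) ^+ 2)%:E.
  have a0 j k : (0 <= a j k)%E by rewrite lee_fin sqr_ge0.
  have -> : T s = (\esum_(j in [set: J]) \esum_(k in [set: K]) a j k)%E.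
    rewrite -(esum_pair a0); apply: eq_esum => -[j k] _.
    by rewrite /a /F -(inner2_localized (x j k) (uA j) mQ Lh hoo hQ ss).
  have frj j : (m%:E * sqnorm2 (F j) <= \esum_(k in [set: K]) a j k
      <= M%:E * sqnorm2 (F j))%E.
    have [_ _ _ /(_ _ (localized_K (uA j) Lh hQ ss))/andP[h1 h2]] := fr j.
    apply/andP; split.
      by apply: le_trans h1; apply: lee_wpmul2r; [exact: sqnorm2_ge0|rewrite lee_fin].
    by apply: (le_trans h2); apply: lee_wpmul2r; [exact: sqnorm2_ge0|rewrite lee_fin].
  have /andP[h1 h2] := sum_sqnorm2_localized uA Lh ss riesz.
  have N0 j : (0 <= sqnorm2 (F j))%E := sqnorm2_ge0 _.
  rewrite !EFinM -!muleA; apply/andP; split.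
    apply: (@le_trans _ _ (m%:E * \esum_(j in [set: J]) sqnorm2 (F j))%E).
      by rewrite lee_pmul2l.
    rewrite -ge0_esumZl//; apply: le_esum => j _.
    by have /andP[] := frj j.
  apply: (@le_trans _ _ (M%:E * \esum_(j in [set: J]) sqnorm2 (F j))%E).
    rewrite -ge0_esumZl//; apply: le_esum => j _.
    by have /andP[] := frj j.
  by rewrite lee_pmul2l.
have MP0 : 0 <= M * P by rewrite mulr_ge0// ltW.
have mp0 : 0 <= m * p by rewrite mulr_ge0// ltW.
have q0 (c : R) f : 0 <= c -> (0 <= c%:E * sqnorm2 f)%E.
  by move=> c0; apply: mule_ge0; [rewrite lee_fin|exact: sqnorm2_ge0].
have upper f : L2 f -> (T f <= (M * P)%:E * sqnorm2 f)%E.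
  (* The full sum is not yet known to be continuous at 0, but finite subsums are; the bound is
     extended from step functions for each of them before taking the supremum. *)
  move=> Lf; apply: ge_ereal_sup => _ [X [finX _] <-].
  rewrite -esum_fset//; last by move=> i _; rewrite lee_fin sqr_ge0.
  apply: (@le_L2_of_step _ _ (fun f => \esum_(jk in X) (normc (inner2 f (g jk)) ^+ 2)%:E)%E
    (fun f => (M * P)%:E * sqnorm2 f)%E) Lf => //.
  - exact: quasi_triangle_esum.
  - exact: quasi_triangle_sqnorm2.
  - exact: continuous_at0_esum.
  - exact: continuous_at0_sqnorm2.
  - by move=> u; exact: q0.
  move=> s ss; have /andP[_] := step s ss; apply: le_trans.
  rewrite esum_fset//; last by move=> i _; rewrite lee_fin sqr_ge0.
  by apply: ereal_sup_ubound; exists X.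
split; [exact: mulr_gt0|exact: mulr_gt0|exact: Lg|move=> f Lf].
apply/andP; split; last exact: upper.
apply: (@le_L2_of_step _ _ (fun f => (m * p)%:E * sqnorm2 f)%E T) Lf.
- exact: quasi_triangle_sqnorm2.
- exact: quasi_triangle_esum.
- exact: continuous_at0_sqnorm2.
- move=> e e0; have [e1 e10 he] := continuous_at0_sqnorm2 d MP0 e0.
  by exists e1 => // r Lr re; apply: le_trans (upper r Lr) (he r Lr re).
- by move=> u; apply: esum_ge0 => i _; rewrite lee_fin sqr_ge0.
- by move=> s ss; have /andP[] := step s ss.
Qed.
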